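(* Let $\alpha\in(1,2)$ and $\rho\in(0,1)$ with $\alpha\rho,\alpha\hat\rho\in(0,1)$, where $\hat\rho=1-\rho$. Let $\tilde\xi$ be a Lévy process with characteristic exponent \[ \tilde\Psi(z)=\frac{\Gamma(\alpha\rho-iz)}{\Gamma(-iz)}\frac{\Gamma(1-\alpha\rho+iz)}{\Gamma(1-\alpha+iz)},\qquad z\in\mathbb{R}, \] issued from $0$, and let $\tilde u$ be the density of its potential measure, $\int_0^\infty\mathbf{P}(\tilde\xi_t\in dx)dt=\tilde u(x)dx$. Then for $x>0$, \[ \tilde u(x)=-\frac1\pi\Gamma(1-\alpha)\sin(\pi\alpha\rho)\big[1-(1-e^{-x})^{\alpha-1}\big]-\frac1\pi\Gamma(1-\alpha)\sin(\pi\alpha\hat\rho)e^{-(\alpha-1)x}, \] for $x<0$, \[ \tilde u(x)=-\frac1\pi\Gamma(1-\alpha)\sin(\pi\alpha\rho)-\frac1\pi\Gamma(1-\alpha)\sin(\pi\alpha\hat\rho)\big[1-(1-e^{x})^{\alpha-1}\big]e^{-(\alpha-1)x}, \] and in particular $\tilde u(0)=-\frac1\pi\Gamma(1-\alpha)\big(\sin(\pi\alpha\rho)+\sin(\pi\alpha\hat\rho)\big)$.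
   Context: The characteristic exponent $\Psi$ of a Lévy process $Y$ is defined by $\mathbf{E}[e^{izY_t}]=e^{-t\Psi(z)}$. The process $\tilde\xi$ is the Lévy process underlying, via the Lamperti transform, the censored stable process obtained from a one-dimensional stable process with index $\alpha$ and positivity parameter $\rho=\mathbb{P}(X_1\ge0)$ by erasing its excursions below $0$ and absorbing at $0$; for $\alpha\in(1,2)$ it drifts to $-\infty$, so its potential measure is locally finite. *)

(* Defs.v *)
From HB Require Import structures.
From mathcomp Require Import all_boot all_order all_algebra.
From mathcomp Require Import all_classical all_reals all_analysis.
From mathcomp Require Import complex.

Set Implicit Arguments.
Unset Strict Implicit.
Unset Printing Implicit Defensive.

Import Order.TTheory GRing.Theory Num.Theory.
Import numFieldNormedType.Exports.
Local Open Scope classical_set_scope.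
Local Open Scope ring_scope.

Section defs.
Variable R : realType.

Definition cexp (w : R[i]) : R[i] :=
  Complex (expR (complex.Re w) * cos (complex.Im w)) (expR (complex.Re w) * sin (complex.Im w)).

Definition gauss_seq (w : R[i]) (n : nat) : R[i] :=
  (\prod_(k < n.+1) (w + (k%:R : R)%:C)%C) /
  (((n`!)%:R : R)%:C * cexp (w * (ln (n%:R : R))%:C))%C.

(** reciprocal Gamma function 1/Gamma (entire), via Gauss' limit formula,
    the limit being taken componentwise *)
Definition rgamma (w : R[i]) : R[i] :=
  Complex (limn (fun n => complex.Re (gauss_seq w n))) (limn (fun n => complex.Im (gauss_seq w n))).

(** complex Gamma function (value 0 at the poles, by the convention 0^-1 = 0) *)
Definition Gamma (w : R[i]) : R[i] := (rgamma w)^-1.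

Definition Psi_tilde (alpha rho : R) (z : R) : R[i] :=
  (Gamma (Complex (alpha * rho) (- z)) / Gamma (Complex 0 (- z))) *
  (Gamma (Complex (1 - alpha * rho) z) / Gamma (Complex (1 - alpha) z)).

Definition u_tilde (alpha rho : R) (x : R) : R :=
  let c := - (1 / pi) * complex.Re (Gamma (Complex (1 - alpha) 0)) in
  let rhohat := 1 - rho in
  if 0 < x then
    c * sin (pi * alpha * rho) * (1 - (1 - expR (- x)) `^ (alpha - 1))
    + c * sin (pi * alpha * rhohat) * expR (- (alpha - 1) * x)
  else if x < 0 then
    c * sin (pi * alpha * rho)
    + c * sin (pi * alpha * rhohat) * (1 - (1 - expR x) `^ (alpha - 1))
          * expR (- (alpha - 1) * x)
  else c * (sin (pi * alpha * rho) + sin (pi * alpha * rhohat)).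

Definition is_levy_process {d} {T : measurableType d} (P : probability T R)
    (X : R -> T -> R) : Prop :=
  [/\ (forall t, 0 <= t -> measurable_fun setT (X t)),
      (forall w, X 0 w = 0),
      (forall s t (A : set R), 0 <= s -> 0 <= t -> measurable A ->
         P [set w | A (X (s + t) w - X s w)] = P [set w | A (X t w)]),
      (forall (n : nat) (ts : nat -> R) (A : nat -> set R),
         0 <= ts 0%N -> (forall k, ts k <= ts k.+1) ->
         (forall k, measurable (A k)) ->
         P (\bigcap_(k in [set k | (k < n)%N]) [set w | A k (X (ts k.+1) w - X (ts k) w)])
         = (\prod_(k < n) P [set w | A k (X (ts k.+1) w - X (ts k) w)%R])%E) &
      (forall w t, 0 <= t ->
         (fun s => X s w) @ t^'+ --> X t w /\
         (0 < t -> cvg ((fun s => X s w) @ t^'-)))].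

Definition has_char_exponent {d} {T : measurableType d} (P : probability T R)
    (X : R -> T -> R) (Psi : R -> R[i]) : Prop :=
  forall t z, 0 <= t ->
    ('E_P[fun w => cos (z * X t w)] = (complex.Re (cexp (- (t%:C)%C * Psi z)))%:E)%E /\
    ('E_P[fun w => sin (z * X t w)] = (complex.Im (cexp (- (t%:C)%C * Psi z)))%:E)%E.

Definition potential {d} {T : measurableType d} (P : probability T R)
    (X : R -> T -> R) (A : set R) : \bar R :=
  (\int[@lebesgue_measure R]_(t in [set t : R | (0 <= t)%R]) P [set w | A (X t w)])%E.

End defs.

(* Main.v *)
Require Import Defs.
From HB Require Import structures.
From mathcomp Require Import all_boot all_order all_algebra.
From mathcomp Require Import all_classical all_reals all_analysis.
From mathcomp Require Import measurable_realfun complex ring lra.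
Import Order.TTheory GRing.Theory Num.Theory.
Import numFieldNormedType.Exports.
Local Open Scope classical_set_scope.
Local Open Scope ring_scope.

Set Implicit Arguments.
Unset Strict Implicit.
Unset Printing Implicit Defensive.

Local Notation Re := complex.Re.
Local Notation Im := complex.Im.
Local Notation normc := ComplexField.Normc.normc.

Local Open Scope complex_scope.

(** * Complex numbers and componentwise limits *)

(** Write s = -iz, a = alpha * rho, and P_t for the law of [X t]. The potential measure should have
    Fourier transform 1/Psi(z), so 1/Psi is expanded into partial fractions and the claimed density
    is read off from its poles. The potential measure is infinite, however: its density tends to a
    positive constant at minus infinity. Uniqueness of Fourier transforms is therefore applied only
    at a finite time t, after which t tends to infinity.

    Expansion. Gauss' limit presents 1/Psi as the limit of n^(-alpha) times a rational function of s
    with poles at -j and at 1 - alpha + j ([gauss_seq_quotient], [gamma_quotient_pf]). The rescaled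
    residues tend to a constant times the binomial coefficients [binw]; the constant contains sin(pi
    a)/pi by the reflection formula, which comes from Euler's sine product. Tannery's theorem allows
    the limit to be taken inside the sum ([gamma_quotient_series]). A term 1/(s + la) with la > 0 is
    the transform of exp(-la x) on the positive half-line, with a mirror image on the negative one,
    and summing the exponentials by the binomial series produces (1 - exp(-x))^(alpha - 1). The pole
    s = 0 lies on the integration line itself: it stands for a constant C = [weight_pos] on the
    negative half-line. Removing it leaves an integrable function h = [residual_density], and
    [inverse_exponent] states that 1/Psi(z) is the transform of h minus iC/z, for z nonzero.

    Identification. Let u = h + C 1_{x<0} be the [green_density]. Formally u - u * P_t is the
    integral of P_s over s in [0, t]. For fixed t this is an identity of finite signed measures as
    soon as [X t] is integrable, since then E[1_{x<0} - 1_{x<X_t}] is integrable in x. Both sides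
    have the same transform at every z > 0, so [fourier_uniqueness] gives [resolvent_identity]. The
    expansion also shows Psi(z) = iz/C + O(z^2) near 0 ([exponent_drift]), hence E(X_t + t/C)^2 <= K
    t: the path is integrable and drifts to minus infinity in probability. Letting t grow, u * P_t
    vanishes on bounded intervals, which is [potential_itv]; equality on half-open intervals extends
    to Borel sets by [measure_unique_itv], and [u_tildeE] matches u with the stated formula. *)

Lemma ReD (R : rcfType) (x y : R[i]) : Re (x + y) = Re x + Re y.
Proof. by case: x => a b; case: y. Qed.
Lemma ImD (R : rcfType) (x y : R[i]) : Im (x + y) = Im x + Im y.
Proof. by case: x => a b; case: y. Qed.
Lemma ReN (R : rcfType) (x : R[i]) : Re (- x) = - Re x.
Proof. by case: x. Qed.
Lemma ImN (R : rcfType) (x : R[i]) : Im (- x) = - Im x.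
Proof. by case: x. Qed.
Lemma ReM (R : rcfType) (x y : R[i]) : Re (x * y) = Re x * Re y - Im x * Im y.
Proof. by case: x => a b; case: y. Qed.
Lemma ImM (R : rcfType) (x y : R[i]) : Im (x * y) = Re x * Im y + Im x * Re y.
Proof. by case: x => a b; case: y. Qed.
Lemma ReV (R : rcfType) (x : R[i]) : Re x^-1 = Re x / (Re x ^+ 2 + Im x ^+ 2).
Proof. by case: x. Qed.
Lemma ImV (R : rcfType) (x : R[i]) : Im x^-1 = - Im x / (Re x ^+ 2 + Im x ^+ 2).
Proof. by case: x => a b /=; rewrite mulNr. Qed.
Lemma eqc (R : rcfType) (x y : R[i]) : Re x = Re y -> Im x = Im y -> x = y.
Proof. by case: x => a b; case: y => c d /= -> ->. Qed.

Lemma normr_Re_le (R : rcfType) (x : R[i]) : `|Re x| <= normc x.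
Proof.
case: x => a b /=; rewrite -sqrtr_sqr ler_sqrt ?addr_ge0 ?sqr_ge0//.
by rewrite lerDl sqr_ge0.
Qed.

Lemma normr_Im_le (R : rcfType) (x : R[i]) : `|Im x| <= normc x.
Proof.
case: x => a b /=; rewrite -sqrtr_sqr ler_sqrt ?addr_ge0 ?sqr_ge0//.
by rewrite lerDr sqr_ge0.
Qed.

Lemma normc_ge0 (R : rcfType) (x : R[i]) : 0 <= normc x.
Proof. exact: le_trans (normr_ge0 _) (normr_Re_le x). Qed.

Lemma normc_sqr (R : rcfType) (x : R[i]) : normc x ^+ 2 = Re x ^+ 2 + Im x ^+ 2.
Proof. by case: x => a b /=; rewrite sqr_sqrtr// addr_ge0// sqr_ge0. Qed.

Lemma normc_eq0 (R : rcfType) (x : R[i]) : (normc x == 0) = (x == 0).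
Proof.
apply/eqP/eqP => [/ComplexField.Normc.eq0_normc//|->].
exact: ComplexField.Normc.normc0.
Qed.

Lemma normc_gt0 (R : rcfType) (x : R[i]) : (0 < normc x) = (x != 0).
Proof. by rewrite lt0r normc_eq0 normc_ge0 andbT. Qed.

Lemma normc_le_ReIm (R : rcfType) (x : R[i]) : normc x <= `|Re x| + `|Im x|.
Proof.
rewrite -(@ler_pXn2r _ 2)// ?nnegrE ?addr_ge0 ?normc_ge0// normc_sqr sqrrD.
by rewrite !real_normK ?num_real// lerD2r lerDl mulrn_wge0// mulr_ge0.
Qed.

Lemma normcM (R : rcfType) (x y : R[i]) : normc (x * y) = normc x * normc y.
Proof. exact: ComplexField.Normc.normcM. Qed.

Lemma normcD (R : rcfType) (x y : R[i]) : normc (x + y) <= normc x + normc y.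
Proof. exact: le_normcD. Qed.

Lemma normcN (R : rcfType) (x : R[i]) : normc (- x) = normc x.
Proof. exact: complex.normcN. Qed.

Lemma normcV (R : rcfType) (x : R[i]) : normc x^-1 = (normc x)^-1.
Proof. exact: ComplexField.Normc.normcV. Qed.

Lemma normcR (R : rcfType) (x : R) : normc x%:C = `|x|.
Proof. by rewrite /= expr0n addr0 sqrtr_sqr. Qed.

Lemma normc_sum (R : rcfType) (I : Type) (r : seq I) (P : pred I) (F : I -> R[i]) :
  normc (\sum_(i <- r | P i) F i) <= \sum_(i <- r | P i) normc (F i).
Proof.
elim/big_ind2 : _ => [|x y x' y' h h'|i _] //.
  by rewrite ComplexField.Normc.normc0.
exact: le_trans (normcD _ _) (lerD h h').
Qed.

(** Componentwise, because [rgamma] is defined by separate limits of real and imaginary parts. *)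
Definition ccvg (R : realType) (u : nat -> R[i]) (l : R[i]) : Prop :=
  Re (u n) @[n --> \oo] --> Re l /\ Im (u n) @[n --> \oo] --> Im l.

Section ccvg.
Variable R : realType.
Implicit Types (u v : nat -> R[i]) (l : R[i]).

Lemma ccvg_unique u l l' : ccvg u l -> ccvg u l' -> l = l'.
Proof.
move=> [ur ui] [ur' ui']; apply: eqc.
  exact: (cvg_unique _ ur ur').
exact: (cvg_unique _ ui ui').
Qed.

Lemma ccvg_cst l : ccvg (fun=> l) l.
Proof. by split; exact: cvg_cst. Qed.

Lemma ccvg_real (f : nat -> R) (a : R) :
  f @ \oo --> a -> ccvg (fun n => (f n)%:C) a%:C.
Proof. by move=> fa; split => //=; exact: cvg_cst. Qed.

Lemma ccvgD u v l m : ccvg u l -> ccvg v m -> ccvg (fun n => u n + v n) (l + m).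
Proof.
move=> [ur ui] [vr vi]; split.
  by under eq_fun do rewrite ReD; rewrite ReD; exact: cvgD.
by under eq_fun do rewrite ImD; rewrite ImD; exact: cvgD.
Qed.

Lemma ccvgM u v l m : ccvg u l -> ccvg v m -> ccvg (fun n => u n * v n) (l * m).
Proof.
move=> [ur ui] [vr vi]; split.
  under eq_fun do rewrite ReM; rewrite ReM.
  by apply: cvgB; exact: cvgM.
under eq_fun do rewrite ImM; rewrite ImM.
by apply: cvgD; exact: cvgM.
Qed.

Lemma sqr_ReIm_neq0 l : l != 0 -> Re l ^+ 2 + Im l ^+ 2 != 0.
Proof. by move=> l0; rewrite -normc_sqr expf_neq0// normc_eq0. Qed.

Lemma ccvgV u l : l != 0 -> ccvg u l -> ccvg (fun n => (u n)^-1) l^-1.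
Proof.
move=> l0 [ur ui].
have n2 : (Re (u n) ^+ 2 + Im (u n) ^+ 2)^-1 @[n --> \oo] -->
          (Re l ^+ 2 + Im l ^+ 2)^-1.
  by apply: cvgV; [exact: sqr_ReIm_neq0|apply: cvgD; apply: cvgM].
split.
  by under eq_fun do rewrite ReV; rewrite ReV; exact: cvgM.
under eq_fun do rewrite ImV; rewrite ImV.
by apply: cvgM => //; exact: cvgN.
Qed.

Lemma ccvg_normc u l : normc (u n - l) @[n --> \oo] --> 0 -> ccvg u l.
Proof.
move=> ul; split; apply/subr_cvg0; apply: norm_cvg0.
- apply: (squeeze_cvgr _ (cvg_cst 0) ul); near=> n.
  by rewrite normr_ge0 -ReN -ReD normr_Re_le.
- apply: (squeeze_cvgr _ (cvg_cst 0) ul); near=> n.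
  by rewrite normr_ge0 -ImN -ImD normr_Im_le.
Unshelve. all: by end_near. Qed.

Lemma ccvg_shiftS u l : ccvg (fun n => u n.+1) l <-> ccvg u l.
Proof.
split=> -[h h']; split.
- by rewrite -(cvg_shiftS (fun n => Re (u n))).
- by rewrite -(cvg_shiftS (fun n => Im (u n))).
- by rewrite (cvg_shiftS (fun n => Re (u n))).
- by rewrite (cvg_shiftS (fun n => Im (u n))).
Qed.

Lemma ccvg_shiftn N u l : ccvg (fun n => u (n + N)%N) l <-> ccvg u l.
Proof.
split=> -[h h']; split.
- by rewrite -(cvg_shiftn N (fun n => Re (u n))).
- by rewrite -(cvg_shiftn N (fun n => Im (u n))).
- by rewrite (cvg_shiftn N (fun n => Re (u n))).
- by rewrite (cvg_shiftn N (fun n => Im (u n))).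
Qed.

(** Each component is its initial value plus an absolutely convergent telescoping series, dominated
    by [b]. *)
Lemma ccvg_summable_increments u (b : nat -> R) :
  (forall n, normc (u n.+1 - u n) <= b n) -> cvgn (series b) ->
  exists l, ccvg u l.
Proof.
move=> ub cb.
have b0 n : 0 <= b n by apply: le_trans (normc_ge0 _) (ub n).
have cv (f : nat -> R) : (forall n, `|f n.+1 - f n| <= b n) -> cvgn f.
  move=> fb.
  have : cvgn (series (telescope f)).
    apply: normed_cvg; apply: (series_le_cvg _ b0 _ cb) => n /=.
      exact: normr_ge0.
    exact: fb.
  move=> ct.
  rewrite (_ : f = (fun n => f 0%N + series (telescope f) n)); last first.
    by apply/funext => n; exact: eq_sum_telescope.
  by apply: is_cvgD => //; exact: is_cvg_cst.
have cr : cvgn (fun n => Re (u n)).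
  by apply: cv => n; rewrite -ReN -ReD (le_trans (normr_Re_le _)).
have ci : cvgn (fun n => Im (u n)).
  by apply: cv => n; rewrite -ImN -ImD (le_trans (normr_Im_le _)).
by exists (limn (fun n => Re (u n)) +i* limn (fun n => Im (u n))); split.
Qed.


(** * Infinite products of complex numbers *)

Lemma infinite_product_bounded u (e : nat -> R[i]) (b : nat -> R) :
  (forall n, u n.+1 = u n * (1 + e n)) -> (forall n, normc (e n) <= b n) ->
  forall n, normc (u n) <= normc (u 0%N) * expR (series b n).
Proof.
move=> ue eb; elim=> [|n IH].
  by rewrite /series/= big_geq// expR0 mulr1.
rewrite ue normcM seriesSr expRD mulrA ler_pM ?normc_ge0//.
rewrite (le_trans (normcD _ _))// ComplexField.Normc.normc1.
by rewrite (le_trans _ (expR_ge1Dx _))// lerD2l.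
Qed.

(** The partial products stay below [M], so the increments [u n * e n] are summable along with
    [b]. *)
Lemma cvg_infinite_product u (e : nat -> R[i]) (b : nat -> R) :
  (forall n, u n.+1 = u n * (1 + e n)) -> (forall n, normc (e n) <= b n) ->
  cvgn (series b) -> exists l, ccvg u l.
Proof.
move=> ue eb cb.
have b0 n : 0 <= b n by apply: le_trans (normc_ge0 _) (eb n).
pose M := normc (u 0%N) * expR (limn (series b)).
apply: (@ccvg_summable_increments _ (fun n => M * b n)) => [n|].
  rewrite ue mulrDr mulr1 addrC addKr normcM ler_pM ?normc_ge0//.
  apply: le_trans (infinite_product_bounded ue eb n) _.
  rewrite ler_wpM2l ?normc_ge0// ler_expR.
  apply: nondecreasing_cvgn_le => //.
  by apply/nondecreasing_seqP => k; rewrite seriesSr lerDl.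
rewrite (_ : series _ = fun n => M * series b n).
  by apply: is_cvgM => //; exact: is_cvg_cst.
by apply/funext => n; rewrite /series/= mulr_sumr.
Qed.

Lemma normc_inv1D (x : R[i]) : normc x <= 2^-1 ->
  1 + x != 0 /\ normc ((1 + x)^-1 - 1) <= 2 * normc x.
Proof.
move=> x2.
have h : 2^-1 <= normc (1 + x).
  have := normcD (1 + x) (- x).
  rewrite addrK ComplexField.Normc.normc1 normcN; lra.
have x1 : 1 + x != 0 by rewrite -normc_gt0; lra.
split=> //.
have -> : (1 + x)^-1 - 1 = - x * (1 + x)^-1.
  by rewrite -[X in _ - X](divff x1) -{1}[(1 + x)^-1]mul1r -mulrBl opprD addNKr.
rewrite normcM normcN normcV mulrC ler_wpM2r ?normc_ge0//.
by rewrite -[leRHS]invrK lef_pV2// posrE; lra.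
Qed.

(** Beyond an index [N] where |e| <= 1/2, the reciprocal factors are again 1 + e' with e' summable,
    so the reciprocal products converge too; a zero limit would contradict that the two products
    multiply to 1. *)
Lemma cvg_infinite_product_neq0 u (e : nat -> R[i]) (b : nat -> R) :
  (forall n, u n.+1 = u n * (1 + e n)) -> (forall n, normc (e n) <= b n) ->
  (forall n, u n != 0) -> cvgn (series b) -> exists2 l, l != 0 & ccvg u l.
Proof.
move=> ue eb u0 cb.
have [l ul] := cvg_infinite_product ue eb cb.
have [N _ bN] : \forall n \near \oo, b n <= 2^-1.
  have /cvgr_le : b n @[n --> \oo] --> 0 by exact: cvg_series_cvg_0.
  by apply; rewrite invr_gt0.
pose e' n := (1 + e (n + N)%N)^-1 - 1.
pose v n := (u (n + N)%N)^-1.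
have eN n : normc (e (n + N)%N) <= 2^-1.
  by rewrite (le_trans (eb _))//; apply: bN => /=; rewrite leq_addl.
have ve n : v n.+1 = v n * (1 + e' n).
  by rewrite /v /e' addSn ue invfM subrKC.
have eb' n : normc (e' n) <= 2 * b (n + N)%N.
  by apply: le_trans (normc_inv1D (eN n)).2 _; rewrite ler_pM2l.
have [|m vm] := cvg_infinite_product ve eb'.
  rewrite (_ : series _ = fun n => 2 * (series b (n + N)%N - series b N)).
    apply: is_cvgM; first exact: is_cvg_cst.
    apply: is_cvgB; last exact: is_cvg_cst.
    by apply/cvg_ex; exists (limn (series b)); rewrite cvg_shiftn.
  apply/funext => n; elim: n => [|n IH].
    by rewrite add0n subrr mulr0 /series/= big_geq.
  by rewrite seriesSr IH addSn seriesSr -mulrDr addrAC.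
exists l => //; apply/eqP => l0.
have : ccvg (fun n => u (n + N)%N * v n) (l * m).
  exact: (ccvgM ((ccvg_shiftn N u l).2 ul) vm).
rewrite (_ : (fun _ => _) = fun=> 1); last first.
  by apply/funext => n; rewrite /v divff.
move=> /ccvg_unique /(_ (ccvg_cst 1)) /esym/eqP.
by rewrite l0 mul0r oner_eq0.
Qed.

End ccvg.

(** * Elementary bounds and the complex exponential *)

(** Mean value theorem. The comparisons of sine with elementary functions below apply it to the
    difference of the two sides. *)
Lemma ge0_derive_le (R : realType) (f df : R -> R) (x : R) : 0 <= x ->
  (forall y : R, is_derive y (1 : R) f (df y)) ->
  (forall y, 0 <= y <= x -> 0 <= df y) -> f 0 <= f x.
Proof.
move=> x0 fdf dfg; move: x0; rewrite le_eqVlt => /predU1P[<-//|x0].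
have cf : {within `[0, x], continuous f}.
  apply: continuous_subspaceT => y; apply/differentiable_continuous/derivable1_diffP.
  by have [] := fdf y.
have [c] := MVT x0 (fun y _ => fdf y) cf.
rewrite in_itv/= => /andP[c0 cx] /eqP; rewrite subr0 subr_eq addrC => /eqP ->.
by rewrite lerDl mulr_ge0 ?(ltW x0)// dfg// (ltW c0) (ltW cx).
Qed.

Section elementary_bounds.
Variable R : realType.
Implicit Types x y : R.

Lemma sin_le_id x : 0 <= x -> sin x <= x.
Proof.
move=> x0; rewrite -subr_ge0.
have -> : 0 = 0 - sin 0 :> R by rewrite sin0 subr0.
apply: (@ge0_derive_le _ (fun y => y - sin y) (fun y => 1 - cos y)) => [//|y _].
by rewrite subr_ge0 cos_le1.
Qed.

Lemma norm_sin_le_id x : `|sin x| <= `|x|.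
Proof.
wlog x0 : x / 0 <= x => [h|].
  have [/h//|/ltW x0] := leP 0 x.
  by rewrite -normrN -sinN -(normrN x) h// oppr_ge0.
rewrite (ger0_norm x0) ler_norml sin_le_id// andbT.
rewrite lerNl -subr_ge0.
have -> : 0 = 0 - - sin 0 :> R by rewrite sin0 oppr0 subr0.
apply: (@ge0_derive_le _ (fun y => y - - sin y) (fun y => 1 - - cos y)) => [//|y _].
by rewrite opprK -lerBlDl sub0r cos_geN1.
Qed.

Lemma onem_cos_ge0 x : 0 <= 1 - cos x.
Proof. by rewrite subr_ge0 cos_le1. Qed.

Lemma onem_cosE x : 1 - cos x = 2 * sin (x / 2) ^+ 2.
Proof.
rewrite [in LHS](_ : x = (x / 2) *+ 2); last by rewrite mulr2n -splitr.
rewrite cos_mulr2n cos2sin2; ring.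
Qed.

Lemma onem_cos_le x : 1 - cos x <= x ^+ 2 / 2.
Proof.
rewrite onem_cosE -real_normK ?num_real//.
have := norm_sin_le_id (x / 2).
move=> /(lerXn2r 2); rewrite !nnegrE => /(_ (normr_ge0 _) (normr_ge0 _)).
by rewrite [X in _ <= X -> _]real_normK ?num_real//; lra.
Qed.

Lemma id_sin_le x : 0 <= x -> x - sin x <= x ^+ 2.
Proof.
move=> x0; rewrite -subr_ge0.
have -> : 0 = 0 ^+ 2 - (0 - sin 0) :> R by rewrite sin0 expr0n /= !subr0.
apply: (@ge0_derive_le _ (fun y => y ^+ 2 - (y - sin y))
  (fun y => 2 * y - (1 - cos y))) => [//|y|y /andP[y0 _]].
  apply: is_derive_eq.
  by rewrite [y%:A]mulr1 -[2]/(1 + 1) mulrDl mul1r.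
rewrite subr_ge0.
have := onem_cos_le y; have := cos_geN1 y; nra.
Qed.

Lemma norm_sinB_le x : `|sin x - x| <= x ^+ 2.
Proof.
wlog x0 : x / 0 <= x => [h|].
  have [/h//|/ltW x0] := leP 0 x.
  by rewrite -normrN opprB addrC -sinN -{2}(opprK x) -(sqrrN x) h// oppr_ge0.
rewrite distrC ger0_norm; first exact: id_sin_le.
by rewrite subr_ge0 sin_le_id.
Qed.

Lemma expR1B_le x : expR x - 1 <= x * expR x.
Proof.
rewrite -subr_ge0.
have -> : x * expR x - (expR x - 1) = 1 - (1 - x) * expR x by ring.
rewrite subr_ge0 -[leRHS](expRxMexpNx_1 x) mulrC ler_wpM2l ?expR_ge0//.
exact: expR_ge1Dx.
Qed.

Lemma norm_expR1B_le x : `|expR x - 1| <= `|x| * expR `|x|.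
Proof.
have [x0|x0] := leP 0 x.
  by rewrite !ger0_norm ?expR1B_le// subr_ge0 -expR0 ler_expR.
rewrite ltr0_norm; last by rewrite subr_lt0 -expR0 ltr_expR.
rewrite ltr0_norm//.
have := expR_ge1Dx x; have := expR_ge1Dx (- x); nra.
Qed.

Lemma norm_expR1DB_le x : `|expR x - 1 - x| <= x ^+ 2 * expR `|x|.
Proof.
rewrite ger0_norm; last first.
  by have := expR_ge1Dx x; lra.
apply: (@le_trans _ _ (x * (expR x - 1))); first by have := expR1B_le x; lra.
apply: le_trans (ler_norm _) _.
rewrite normrM -real_normK ?num_real// expr2 -mulrA ler_wpM2l//.
exact: norm_expR1B_le.
Qed.
End elementary_bounds.

Section cexp.
Variable R : realType.
Implicit Types v w : R[i].

Lemma cexpD v w : cexp (v + w) = cexp v * cexp w.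
Proof.
apply: eqc; rewrite ?ReM ?ImM /cexp /= ReD ImD expRD.
  rewrite cosD; ring.
rewrite sinD; ring.
Qed.

Lemma cexp0 : cexp (0 : R[i]) = 1.
Proof. by apply: eqc; rewrite /cexp /= expR0 ?cos0 ?sin0 ?mulr1 ?mulr0. Qed.

Lemma cexp_neq0 w : cexp w != 0.
Proof.
apply/eqP => w0; have := cexpD w (- w); rewrite subrr cexp0 w0 mul0r.
by move/eqP; rewrite oner_eq0.
Qed.

Lemma cexpN w : cexp (- w) = (cexp w)^-1.
Proof.
apply: (mulfI (cexp_neq0 w)).
by rewrite -cexpD subrr cexp0 divff// cexp_neq0.
Qed.

Lemma normc_cexp w : normc (cexp w) = expR (Re w).
Proof.
rewrite /= !exprMn -mulrDr cos2Dsin2 mulr1 sqrtr_sqr.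
by rewrite ger0_norm// expR_ge0.
Qed.

Lemma cexp_real (x : R) : cexp x%:C = (expR x)%:C.
Proof. by rewrite /cexp/= cos0 sin0 mulr1 mulr0. Qed.

(** The constant 4 + M is the sum of 2 + M from the real part and 2 from the imaginary part. *)
Lemma cexp_taylor w (M : R) : normc w <= M ->
  normc (cexp w - 1 - w) <= (4 + M) * expR M * normc w ^+ 2.
Proof.
move=> wM; apply: le_trans (normc_le_ReIm _) _.
rewrite !ReD !ImD !ReN !ImN /= subr0.
set x := Re w; set y := Im w.
have nw : 0 <= normc w := normc_ge0 w.
have xw : `|x| <= normc w := normr_Re_le w.
have yw : `|y| <= normc w := normr_Im_le w.
have eM : expR `|x| <= expR M by rewrite ler_expR (le_trans xw).
have e1 : 1 <= expR M by rewrite -expR0 ler_expR (le_trans nw).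
have x2 : x ^+ 2 <= normc w ^+ 2 by rewrite -real_normK ?num_real// lerXn2r ?nnegrE.
have y2 : y ^+ 2 <= normc w ^+ 2 by rewrite -real_normK ?num_real// lerXn2r ?nnegrE.
have xE : x ^+ 2 * expR `|x| <= normc w ^+ 2 * expR M.
  by rewrite ler_pM ?sqr_ge0 ?expR_ge0.
have re : `|expR x * cos y - 1 - x| <= (1 + (1 + M)) * (normc w ^+ 2 * expR M).
  have -> : expR x * cos y - 1 - x =
    (expR x - 1 - x) * cos y - (1 + x) * (1 - cos y) by ring.
  apply: le_trans (ler_normB _ _) _; rewrite [leRHS]mulrDl mul1r lerD//.
    rewrite normrM (le_trans _ xE)// -[leRHS]mulr1 ler_pM ?norm_expR1DB_le//.
    exact: cos_max.
  rewrite normrM ler_pM//.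
    by rewrite (le_trans (ler_normD _ _))// normr1 lerD2l (le_trans xw).
  rewrite ger0_norm ?onem_cos_ge0// (le_trans (onem_cos_le y))//.
  have := sqr_ge0 (normc w); nra.
have im : `|expR x * sin y - y| <= 2 * (normc w ^+ 2 * expR M).
  have -> : expR x * sin y - y = (expR x - 1) * sin y + (sin y - y) by ring.
  apply: le_trans (ler_normD _ _) _.
  rewrite (_ : 2 = 1 + 1)// [leRHS]mulrDl mul1r lerD//.
    rewrite normrM (le_trans (ler_pM _ _ (norm_expR1B_le x) (norm_sin_le_id y)))//.
    rewrite mulrAC ler_pM ?mulr_ge0 ?expR_ge0// expr2 ler_pM//.
  rewrite (le_trans (norm_sinB_le y))//.
  have := sqr_ge0 (normc w); nra.
by apply: le_trans (lerD re im) _; rewrite le_eqVlt; apply/orP/or_introl/eqP; ring.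
Qed.
End cexp.

(** * Gauss' limit for the reciprocal Gamma function *)

(** Telescoping comparison: the first n + 1 terms add up to at most 2 - 1/(n + 1). *)
Lemma cvg_series_inv_sqr (R : realType) :
  cvgn (series (fun n => (n.+1%:R ^- 2 : R))).
Proof.
have pos n : 0 <= (n.+1%:R ^- 2 : R) by rewrite invr_ge0 exprn_ge0.
apply: nondecreasing_is_cvgn.
  by apply/nondecreasing_seqP => n; rewrite seriesSr lerDl.
exists 2 => _ [n _ <-].
have : series (fun n => (n.+1%:R ^- 2 : R)) n.+1 <= 2 - n.+1%:R^-1.
  elim: n => [|n IH]; first by rewrite seriesSr /series/= big_geq// expr1n; lra.
  rewrite seriesSr; apply: le_trans (lerD IH (lexx _)) _.
  rewrite -subr_ge0.
  have -> : 2 - n.+2%:R^-1 - (2 - n.+1%:R^-1 + n.+2%:R ^- 2) =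
    n.+1%:R^-1 * n.+2%:R ^- 2 :> R.
    have -> : n.+2%:R = n.+1%:R + 1 :> R by rewrite -natr1.
    by field; rewrite ?nat1r ?natr1 !pnatr_eq0.
  by rewrite mulr_ge0 ?invr_ge0.
rewrite seriesSr => h; apply: le_trans (_ : 2 - n.+1%:R^-1 <= 2).
  by apply: le_trans h; rewrite lerDl.
by rewrite gerBl invr_ge0.
Qed.

Section gauss.
Variable R : realType.
Implicit Types w : R[i].

Lemma ln_increment_ub (n : nat) : ln n.+2%:R - ln n.+1%:R <= n.+1%:R^-1 :> R.
Proof.
rewrite -ln_div ?posrE// -[n.+2%:R]natr1 mulrDl divff ?pnatr_eq0// mul1r.
by rewrite le_ln1Dx// (lt_le_trans (ltrN10 _))// invr_ge0.
Qed.

Lemma ln_increment_lb (n : nat) : n.+2%:R^-1 <= ln n.+2%:R - ln n.+1%:R :> R.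
Proof.
rewrite -lerN2 opprB -ln_div ?posrE//.
have -> : n.+1%:R / n.+2%:R = 1 + - n.+2%:R^-1 :> R.
  by rewrite -[n.+2%:R]natr1; field; rewrite ?nat1r ?natr1 ?pnatr_eq0.
by rewrite le_ln1Dx// ltrN2 invf_lt1// ltr1n.
Qed.

(** One plus this is the quotient of consecutive Gauss terms. It starts from the term of index 1,
    because the term of index 0 involves the default value [ln 0]. *)
Definition gauss_ratio w (n : nat) : R[i] :=
  (1 + w * (n.+2%:R^-1)%:C) * cexp (- (w * (ln n.+2%:R - ln n.+1%:R)%:C)) - 1.

Lemma natC_neq0 (n : nat) : ((n.+1%:R : R)%:C != 0).
Proof. by rewrite eq_complex /= pnatr_eq0. Qed.

Lemma factC_neq0 (n : nat) : ((n`!%:R : R)%:C != 0).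
Proof. by rewrite eq_complex /= pnatr_eq0 eqxx andbT -lt0n fact_gt0. Qed.

Lemma gauss_seqSS w n :
  gauss_seq w n.+2 = gauss_seq w n.+1 * (1 + gauss_ratio w n).
Proof.
rewrite /gauss_ratio subrKC /gauss_seq big_ord_recr /=.
set P := \prod_(i < n.+2) _.
rewrite factS natrM rmorphM /=.
rewrite (rmorphB (real_complex R)) mulrBr opprB cexpD cexpN fmorphV /=.
have := cexp_neq0 (w * (ln n.+1%:R)%:C); have := cexp_neq0 (w * (ln n.+2%:R)%:C).
have := factC_neq0 n.+1; have := natC_neq0 n.+1.
move: (cexp _) (cexp _) ((n.+1)`!%:R)%:C (n.+2%:R)%:C => A B f N N0 f0 B0 A0.
by field; rewrite A0 B0 f0 N0.
Qed.

(** The logarithmic increment lies between 1/(n+2) and 1/(n+1), so the terms linear in w of the two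
    factors cancel up to order n^(-2), and [cexp_taylor] bounds the remainder by the square of the
    increment. *)
Lemma gauss_ratio_le w : exists K : R, forall n,
  normc (gauss_ratio w n) <= K * n.+1%:R ^- 2.
Proof.
set A := normc w.
exists (A + A ^+ 2 + (1 + A) * ((4 + A) * expR A * A ^+ 2)) => n.
have A0 : 0 <= A := normc_ge0 w.
set h := n.+1%:R^-1 : R.
set l := ln n.+2%:R - ln n.+1%:R : R; set m := n.+2%:R^-1 : R.
have lh : l <= h := ln_increment_ub n.
have ml : m <= l := ln_increment_lb n.
have m0 : 0 <= m by rewrite invr_ge0.
have h1 : h <= 1 by rewrite invf_le1// ler1n.
have l0 : 0 <= l := le_trans m0 ml.
have h0 : 0 <= h := le_trans l0 lh.
have hm : h - m <= h ^+ 2.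
  rewrite /h /m -subr_ge0.
  have -> : n.+1%:R^-1 ^+ 2 - (n.+1%:R^-1 - n.+2%:R^-1) =
            n.+1%:R ^- 2 * n.+2%:R^-1 :> R.
    have -> : n.+2%:R = n.+1%:R + 1 :> R by rewrite -natr1.
    by field; rewrite ?nat1r ?natr1 !pnatr_eq0.
  by rewrite mulr_ge0 ?invr_ge0.
rewrite -exprVn -/h.
pose v := - (w * l%:C).
have nv : normc v = A * l by rewrite normcN normcM normcR ger0_norm.
have nvA : normc v <= A by rewrite nv ler_piMr// (le_trans lh).
set r := cexp v - 1 - v.
have -> : gauss_ratio w n =
    w * (m - l)%:C - w * w * (l * m)%:C + (1 + w * m%:C) * r.
  rewrite /gauss_ratio -/l -/m -/v /r.
  rewrite (rmorphB (real_complex R)) (rmorphM (real_complex R)) /=.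
  by move: (cexp v) => E; rewrite /v; ring.
have mh : m <= h := le_trans ml lh.
rewrite [leRHS]mulrDl [X in _ <= X + _]mulrDl.
apply: le_trans (normcD _ _) (lerD _ _).
  apply: le_trans (normcD _ _) (lerD _ _).
    rewrite normcM normcR ler_wpM2l// ler0_norm; first by rewrite opprB; lra.
    by rewrite subr_le0.
  rewrite normcN !normcM normcR -expr2 ler_wpM2l ?sqr_ge0//.
  by rewrite ger0_norm ?mulr_ge0// expr2 ler_pM.
rewrite normcM.
have nr : normc r <= (4 + A) * expR A * A ^+ 2 * h ^+ 2.
  apply: le_trans (cexp_taylor nvA) _.
  rewrite -[leRHS]mulrA ler_wpM2l ?mulr_ge0 ?expR_ge0 ?addr_ge0// -exprMn.
  by rewrite lerXn2r ?nnegrE ?normc_ge0 ?mulr_ge0// nv ler_wpM2l.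
rewrite -[leRHS]mulrA; apply: (ler_pM (normc_ge0 _) (normc_ge0 _) _ nr).
apply: le_trans (normcD _ _) _.
rewrite ComplexField.Normc.normc1 normcM normcR ger0_norm// lerD2l ler_piMr//.
exact: le_trans h1.
Qed.

Let cvg_bound (K : R) : cvgn (series (fun n => K * n.+1%:R ^- 2)).
Proof.
rewrite (_ : series _ = fun n => K * series (fun n => n.+1%:R ^- 2) n).
  by apply: is_cvgM; [exact: is_cvg_cst|exact: cvg_series_inv_sqr].
by apply/funext => n; rewrite /series/= mulr_sumr.
Qed.

Lemma cvg_gauss_seq w : ccvg (gauss_seq w) (rgamma w).
Proof.
have [K Kw] := gauss_ratio_le w.
have [l /ccvg_shiftS [lr li]] :=
  cvg_infinite_product (gauss_seqSS w) Kw (@cvg_bound K).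
by split; [rewrite /= (cvg_lim _ lr)|rewrite /= (cvg_lim _ li)].
Qed.

Lemma gauss_seq_neq0 w n : (forall k : nat, w + (k%:R : R)%:C != 0) ->
  gauss_seq w n != 0.
Proof.
move=> w0; rewrite /gauss_seq mulf_neq0// ?invr_eq0 ?mulf_neq0 ?cexp_neq0//.
  by apply/prodf_neq0 => k _; exact: w0.
exact: factC_neq0.
Qed.

Lemma rgamma_neq0 w : (forall k : nat, w + (k%:R : R)%:C != 0) -> rgamma w != 0.
Proof.
move=> w0; have [K Kw] := gauss_ratio_le w.
have [|l l0 /ccvg_shiftS gl] :=
  cvg_infinite_product_neq0 (gauss_seqSS w) Kw _ (@cvg_bound K).
  by move=> n; exact: gauss_seq_neq0.
by rewrite (ccvg_unique (cvg_gauss_seq w) gl).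
Qed.

End gauss.

(** * Wallis integrals and the reflection formula *)

Section derive_lambda.
Variable R : realType.
Implicit Types (f g : R -> R) (x a b : R).

Lemma dcst a x : is_derive x (1 : R) (fun=> a) 0.
Proof. exact: is_derive_cst. Qed.

Lemma did x : is_derive x (1 : R) id 1.
Proof. exact: is_derive_id. Qed.

Lemma dD f g x a b : is_derive x (1 : R) f a -> is_derive x (1 : R) g b ->
  is_derive x (1 : R) (fun y => f y + g y) (a + b).
Proof. by move=> h k; exact: is_deriveD. Qed.

Lemma dN f x a : is_derive x (1 : R) f a ->
  is_derive x (1 : R) (fun y => - f y) (- a).
Proof. by move=> h; exact: is_deriveN. Qed.

Lemma dB f g x a b : is_derive x (1 : R) f a -> is_derive x (1 : R) g b ->
  is_derive x (1 : R) (fun y => f y - g y) (a - b).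
Proof. by move=> h k; exact: is_deriveB. Qed.

Lemma dM f g x a b : is_derive x (1 : R) f a -> is_derive x (1 : R) g b ->
  is_derive x (1 : R) (fun y => f y * g y) (a * g x + f x * b).
Proof.
move=> h k; have := is_deriveM h k.
by rewrite [_ *: b + _]addrC [g x *: a]mulrC.
Qed.

Lemma dZ f x a b : is_derive x (1 : R) f a ->
  is_derive x (1 : R) (fun y => b * f y) (b * a).
Proof. by move=> h; exact: (is_deriveZ b h). Qed.

Lemma dX n f x a : is_derive x (1 : R) f a ->
  is_derive x (1 : R) (fun y => f y ^+ n.+1) (n.+1%:R * f x ^+ n * a).
Proof. by move=> h; have := is_deriveX n.+1 h; rewrite exprfctE. Qed.

Lemma dcomp f g x a b :
  is_derive (g x) (1 : R) f a -> is_derive x (1 : R) g b ->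
  is_derive x (1 : R) (fun y => f (g y)) (a * b).
Proof. exact: is_derive1_comp. Qed.

Lemma dlin a x : is_derive x (1 : R) (fun y => a * y) a.
Proof. by rewrite -[X in is_derive _ _ _ X](mulr1 a); exact: dZ (did x). Qed.

Lemma derive_continuous f (df : R -> R) :
  (forall x : R, is_derive x (1 : R) f (df x)) -> continuous f.
Proof.
move=> fdf x; apply/differentiable_continuous/derivable1_diffP.
by have [] := fdf x.
Qed.
End derive_lambda.

Section segment_integrals.
Variable R : realType.
Local Notation mu := (@lebesgue_measure R).
Implicit Types (f F : R -> R) (a b : R).

Lemma continuous_segment_integrable f a b : continuous f ->
  mu.-integrable `[a, b] (EFin \o f).
Proof.
move=> cf; apply: continuous_compact_integrable; first exact: segment_compact.
exact: continuous_subspaceT.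
Qed.

Lemma segment_FTC2 F f a b : a < b -> continuous f ->
  (forall x : R, is_derive x (1 : R) F (f x)) ->
  (\int[mu]_(x in `[a, b]) (f x)%:E = (F b - F a)%:E)%E.
Proof.
move=> ab cf dF; have cF := derive_continuous dF.
rewrite (@continuous_FTC2 _ f F)//.
- exact: continuous_subspaceT.
- split => [x _| |].
  + by have [] := dF x.
  + by apply: cvg_at_right_filter; exact: cF.
  + by apply: cvg_at_left_filter; exact: cF.
- move=> x _; rewrite derive1E; by have [_] := dF x.
Qed.

Lemma segment_RFTC2 F f a b : a < b -> continuous f ->
  (forall x : R, is_derive x (1 : R) F (f x)) ->
  \int[mu]_(x in `[a, b]) f x = F b - F a.
Proof. by move=> ab cf dF; rewrite /Rintegral (segment_FTC2 ab cf dF). Qed.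
End segment_integrals.

Section wallis.
Variable R : realType.
Local Notation mu := (@lebesgue_measure R).
Implicit Types a t : R.

(** Wallis integrals deformed by cos(2at): their recurrence in n produces Euler's factors 1 -
    a^2/k^2, which leads to the sine product. *)
Definition wallis a (n : nat) : R :=
  \int[mu]_(t in `[0, pi / 2]) (cos t ^+ n * cos (2 * a * t)).

Let cf a n : continuous (fun t => cos t ^+ n * cos (2 * a * t)).
Proof.
move=> t; apply: cvgM.
  apply: (@continuous_comp _ _ _ cos (fun x => x ^+ n)).
    exact: continuous_cos.
  exact: exprn_continuous.
apply: (@continuous_comp _ _ _ (fun t => 2 * a * t) cos).
  exact: mulrl_continuous.
exact: continuous_cos.
Qed.

(** Two integrations by parts, condensed into a primitive [F] that vanishes at both endpoints. *)
Lemma wallis_rec a n :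
  (n.+2%:R ^+ 2 - 4 * a ^+ 2) * wallis a n.+2 = n.+2%:R * n.+1%:R * wallis a n.
Proof.
have p2 : 0 < pi / 2 :> R by rewrite divr_gt0 ?pi_gt0.
pose F t := n.+2%:R * (cos t ^+ n.+1 * sin t * cos (2 * a * t))
  - 2 * a * (cos t ^+ n.+2 * sin (2 * a * t)).
pose f t := (n.+2%:R ^+ 2 - 4 * a ^+ 2) * (cos t ^+ n.+2 * cos (2 * a * t))
  - n.+2%:R * n.+1%:R * (cos t ^+ n * cos (2 * a * t)).
have dF (t : R) : is_derive t (1 : R) F (f t).
  have dC := @dcomp _ cos ( *%R (2 * a)) t _ _ (is_derive_cos _) (dlin _ _).
  have dS := @dcomp _ sin ( *%R (2 * a)) t _ _ (is_derive_sin _) (dlin _ _).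
  have dA := dM (dM (dX n (is_derive_cos t)) (is_derive_sin t)) dC.
  apply: (is_derive_eq
    (dB (dZ n.+2%:R dA) (dZ (2 * a) (dM (dX n.+1 (is_derive_cos t)) dS)))).
  apply/eqP; rewrite -subr_eq0; apply/eqP.
  transitivity (n.+2%:R * n.+1%:R * cos t ^+ n * cos (2 * a * t) *
    (1 - (cos t ^+ 2 + sin t ^+ 2))); last by rewrite cos2Dsin2 subrr mulr0.
  rewrite /f !exprS -[n.+2%:R]natr1 -[n.+1%:R]natr1; ring.
have cof : continuous f.
  by move=> t; apply: cvgB; apply: cvgM; (exact: cvg_cst || exact: cf).
have := segment_RFTC2 p2 cof dF.
rewrite /F mulr0 sin0 cos0 !mulr0 mul0r !mulr0 subr0 cos_pihalf exprS !mul0r.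
rewrite exprS !mul0r !mulr0 subr0 /f RintegralB//; last 2 first.
- apply: continuous_segment_integrable => t.
  by apply: cvgM; [exact: cvg_cst|exact: cf].
- apply: continuous_segment_integrable => t.
  by apply: cvgM; [exact: cvg_cst|exact: cf].
rewrite !RintegralZl//; try exact: continuous_segment_integrable.
rewrite subrr => /eqP; rewrite subr_eq0 => /eqP; exact.
Qed.

Lemma wallis0 a : a != 0 -> wallis a 0 = sin (pi * a) / (2 * a).
Proof.
move=> a0; have p2 : 0 < pi / 2 :> R by rewrite divr_gt0 ?pi_gt0.
have dF (t : R) : is_derive t (1 : R) (fun t => (2 * a)^-1 * sin (2 * a * t))
    (cos t ^+ 0 * cos (2 * a * t)).
  have dS := @dcomp _ sin ( *%R (2 * a)) t _ _ (is_derive_sin _) (dlin _ _).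
  apply: (is_derive_eq (dZ _ dS)).
  by field.
rewrite /wallis (segment_RFTC2 p2 (@cf a 0) dF).
have -> : 2 * a * (pi / 2) = pi * a by field.
by rewrite !mulr0 sin0 mulr0 subr0 mulrC.
Qed.

Lemma wallis00 : wallis 0 0 = pi / 2.
Proof.
have p2 : 0 < pi / 2 :> R by rewrite divr_gt0 ?pi_gt0.
have dF (t : R) : is_derive t (1 : R) id (cos t ^+ 0 * cos (2 * 0 * t)).
  by rewrite mulr0 mul0r cos0 mulr1 expr0; exact: did.
by rewrite /wallis (segment_RFTC2 p2 (@cf 0 0) dF) subr0.
Qed.

Lemma wallis_even_rec a n :
  (n.+1%:R ^+ 2 - a ^+ 2) * wallis a n.+1.*2 =
  n.+1%:R * (n%:R + 2^-1) * wallis a n.*2.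
Proof.
have := wallis_rec a n.*2; rewrite -doubleS.
set A := wallis _ _; set B := wallis _ _.
rewrite -[n.*2.+1]addn1 -!mul2n !natrD !natrM -[n.+1%:R]natr1 => h.
have {}h : 4 * (((n%:R + 1) ^+ 2 - a ^+ 2) * A) = 4 * ((n%:R + 1) * (n%:R + 2^-1) * B).
  transitivity (((2 * (n%:R + 1)) ^+ 2 - 4 * a ^+ 2) * A); first by ring.
  by rewrite h; field.
by apply: (mulfI _ h); rewrite pnatr_eq0.
Qed.

Lemma wallis_even0_gt0 n : 0 < wallis 0 n.*2.
Proof.
elim: n => [|n IH]; first by rewrite wallis00 divr_gt0 ?pi_gt0.
have := wallis_even_rec 0 n; rewrite expr0n /= subr0 => h.
have : 0 < n.+1%:R ^+ 2 * wallis 0 n.+1.*2.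
  by rewrite h !mulr_gt0// ltr_wpDl// invr_gt0.
by rewrite pmulr_rgt0// exprn_gt0.
Qed.

Lemma mul_cos_le_sin t : 0 <= t <= pi / 2 -> t * cos t <= sin t.
Proof.
move=> /andP[t0 tp]; rewrite -subr_ge0.
have -> : 0 = sin 0 - 0 * cos 0 :> R by rewrite sin0 mul0r subr0.
apply: (@ge0_derive_le _ (fun y => sin y - y * cos y) (fun y => y * sin y)) => //.
  move=> y; apply: (is_derive_eq (dB (is_derive_sin y) (dM (did y) (is_derive_cos y)))).
  by rewrite mul1r mulrN opprD opprK addNKr.
move=> y /andP[y0 yt]; rewrite mulr_ge0// sin_ge0_pi// y0/=.
by rewrite (le_trans yt)// (le_trans tp)// ler_pdivrMr// ler_peMr ?pi_ge0// ler1n.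
Qed.

(** From 1 - cos(2at) <= 2 a^2 t^2 and t cos t <= sin t: the factor t^2 cos^2 t is at most sin^2 t =
    1 - cos^2 t, and this turns the bound into a difference of undeformed integrals. *)
Lemma wallis_dist a n : `|wallis 0 n.+1.*2 - wallis a n.+1.*2| <=
  2 * a ^+ 2 * (wallis 0 n.*2 - wallis 0 n.+1.*2).
Proof.
have int b k := @continuous_segment_integrable _ _ 0 (pi / 2) (@cf b k).
rewrite /wallis -!RintegralB//.
rewrite -RintegralZl//; last first.
  by apply: continuous_segment_integrable => t; apply: cvgB; exact: cf.
apply: le_trans (le_normr_Rintegral _ _) _ => //.
  by apply: continuous_segment_integrable => t; apply: cvgB; exact: cf.
apply: le_Rintegral => //.
- apply: continuous_segment_integrable => t.
  by apply: cvg_norm; apply: cvgB; exact: cf.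
- apply: continuous_segment_integrable => t.
  by apply: cvgM; [exact: cvg_cst|apply: cvgB; exact: cf].
move=> t; rewrite /= in_itv/= => /andP[t0 tp].
have c0 : 0 <= cos t.
  by apply: cos_ge0_pihalf; rewrite tp andbT (le_trans _ t0)// oppr_le0 divr_ge0 ?pi_ge0.
rewrite mulr0 mul0r cos0 !mulr1 -{1}[cos t ^+ _]mulr1 -mulrBr.
rewrite normrM ger0_norm ?exprn_ge0// ger0_norm ?onem_cos_ge0//.
apply: (@le_trans _ _ (cos t ^+ n.+1.*2 * (2 * a ^+ 2 * t ^+ 2))).
  rewrite ler_wpM2l ?exprn_ge0// (le_trans (onem_cos_le _))//.
  by rewrite le_eqVlt; apply/orP/or_introl/eqP; field.
rewrite mulrCA ler_wpM2l ?(mulr_ge0 _ (sqr_ge0 _))// doubleS exprSr exprSr.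
have -> : cos t ^+ n.*2 * cos t * cos t * t ^+ 2 = cos t ^+ n.*2 * (t * cos t) ^+ 2.
  by ring.
have -> : cos t ^+ n.*2 - cos t ^+ n.*2 * cos t * cos t = cos t ^+ n.*2 * sin t ^+ 2.
  by rewrite sin2cos2; ring.
rewrite ler_wpM2l ?exprn_ge0// lerXn2r ?nnegrE ?mulr_ge0//.
  by rewrite (le_trans _ (mul_cos_le_sin _)) ?mulr_ge0// t0.
by rewrite mul_cos_le_sin// t0.
Qed.

(** By the recurrence at a = 0, the drop between consecutive even Wallis integrals is at most
    1/(n+1) times the later one, so [wallis_dist] becomes a relative error of order 1/n. *)
Lemma wallis_ratio_cvg a :
  wallis a n.*2 / wallis 0 n.*2 @[n --> \oo] --> (1 : R).
Proof.
apply/subr_cvg0; apply: norm_cvg0; rewrite -cvg_shiftS /=.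
have h0 : 2 * a ^+ 2 * n.+1%:R^-1 @[n --> \oo] --> (0 : R).
  rewrite -(mulr0 (2 * a ^+ 2)); apply: cvgM; first exact: cvg_cst.
  exact: cvg_harmonic.
apply: (squeeze_cvgr _ (cvg_cst 0) h0); near=> n; rewrite normr_ge0/=.
have w0 := wallis_even0_gt0 n.+1.
have -> : wallis a n.+1.*2 / wallis 0 n.+1.*2 - 1 =
    (wallis a n.+1.*2 - wallis 0 n.+1.*2) / wallis 0 n.+1.*2.
  by rewrite mulrBl divff// gt_eqF.
rewrite normrM distrC (ger0_norm (_ : 0 <= _^-1)) ?invr_ge0 ?(ltW w0)//.
rewrite ler_pdivrMr// (le_trans (wallis_dist a n))// -[leRHS]mulrA.
rewrite ler_wpM2l ?(mulr_ge0 _ (sqr_ge0 _))//.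
have := wallis_even_rec 0 n; rewrite expr0n /= subr0.
move: w0; set A := wallis _ _; set B := wallis _ _ => w0 h.
have n0 : 0 < n.+1%:R :> R by [].
have h2 : n.+1%:R * A = (n%:R + 2^-1) * B.
  by apply: (mulfI (lt0r_neq0 n0)); rewrite mulrA -expr2 h mulrA.
have n1 : 0 <= n%:R :> R by [].
rewrite ler_pdivlMl//.
have -> : n.+1%:R * (B - A) = B / 2.
  by rewrite mulrBr h2 -natr1; field.
move: h2; rewrite -natr1; have : 0 <= n%:R * A by rewrite mulr_ge0// ltW.
nra.
Unshelve. all: by end_near. Qed.

Lemma wallis_prod a n :
  wallis a n.*2 / wallis 0 n.*2 * \prod_(k < n) (1 - a ^+ 2 / k.+1%:R ^+ 2) =
  wallis a 0 / wallis 0 0.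
Proof.
elim: n => [|n IH]; first by rewrite big_ord0 mulr1.
rewrite -IH big_ord_recr /= [RHS]mulrC [in LHS]mulrCA; congr (_ * _).
have h := wallis_even_rec a n; have h0 := wallis_even_rec 0 n.
have w0 := lt0r_neq0 (wallis_even0_gt0 n); have w1 := lt0r_neq0 (wallis_even0_gt0 n.+1).
have n0 : n.+1%:R != 0 :> R by rewrite pnatr_eq0.
have n2 : n%:R + 2^-1 != 0 :> R by rewrite lt0r_neq0// ltr_wpDl// invr_gt0.
move: h0; rewrite expr0n /= subr0.
move: h w0 w1; set A := wallis a _; set B := wallis a _; set C := wallis 0 _.
set D := wallis 0 _ => h w0 w1 h0.
rewrite mulrAC; apply: (mulIf w1); rewrite divfK//.
apply: (mulfI n2); apply: (mulfI n0); apply: (mulfI n0).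
transitivity ((n%:R + 2^-1) * ((n.+1%:R ^+ 2 - a ^+ 2) * A)); first by field.
rewrite h; transitivity (B / C * (n%:R + 2^-1) * (n.+1%:R ^+ 2 * D)); last by ring.
by rewrite h0; field.
Qed.

(** By [wallis_prod] the partial product times the Wallis ratio is independent of n, and the ratio
    tends to 1. *)
Lemma euler_sine_product a : a != 0 ->
  \prod_(k < n) (1 - a ^+ 2 / k.+1%:R ^+ 2) @[n --> \oo] --> sin (pi * a) / (pi * a).
Proof.
move=> a0.
have r0 : wallis a 0 / wallis 0 0 = sin (pi * a) / (pi * a).
  have := lt0r_neq0 (pi_gt0 R) => p0.
  rewrite wallis0// wallis00 !invfM invrK.
  transitivity (sin (pi * a) * (pi^-1 * a^-1) * (2^-1 * 2)); first by ring.
  by rewrite mulVf ?pnatr_eq0// mulr1.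
rewrite -r0; set L := _ / _.
have cv : (wallis a n.*2 / wallis 0 n.*2)^-1 @[n --> \oo] --> (1 : R)^-1.
  by apply: cvgV; [exact: oner_neq0|exact: wallis_ratio_cvg].
have cvr : L * (wallis a n.*2 / wallis 0 n.*2)^-1 @[n --> \oo] --> L * 1^-1.
  by apply: cvgM => //; exact: cvg_cst.
rewrite invr1 mulr1 in cvr.
apply: cvg_trans cvr; apply: near_eq_cvg.
have := wallis_ratio_cvg a => /cvgr_gt /(_ _ ltr01).
move=> /= h; near=> n.
rewrite /= /L -(wallis_prod a n) mulrAC divff ?mul1r//.
by apply: lt0r_neq0; near: n.
Unshelve. all: by end_near. Qed.

End wallis.

Section reflection.
Variable R : realType.

Lemma gauss_seq_real (a : R) n : gauss_seq a%:C n =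
  (\prod_(k < n.+1) (a + k%:R) / (n`!%:R * expR (a * ln n%:R)))%:C.
Proof.
rewrite /gauss_seq -(rmorphM (real_complex R)) cexp_real.
rewrite -(rmorphM (real_complex R)) -fmorphV (rmorphM (real_complex R)) /=.
congr (_ * _); rewrite rmorph_prod; apply: eq_bigr => k _.
by rewrite rmorphD.
Qed.

Lemma rgamma_real (a : R) : rgamma a%:C = (Re (rgamma a%:C))%:C.
Proof.
apply: eqc => //=.
by under eq_fun do rewrite gauss_seq_real /=; rewrite lim_cst.
Qed.

Lemma prod_reflection (a : R) n :
  \prod_(k < n.+1) (a + k%:R) * \prod_(k < n.+1) (1 - a + k%:R) =
  a * (n.+1%:R - a) * n`!%:R ^+ 2 * \prod_(k < n) (1 - a ^+ 2 / k.+1%:R ^+ 2).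
Proof.
elim: n => [|n IH].
  by rewrite !big_ord_recl !big_ord0 fact0 expr1n !mulr1 !addr0.
rewrite big_ord_recr [X in _ * X]big_ord_recr [X in _ = _ * X]big_ord_recr /=.
rewrite mulrACA IH factS natrM.
by rewrite -[n.+2%:R]natr1; field; rewrite ?natr1 ?nat1r pnatr_eq0.
Qed.

(** The powers n^a and n^(1-a) multiply to n, and the two products over k pair up into a partial
    product of Euler's sine product. *)
Lemma rgamma_reflection (a : R) : a != 0 ->
  rgamma a%:C * rgamma (1 - a)%:C = (sin (pi * a) / pi)%:C.
Proof.
move=> a0; apply: ccvg_unique (ccvgM (cvg_gauss_seq _) (cvg_gauss_seq _)) _.
apply/ccvg_shiftS.
have p0 := lt0r_neq0 (pi_gt0 R).
pose f n := a * (1 + (1 - a) * n.+1%:R^-1) *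
  \prod_(k < n.+1) (1 - a ^+ 2 / k.+1%:R ^+ 2).
rewrite (_ : (fun _ => _) = fun n => (f n)%:C); last first.
  apply/funext => n; rewrite !gauss_seq_real -(rmorphM (real_complex R)) /=.
  congr (_%:C); rewrite mulrACA prod_reflection -invfM [X in _ / X]mulrACA -expRD -mulrDl.
  rewrite subrKC mul1r lnK ?posrE// /f -[n.+2%:R]natr1.
  by field; rewrite nat1r !pnatr_eq0 -!lt0n fact_gt0.
apply: ccvg_real.
have -> : sin (pi * a) / pi = a * (1 + (1 - a) * 0) * (sin (pi * a) / (pi * a)).
  rewrite mulr0 addr0 mulr1 invfM.
  transitivity (sin (pi * a) * pi^-1 * (a * a^-1)); last by ring.
  by rewrite divff// mulr1.
have sp := euler_sine_product a0; rewrite -cvg_shiftS /= in sp.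
apply: cvgM; last exact: sp.
apply: cvgM; first exact: cvg_cst.
apply: cvgD; first exact: cvg_cst.
by apply: cvgM; [exact: cvg_cst|exact: cvg_harmonic].
Qed.

End reflection.

(** * Partial fractions and Tannery's theorem *)

Section partial_fractions.
Variable F : fieldType.
Variables r c : nat -> F.

(** The residue at the pole [c j] of the product of the (s - r k)/(s - c k), for distinct poles. *)
Definition pf_coef (n j : nat) : F :=
  (c j - r j) * \prod_(k < n | k != j :> nat) ((c j - r k) / (c j - c k)).

Lemma pf_coefS n j : (j < n)%N ->
  pf_coef n.+1 j = pf_coef n j * ((c j - r n) / (c j - c n)).
Proof.
by move=> jn; rewrite /pf_coef big_mkcond big_ord_recr /= -big_mkcond gtn_eqF// mulrA.
Qed.

Lemma pf_coef_last n :
  pf_coef n.+1 n = (c n - r n) * \prod_(k < n) ((c n - r k) / (c n - c k)).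
Proof.
rewrite /pf_coef big_mkcond big_ord_recr /= eqxx mulr1; congr (_ * _).
by apply: eq_bigr => k _; rewrite ltn_eqF.
Qed.

(** Induction on the number of factors. The residue at the new pole contains the old product
    evaluated at [c n], which the induction hypothesis, used a second time with s = c n, expands. *)
Lemma partial_fractions n (s : F) :
  (forall i j, (i < n)%N -> (j < n)%N -> i != j -> c i != c j) ->
  (forall i, (i < n)%N -> s != c i) ->
  \prod_(k < n) ((s - r k) / (s - c k)) = 1 + \sum_(j < n) pf_coef n j / (s - c j).
Proof.
elim: n s => [|n IH] s cij sc; first by rewrite !big_ord0 addr0.
have cij' i j : (i < n)%N -> (j < n)%N -> i != j -> c i != c j.
  by move=> i_n j_n; apply: cij; exact: leqW.
have sc' i : (i < n)%N -> s != c i by move=> i_n; apply: sc; exact: leqW.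
have cn i : (i < n)%N -> c n != c i.
  by move=> i_n; apply: cij => //; [exact: leqW|rewrite gtn_eqF].
rewrite big_ord_recr big_ord_recr /= pf_coef_last (IH s)// (IH (c n))//.
have sn : s - c n != 0 by rewrite subr_eq0 sc.
have -> : \sum_(j < n) pf_coef n.+1 j / (s - c j) =
    \sum_(j < n) pf_coef n j / (s - c j) * ((s - r n) / (s - c n))
    - (c n - r n) / (s - c n) * \sum_(j < n) pf_coef n j / (c n - c j).
  rewrite mulr_sumr -sumrB; apply: eq_bigr => j _.
  have jn : c n - c j != 0 by rewrite subr_eq0 cn.
  have sj : s - c j != 0 by rewrite subr_eq0 sc'.
  rewrite pf_coefS//; field.
  by rewrite jn sj sn -opprB oppr_eq0 jn.
rewrite -mulr_suml; field.
by rewrite sn.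
Qed.
End partial_fractions.

Section coefficients.
Variable R : realType.
Implicit Types a al x : R.

(** The Pochhammer symbol. *)
Definition rising x (N : nat) : R := \prod_(k < N) (x + k%:R).

Lemma rising_shift x N : rising x N * (x + N%:R) = x * rising (x + 1) N.
Proof.
have -> : rising x N * (x + N%:R) = rising x N.+1 by rewrite /rising big_ord_recr.
rewrite /rising big_ord_recl addr0; congr (_ * _); apply: eq_bigr => k _.
by rewrite -addrA nat1r.
Qed.

Definition lagrange_den (N j : nat) : R := \prod_(k < N | k != j :> nat) (k%:R - j%:R).

Lemma lagrange_denE j m :
  lagrange_den (j.+1 + m) j = (-1) ^+ j * j`!%:R * m`!%:R.
Proof.
elim: m => [|m IH].
  rewrite addn0 fact0 mulr1 /lagrange_den big_mkcond big_ord_recr /= eqxx mulr1.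
  have -> : \prod_(i < j) (if i != j :> nat then i%:R - j%:R else 1) =
            \prod_(i < j) (-1 * (i.+1%:R)) :> R.
    rewrite (reindex_inj rev_ord_inj); apply: eq_bigr => i _ /=.
    rewrite ltn_eqF/=; last by rewrite ltn_subrL (leq_trans _ (ltn_ord i)).
    by rewrite natrB ?ltn_ord// mulN1r addrAC subrr sub0r.
  rewrite big_split /= prodr_const card_ord; congr (_ * _).
  by rewrite fact_prod big_add1 /= big_mkord natr_prod.
rewrite addnS /lagrange_den big_mkcond big_ord_recr /= -big_mkcond -/(lagrange_den _ _) IH.
rewrite gtn_eqF/=; last by rewrite addSn ltnS leq_addr.
by rewrite addSn -addnS natrD addrAC subrr add0r factS natrM -mulrA [_ * m.+1%:R]mulrC.
Qed.

Lemma lagrange_denS N j : (j.+1 < N)%N ->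
  lagrange_den N j.+1 * (N.-1 - j)%:R = - j.+1%:R * lagrange_den N j.
Proof.
move=> jN; have [m ->] : exists m, N = (j.+2 + m)%N by exists (N - j.+2)%N; rewrite subnKC.
rewrite [in RHS]addSnnS !lagrange_denE addSn /= addSnnS addKn.
by rewrite exprS !factS !natrM; ring.
Qed.

Lemma lagrange_den_neq0 N j : lagrange_den N j != 0.
Proof.
apply/prodf_neq0 => k kj; rewrite subr_eq0 eqr_nat //.
Qed.

(** The residue at the left pole -j of the rational approximant with N poles in each family, see
    [pf_coef_left]. *)
Definition res_coef a al (N j : nat) : R :=
  rising (a - j%:R) N * rising (1 - a + j%:R) N /
  (lagrange_den N j * rising (1 - al + j%:R) N).

(** The coefficient of t^j in (1 - t)^(al - 1), see [binomial_series]. *)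
Definition binw al (j : nat) : R := \prod_(i < j) ((1 - al + i%:R) / i.+1%:R).

(** Relative to the residue at 0, the residue at -j is [binw al j] times this correction, which
    tends to 1 as N grows. *)
Definition res_factor a al (N j : nat) : R :=
  \prod_(i < j) (((N.-1 - i)%:R / ((N.-1 - i)%:R + a)) *
    ((N.+1%:R + i%:R - a) / (N.+1%:R + i%:R - al))).

Lemma rising_neq0 x N : (forall k : nat, x + k%:R != 0) -> rising x N != 0.
Proof. by move=> h; apply/prodf_neq0. Qed.

Lemma natr_pred_sub N j : (j < N)%N -> (N.-1 - j)%:R = N%:R - 1 - j%:R :> R.
Proof. by case: N => // N jN; rewrite natrB//= -[N.+1%:R]natr1 addrK. Qed.

Lemma res_coefS a al N j : (j.+1 < N)%N -> 0 < a < 1 -> 1 < al < 2 ->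
  res_coef a al N j.+1 = res_coef a al N j * ((1 - al + j%:R) / j.+1%:R *
    ((N.-1 - j)%:R / ((N.-1 - j)%:R + a) *
    ((N.+1%:R + j%:R - a) / (N.+1%:R + j%:R - al)))).
Proof.
move=> jN /andP[a0 a1] /andP[al1 al2]; rewrite /res_coef.
have j0 : 0 <= j%:R :> R by [].
have N2 : j%:R + 2 <= N%:R :> R by rewrite -natrD addn2 ler_nat.
have W0 : rising (1 - al + j%:R) N != 0.
  apply: rising_neq0 => k; rewrite -addrA -natrD.
  case: (j + k)%N => [|m]; first by rewrite addr0 lt_eqF// subr_lt0.
  by rewrite gt_eqF// -natr1; have : 0 <= m%:R :> R by []; lra.
have D0 := lagrange_den_neq0 N j.
have n1 : a - j.+1%:R + N%:R != 0 by rewrite gt_eqF// -natr1; lra.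
have n2 : 1 - a + j%:R != 0 by rewrite gt_eqF//; lra.
have n3 : 1 - al + j%:R != 0.
  case: (j) => [|m]; first by rewrite addr0 lt_eqF// subr_lt0.
  by rewrite gt_eqF// -natr1; have : 0 <= m%:R :> R by []; lra.
have n4 : N%:R - 1 - j%:R != 0 :> R by rewrite gt_eqF//; lra.
have -> : rising (a - j.+1%:R) N =
    (a - j.+1%:R) * rising (a - j%:R) N / (a - j.+1%:R + N%:R).
  apply: (mulIf n1); rewrite rising_shift divfK//; congr (_ * rising _ _).
  by rewrite -natr1; ring.
have -> : rising (1 - a + j.+1%:R) N =
    rising (1 - a + j%:R) N * (1 - a + j%:R + N%:R) / (1 - a + j%:R).
  by apply: (mulIf n2); rewrite divfK// rising_shift mulrC; congr (_ * rising _ _); rewrite -natr1; ring.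
have -> : rising (1 - al + j.+1%:R) N =
    rising (1 - al + j%:R) N * (1 - al + j%:R + N%:R) / (1 - al + j%:R).
  by apply: (mulIf n3); rewrite divfK// rising_shift mulrC; congr (_ * rising _ _); rewrite -natr1; ring.
have -> : lagrange_den N j.+1 = - j.+1%:R * lagrange_den N j / (N%:R - 1 - j%:R).
  by apply: (mulIf n4); rewrite divfK// -lagrange_denS// natr_pred_sub// ltnW.
have n5 : j%:R + 1 != 0 :> R by rewrite gt_eqF//; lra.
have n6 : N%:R - 1 - j%:R + a != 0 by rewrite gt_eqF//; lra.
have n7 : N%:R + 1 + j%:R - al != 0 by rewrite gt_eqF//; lra.
rewrite natr_pred_sub ?(ltnW jN)// -[j.+1%:R]natr1 -[N.+1%:R]natr1.
move: n1; rewrite -[j.+1%:R]natr1 => n1.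
move: (rising _ _) (rising _ _) (rising _ _) (lagrange_den _ _) D0 W0 => U V W D D0 W0.
move: (j%:R) (N%:R) n1 n2 n3 n4 n5 n6 n7 {j0 N2} => x M n1 n2 n3 n4 n5 n6 n7.
field.
by rewrite n7 n6 n5 W0 D0 n3 n4 n2.
Qed.

Lemma res_coefE a al N j : (j < N)%N -> 0 < a < 1 -> 1 < al < 2 ->
  res_coef a al N j = res_coef a al N 0 * (binw al j * res_factor a al N j).
Proof.
move=> + ha hal; elim: j => [|j IH] jN.
  by rewrite /binw /res_factor !big_ord0 !mulr1.
rewrite res_coefS// IH ?(ltnW jN)// /binw /res_factor !big_ord_recr /=.
by rewrite -[LHS]mulrA; congr (_ * _); exact: mulrACA.
Qed.

Lemma res_factor_ge0 a al N j : (j < N)%N -> 0 < a < 1 -> 1 < al < 2 ->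
  0 <= res_factor a al N j.
Proof.
move=> jN /andP[a0 a1] /andP[al1 al2]; apply: prodr_ge0 => i _.
have i0 : 0 <= i%:R :> R by [].
have N1 : 1 <= N%:R :> R by rewrite ler1n (leq_trans _ jN).
rewrite mulr_ge0//; first by rewrite divr_ge0// addr_ge0// ltW.
by rewrite divr_ge0// -natr1; lra.
Qed.

(** Each of the j factors is at most 1 + q <= exp q with q = 2/(N + 1 - al), and j q <= 2 because j
    < N and al < 2. The bound is uniform in N and j, as the domination in Tannery's theorem
    requires. *)
Lemma res_factor_le a al N j : (j < N)%N -> 0 < a < 1 -> 1 < al < 2 ->
  res_factor a al N j <= expR 2.
Proof.
move=> jN /andP[a0 a1] /andP[al1 al2].
have N1 : 1 <= N%:R :> R by rewrite ler1n (leq_trans _ jN).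
set q := 2 / (N.+1%:R - al).
have d0 : 0 < N.+1%:R - al by rewrite -natr1; lra.
have q0 : 0 <= q by rewrite divr_ge0// ltW.
apply: (@le_trans _ _ (\prod_(i < j) expR q)).
  apply: ler_prod => i _.
  have i0 : 0 <= i%:R :> R by [].
  have m0 : 0 <= (N.-1 - i)%:R :> R by [].
  have num0 : 0 <= N.+1%:R + i%:R - a by rewrite -natr1; lra.
  have den0 : 0 <= N.+1%:R + i%:R - al by rewrite -natr1; lra.
  have ma0 : 0 <= (N.-1 - i)%:R + a by rewrite addr_ge0// ltW.
  rewrite mulr_ge0 ?(divr_ge0 num0 den0) ?(divr_ge0 m0 ma0)//=.
  rewrite (le_trans _ (expR_ge1Dx _))//.
  apply: (@le_trans _ _ (1 * ((N.+1%:R + i%:R - a) / (N.+1%:R + i%:R - al)))).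
    rewrite ler_wpM2r//; first by rewrite divr_ge0.
    by rewrite ler_pdivrMr ?ltr_wpDl// mul1r lerDl ltW.
  rewrite mul1r ler_pdivrMr; last by rewrite -natr1; lra.
  rewrite mulrDl mul1r /q.
  have : 2 <= 2 / (N.+1%:R - al) * (N.+1%:R + i%:R - al).
    by rewrite mulrAC ler_pdivlMr// ler_wpM2l//; lra.
  lra.
rewrite prodr_const card_ord -expRM_natr ler_expR /q -mulrA ler_piMr//.
rewrite mulrC ler_pdivrMr// mul1r -natr1.
have : j%:R + 1 <= N%:R :> R by rewrite natr1 ler_nat.
lra.
Qed.

Lemma cvg_shifted_ratio x y :
  (n%:R + x) / (n%:R + y) @[n --> \oo] --> (1 : R).
Proof.
rewrite -cvg_shiftS /=.
have -> : (fun n => (n.+1%:R + x) / (n.+1%:R + y)) =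
    fun n => (1 + x * n.+1%:R^-1) / (1 + y * n.+1%:R^-1) :> R.
  apply/funext => n; have n0 : n.+1%:R != 0 :> R by rewrite pnatr_eq0.
  have E (t : R) : n.+1%:R + t = n.+1%:R * (1 + t * n.+1%:R^-1) by field.
  by rewrite (E x) (E y) invfM mulrACA divff// mul1r.
have h (t : R) : 1 + t * n.+1%:R^-1 @[n --> \oo] --> (1 + t * 0 : R).
  apply: cvgD; first exact: cvg_cst.
  by apply: cvgM; [exact: cvg_cst|exact: cvg_harmonic].
suff : (1 + x * n.+1%:R^-1) / (1 + y * n.+1%:R^-1) @[n --> \oo] -->
    ((1 + x * 0) / (1 + y * 0) : R) by rewrite !mulr0 addr0 divr1.
apply: cvgM; first exact: h.
by apply: cvgV; [rewrite mulr0 addr0 oner_neq0|exact: h].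
Qed.

Lemma cvg_res_factor a al j :
  res_factor a al n.+1 j @[n --> \oo] --> (1 : R).
Proof.
elim: j => [|j IH].
  rewrite /res_factor; under eq_fun do rewrite big_ord0.
  exact: cvg_cst.
rewrite /res_factor; under eq_fun do rewrite big_ord_recr /=.
have h1 : (n.+1.-1 - j)%:R / ((n.+1.-1 - j)%:R + a) @[n --> \oo] --> (1 : R).
  rewrite -(cvg_shiftn j) /=.
  have := cvg_shifted_ratio 0 a; apply: cvg_trans; apply: near_eq_cvg.
  by apply: nearW => n; rewrite addnK addr0.
have h2 : (n.+2%:R + j%:R - a) / (n.+2%:R + j%:R - al) @[n --> \oo] --> (1 : R).
  have := cvg_shifted_ratio (2 + j%:R - a) (2 + j%:R - al).
  apply: cvg_trans; apply: near_eq_cvg; apply: nearW => n.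
  by rewrite -[n.+2]addn2 natrD -!addrA.
suff : res_factor a al n.+1 j * ((n.+1.-1 - j)%:R / ((n.+1.-1 - j)%:R + a) *
    ((n.+2%:R + j%:R - a) / (n.+2%:R + j%:R - al))) @[n --> \oo] --> (1 * (1 * 1) : R).
  by rewrite !mulr1.
by apply: cvgM => //; exact: cvgM.
Qed.

Lemma binwS al j : binw al j.+1 = binw al j * ((1 - al + j%:R) / j.+1%:R).
Proof. by rewrite /binw big_ord_recr. Qed.

Lemma binw0 al : binw al 0 = 1. Proof. by rewrite /binw big_ord0. Qed.

Lemma binwS_le0 al j : 1 < al < 2 -> binw al j.+1 <= 0.
Proof.
move=> /andP[al1 al2]; elim: j => [|j IH].
  by rewrite binwS binw0 addr0 mul1r divr1 subr_le0 ltW.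
rewrite binwS mulr_le0_ge0// divr_ge0// -natr1.
have : 0 <= j%:R :> R by [].
lra.
Qed.

(** Summing coefficients amounts to dividing (1 - t)^(al - 1) by 1 - t, and the right-hand side is
    the n-th coefficient of (1 - t)^(al - 2). *)
Lemma sum_binw al n : \sum_(j < n.+1) binw al j =
  \prod_(i < n) ((2 - al + i%:R) / i.+1%:R).
Proof.
have shift k : binw al k.+1 =
    \prod_(i < k) ((2 - al + i%:R) / i.+1%:R) * ((1 - al) / k.+1%:R).
  elim: k => [|k IH]; first by rewrite binwS binw0 big_ord0 !mul1r addr0.
  rewrite binwS IH big_ord_recr /=; have : k.+2%:R != 0 :> R by [].
  have : k.+1%:R != 0 :> R by [].
  rewrite -[k.+2%:R]natr1 -[k.+1%:R]natr1 => h h'.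
  by field; rewrite h h'.
elim: n => [|n IH]; first by rewrite big_ord_recl !big_ord0 addr0 binw0.
rewrite big_ord_recr /= IH shift big_ord_recr /= -[X in X + _]mulr1 -mulrDr.
congr (_ * _); have : n.+1%:R != 0 :> R by [].
by rewrite -[n.+1%:R]natr1 => h; field.
Qed.

(** All coefficients but the first are nonpositive, so the absolute sum is 2 minus the ordinary sum,
    and the latter is nonnegative by [sum_binw]. *)
Lemma series_norm_binw_le al n : 1 < al < 2 ->
  series (fun j => `|binw al j|) n <= 2.
Proof.
move=> hal; have [al1 al2] := andP hal.
case: n => [|n]; first by rewrite /series/= big_geq.
rewrite /series/= big_mkord big_ord_recl /= binw0 normr1.
under eq_bigr do rewrite ler0_norm ?binwS_le0//.
rewrite sumrN; have := sum_binw al n; rewrite big_ord_recl /= binw0 => h.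
have : 0 <= \prod_(i < n) ((2 - al + i%:R) / i.+1%:R).
  by apply: prodr_ge0 => i _; rewrite divr_ge0// addr_ge0// subr_ge0 ltW.
by rewrite -h; set S := \sum_(_ < _) _; lra.
Qed.

Lemma cvg_series_norm_binw al : 1 < al < 2 ->
  cvgn (series (fun j => `|binw al j|)).
Proof.
move=> hal; apply: nondecreasing_is_cvgn.
  by apply/nondecreasing_seqP => n; rewrite seriesSr lerDl.
by exists 2 => _ [n _ <-]; exact: series_norm_binw_le.
Qed.

End coefficients.

Section tannery.
Variable R : realType.

Lemma cvg_sum_seq (I : Type) (r : seq I) (f : nat -> I -> R) (l : I -> R) :
  (forall i, f n i @[n --> \oo] --> l i) ->
  \sum_(i <- r) f n i @[n --> \oo] --> \sum_(i <- r) l i.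
Proof.
move=> fl; elim: r => [|i r IH].
  by under eq_fun do rewrite big_nil; rewrite big_nil; exact: cvg_cst.
under eq_fun do rewrite big_cons; rewrite big_cons.
by apply: cvgD; [exact: fl|exact: IH].
Qed.

(** Dominated convergence for sums whose range grows with n: a fixed head of length [K] converges
    term by term, and the rest is at most twice a tail of the series of [g]. *)
Lemma tannery (f : nat -> nat -> R) (l g : nat -> R) :
  (forall n j, (j < n)%N -> `|f n j| <= g j) -> cvgn (series g) ->
  (forall j, f n j @[n --> \oo] --> l j) ->
  cvgn (series l) /\ \sum_(j < n) f n j @[n --> \oo] --> limn (series l).
Proof.
move=> fg cg fl.
have lg j : `|l j| <= g j.
  rewrite -(cvg_lim _ (cvg_norm (fl j)))//; apply: limr_le.
    by apply/cvg_ex; exists `|l j|; exact: cvg_norm.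
  by near=> n; apply: fg; near: n; exact: nbhs_infty_gt.
have g0 j : 0 <= g j by rewrite (le_trans _ (lg j)).
have cl : cvgn (series l).
  by apply: normed_cvg; apply: (series_le_cvg _ g0 lg cg) => n /=.
split=> //.
suff d0 : \sum_(j < n) (f n j - l j) @[n --> \oo] --> (0 : R).
  have h : \sum_(j < n) (f n j - l j) + series l n @[n --> \oo] -->
      0 + limn (series l) by apply: cvgD.
  rewrite add0r in h; apply: cvg_trans h; apply: near_eq_cvg; apply: nearW => n.
  by rewrite /series/= big_mkord -big_split; apply: eq_bigr => j _; rewrite /= subrK.
apply/cvgrPdist_le => e e0.
have gnd : {homo series g : n m / (n <= m)%N >-> n <= m}.
  by apply/nondecreasing_seqP => n; rewrite seriesSr lerDl.
have e4 : 0 < e / 4 by rewrite divr_gt0.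
have [K _ KG] : \forall K \near \oo, limn (series g) - series g K <= e / 4.
  have /cvgrPdist_le /(_ _ e4) := cg; apply: filterS => K.
  by rewrite ger0_norm// subr_ge0 nondecreasing_cvgn_le.
have {}KG := KG K (leqnn _).
have hK : \sum_(j < K) `|f n j - l j| @[n --> \oo] --> (0 : R).
  suff : \sum_(j < K) `|f n j - l j| @[n --> \oo] --> (\sum_(j < K) 0 : R).
    by rewrite big1.
  apply: (@cvg_sum_seq _ _ (fun n (j : 'I_K) => `|f n j - l j|) (fun=> 0)) => j.
  by apply/norm_cvg0P/subr_cvg0.
have e2 : 0 < e / 2 by rewrite divr_gt0.
have {}hK := cvgr_le (0 : R) hK _ e2.
near=> n; rewrite sub0r normrN.
have Kn : (K <= n)%N by near: n; exact: nbhs_infty_ge.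
rewrite -(big_mkord xpredT (fun j => f n j - l j)) (big_cat_nat (leq0n K) Kn) /=.
apply: le_trans (ler_normD _ _) _.
rewrite (_ : e = e / 2 + (e / 4) * 2); last by field.
apply: lerD.
  rewrite big_mkord (le_trans (ler_norm_sum _ _ _))//.
  near: n; exact: hK.
apply: (@le_trans _ _ (\sum_(K <= j < n) (g j * 2))).
  apply: le_trans (ler_norm_sum _ _ _) _.
  rewrite big_nat [leRHS]big_nat; apply: ler_sum => j /andP[_ jn].
  rewrite mulr_natr mulr2n (le_trans (ler_normB _ _))// lerD//.
  exact: fg.
rewrite -mulr_suml ler_wpM2r// (le_trans _ KG)//.
have -> : \sum_(K <= j < n) g j = series g n - series g K.
  by rewrite /series/= (big_cat_nat (leq0n K) Kn) /= [RHS]addrC addKr.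
by rewrite lerD2r nondecreasing_cvgn_le.
Unshelve. all: by end_near. Qed.

End tannery.

(** * The quotient of Gamma functions as a series *)

Section residues.
Variable R : realType.
Variables (a al : R) (N : nat).
Hypothesis hal : 1 < al < 2.

(** The two families are merged into one list of length N + N, so that [partial_fractions] is
    applied once: indices below N descend to the left, the others ascend to the right. *)
Definition zeros (k : nat) : R :=
  if (k < N)%N then - a - k%:R else 1 - a + (k - N)%:R.
Definition poles (k : nat) : R :=
  if (k < N)%N then - k%:R else 1 - al + (k - N)%:R.

(** The number al - 1 lies strictly between 0 and 1; this keeps the two families of poles
    disjoint. *)
Lemma natr_neq_onemal (n m : nat) : n%:R != al - 1 + m%:R :> R.
Proof.
have [al1 al2] := andP hal; have [nm|mn] := leqP n m.
  have : n%:R <= m%:R :> R by rewrite ler_nat.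
  by move=> h; rewrite lt_eqF//; lra.
have : m%:R + 1 <= n%:R :> R by rewrite natr1 ler_nat.
by move=> h; rewrite gt_eqF//; lra.
Qed.

Lemma poles_inj i j : (i < N + N)%N -> (j < N + N)%N -> i != j ->
  poles i != poles j.
Proof.
move=> _ _ ij; rewrite /poles; case: ifPn => iN; case: ifPn => jN.
- by rewrite eqr_opp eqr_nat.
- rewrite -eqr_opp opprK opprD opprB; apply/eqP => h.
  have /eqP := natr_neq_onemal (i + (j - N)) 0; apply; rewrite natrD h; ring.
- rewrite -eqr_opp opprK opprD opprB; apply/eqP => h.
  have /eqP := natr_neq_onemal (j + (i - N)) 0; apply; rewrite natrD -h; ring.
- rewrite -!leqNgt in iN jN; rewrite (inj_eq (addrI _)) eqr_nat.
  by rewrite -(eqn_add2r N) !subnK.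
Qed.

Lemma pf_coef_left j : (j < N)%N ->
  pf_coef zeros poles (N + N) j = res_coef a al N j.
Proof.
move=> jN; rewrite /pf_coef big_split_ord /= mulrA /res_coef invfM mulrACA.
congr (_ * _).
  rewrite prodf_div mulrA /lagrange_den.
  congr (_ / _).
    rewrite /rising [RHS](bigD1 (Ordinal jN))//=; congr (_ * _).
      by rewrite /zeros /poles jN; ring.
    apply: eq_big => [k|k _]; first by rewrite -val_eqE.
    by rewrite /zeros /poles ltn_ord jN; ring.
  apply: eq_bigr => k _; rewrite /poles ltn_ord jN; ring.
rewrite /rising -prodf_div; apply: eq_big => [k|k _].
  by rewrite gtn_eqF// ltn_addr.
rewrite /zeros /poles jN ltnNge leq_addr/= addKn.
rewrite (_ : - j%:R - (1 - a + k%:R) = - (1 - a + j%:R + k%:R)); last by ring.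
rewrite (_ : - j%:R - (1 - al + k%:R) = - (1 - al + j%:R + k%:R)); last by ring.
by rewrite invrN mulrNN.
Qed.

(** The reflection s -> 1 - al - s exchanges the two families, replaces a by al - a and reverses the
    sign of residues. *)
Lemma pf_coef_right i : (i < N)%N ->
  pf_coef zeros poles (N + N) (N + i) = - res_coef (al - a) al N i.
Proof.
move=> iN; rewrite /pf_coef big_split_ord /= /res_coef invfM mulrACA -mulNr.
have pN : poles (N + i) = 1 - al + i%:R by rewrite /poles ltnNge leq_addr/= addKn.
have zN : zeros (N + i) = 1 - a + i%:R by rewrite /zeros ltnNge leq_addr/= addKn.
rewrite mulrCA mulrC; congr (_ * _); last first.
  rewrite /rising -prodf_div; apply: eq_big => [k|k _].
    by rewrite ltn_eqF// ltn_addr.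
  by rewrite pN /zeros /poles ltn_ord; congr (_ / _); ring.
rewrite /lagrange_den /rising [in RHS](bigD1 (Ordinal iN))//= subrK -mulrA -mulNr -prodf_div.
congr (_ * _); first by rewrite pN zN; ring.
apply: eq_big => [k|k _]; first by rewrite -val_eqE/= eqn_add2l.
rewrite pN /zeros /poles ltnNge leq_addr/= addKn.
rewrite (_ : 1 - al + i%:R - (1 - a + k%:R) = - (al - a - i%:R + k%:R)); last by ring.
rewrite (_ : 1 - al + i%:R - (1 - al + k%:R) = - (k%:R - i%:R)); last by ring.
by rewrite invrN mulrNN.
Qed.

End residues.

Lemma rmorph_pf_coef (F K : fieldType) (f : {rmorphism F -> K}) (r c : nat -> F) n j :
  pf_coef (f \o r) (f \o c) n j = f (pf_coef r c n j).
Proof.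
rewrite /pf_coef rmorphM rmorphB rmorph_prod; congr (_ * _).
by apply: eq_bigr => k _; rewrite fmorph_div !rmorphB.
Qed.

Section gamma_quotient.
Variable R : realType.
Variables (a al : R).
Hypotheses (hal : 1 < al < 2) (ha : 0 < a < 1) (hb : 0 < al - a < 1).

Definition shift_inv (s : R[i]) (j : nat) : R[i] := (s + (j%:R : R)%:C)^-1.

Definition gamma_quotient_approx (s : R[i]) (N : nat) : R[i] :=
  (\prod_(k < N) (a%:C + s + (k%:R : R)%:C) *
   \prod_(k < N) ((1 - a)%:C - s + (k%:R : R)%:C)) /
  (\prod_(k < N) (s + (k%:R : R)%:C) *
   \prod_(k < N) ((1 - al)%:C - s + (k%:R : R)%:C)).

(** The leading 1 is the value at infinity of the rational function; multiplication by [power_decay]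
    makes it vanish in the limit. *)
Lemma gamma_quotient_pf (s : R[i]) N :
  (forall k : nat, s + (k%:R : R)%:C != 0) ->
  (forall k : nat, (1 - al)%:C - s + (k%:R : R)%:C != 0) ->
  gamma_quotient_approx s N = 1 +
    \sum_(j < N) (res_coef a al N j)%:C * shift_inv s j +
    \sum_(j < N) (res_coef (al - a) al N j)%:C * shift_inv ((1 - al)%:C - s) j.
Proof.
move=> s0 s1.
pose z := real_complex R \o zeros a N; pose p := real_complex R \o poles al N.
have pole_ne i : (i < N + N)%N -> s != p i.
  move=> _; rewrite /p /poles /=; case: ifPn => _.
    by rewrite -subr_eq0 rmorphN opprK s0.
  rewrite -subr_eq0 rmorphD -oppr_eq0.
  rewrite (_ : - (s - _) = (1 - al)%:C - s + ((i - N)%:R)%:C) ?s1//; ring.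
have pole_inj i j : (i < N + N)%N -> (j < N + N)%N -> i != j -> p i != p j.
  by move=> iN jN ij; rewrite /p /= (inj_eq (@complexI _)) poles_inj.
have <- : \prod_(k < N + N) ((s - z k) / (s - p k)) = gamma_quotient_approx s N.
  rewrite /gamma_quotient_approx -mulf_div -!prodf_div big_split_ord /=.
  congr (_ * _); apply: eq_bigr => k _.
    by rewrite /z /p /zeros /poles /= ltn_ord; congr (_ / _); ring.
  rewrite /z /p /zeros /poles /= ltnNge leq_addr/= addKn.
  rewrite -(opprB _ s) -(opprB _ s) invrN mulrNN !rmorphD.
  by congr (_ / _); rewrite addrAC.
rewrite partial_fractions// big_split_ord /= addrA; congr (_ + _ + _).
  apply: eq_bigr => j _.
  rewrite rmorph_pf_coef pf_coef_left// /p /poles /= ltn_ord.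
  by rewrite rmorphN opprK.
apply: eq_bigr => j _.
rewrite rmorph_pf_coef pf_coef_right// /p /poles /= ltnNge leq_addr/= addKn.
rewrite rmorphN mulNr -mulrN -invrN opprB; congr (_ * _^-1).
by rewrite rmorphD addrAC.
Qed.

Definition power_decay (n : nat) : R := expR (- (al * ln n%:R)).

Lemma cvg_power_decay : power_decay n @[n --> \oo] --> 0.
Proof.
have [al1 _] := andP hal.
rewrite -cvg_shiftS /=.
apply: (squeeze_cvgr _ (cvg_cst 0) (@cvg_harmonic R)); near=> n.
rewrite expR_ge0/= -[leRHS]lnK; last by rewrite posrE invr_gt0.
rewrite ler_expR /= lnV ?posrE// lerN2 ler_peMl ?ln_ge0 ?ler1n//.
exact: ltW.
Unshelve. all: by end_near. Qed.

(** The exponents of n in the four Gauss terms add up to -al, whatever s is. *)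
Lemma gauss_seq_quotient (s : R[i]) n :
  gauss_seq (a%:C + s) n * gauss_seq ((1 - a)%:C - s) n /
  (gauss_seq s n * gauss_seq ((1 - al)%:C - s) n) =
  (power_decay n)%:C * gamma_quotient_approx s n.+1.
Proof.
rewrite /gauss_seq /gamma_quotient_approx /power_decay.
set A := \prod_(k < n.+1) _; set B := \prod_(k < n.+1) _.
set C := \prod_(k < n.+1) _; set D := \prod_(k < n.+1) _.
set l := (ln n%:R)%:C; have f0 := factC_neq0 R n.
rewrite -cexp_real (_ : (- (al * ln n%:R))%:C =
  (s * l + ((1 - al)%:C - s) * l) - ((a%:C + s) * l + ((1 - a)%:C - s) * l)).
  rewrite cexpD cexpN !cexpD.
  move: (cexp_neq0 ((a%:C + s) * l)) (cexp_neq0 (((1 - a)%:C - s) * l)).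
  move: (cexp_neq0 (s * l)) (cexp_neq0 (((1 - al)%:C - s) * l)).
  move: (cexp _) (cexp _) (cexp _) (cexp _) f0 => e1 e2 e3 e4.
  move: ((n`!%:R)%:C) => f f0 n1 n2 n3 n4.
  transitivity ((f^-1 * f) ^+ 2 * (A * B / (C * D) * (e3 * e4 / (e1 * e2)))).
    by rewrite !invfM !invrK; ring.
  by rewrite mulVf// expr1n mul1r !invfM; ring.
by rewrite /l; ring.
Qed.

End gamma_quotient.

Section residue_limit.
Variable R : realType.
Variables (a al : R).
Hypotheses (hal : 1 < al < 2) (ha : 0 < a < 1).

Definition residue_limit : R := sin (pi * a) / pi * Re (Gamma (1 - al)%:C).

Lemma onemal_nonpole (k : nat) : (1 - al)%:C + (k%:R : R)%:C != 0 :> R[i].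
Proof.
rewrite -(rmorphD (real_complex R)) (inj_eq (@complexI _) _ 0).
have := natr_neq_onemal hal k 0; apply: contra => /eqP h.
by apply/eqP; rewrite addr0 -[LHS]subr0 -h; ring.
Qed.

(** At j = 0 the residue is itself a quotient of Gauss products at a, 1 - a and 1 - al, and the
    reflection formula evaluates the limit. *)
Lemma cvg_residue :
  power_decay al n * res_coef a al n.+1 0 @[n --> \oo] --> residue_limit.
Proof.
have a0 : a != 0 by rewrite gt_eqF//; case/andP: ha.
pose g x n : R := \prod_(k < n.+1) (x + k%:R) / (n`!%:R * expR (x * ln n%:R)).
have cg x : g x n @[n --> \oo] --> Re (rgamma x%:C).
  have [h _] := cvg_gauss_seq x%:C; apply: cvg_trans h; apply: near_eq_cvg.
  by apply: nearW => n; rewrite gauss_seq_real.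
have g0 : Re (rgamma (1 - al)%:C) != 0.
  have := rgamma_neq0 onemal_nonpole; rewrite rgamma_real.
  by rewrite (inj_eq (@complexI _) _ 0).
have -> : residue_limit = Re (rgamma a%:C) * Re (rgamma (1 - a)%:C) *
    (Re (rgamma (1 - al)%:C))^-1.
  rewrite /residue_limit /Gamma [rgamma (1 - al)%:C]rgamma_real -fmorphV /=.
  congr (_ * _); apply: (@complexI R).
  have E (x y : R) : (x * y)%:C = x%:C * y%:C by exact: (rmorphM (real_complex R)).
  by rewrite [RHS]E -!rgamma_real rgamma_reflection.
have : g a n * g (1 - a) n * (g (1 - al) n)^-1 @[n --> \oo] -->
    Re (rgamma a%:C) * Re (rgamma (1 - a)%:C) * (Re (rgamma (1 - al)%:C))^-1.
  by apply: cvgM; [exact: cvgM|apply: cvgV].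
apply: cvg_trans; apply: near_eq_cvg; apply: nearW => n.
rewrite /g /power_decay /res_coef subr0 !addr0 -[n.+1]/(1 + n)%N lagrange_denE.
rewrite expr0 fact0 !mul1r /rising [(1 + n)%N]add1n.
set A := \prod_(k < n.+1) _; set B := \prod_(k < n.+1) _.
set C := \prod_(k < n.+1) _; set l := ln n%:R.
have f0 : n`!%:R != 0 :> R by rewrite pnatr_eq0 -lt0n fact_gt0.
rewrite (_ : - (al * l) = (1 - al) * l - (a * l + (1 - a) * l)); last by ring.
rewrite expRD expRN expRD.
move: (expR_gt0 (a * l)) (expR_gt0 ((1 - a) * l)) (expR_gt0 ((1 - al) * l)).
move: (expR _) (expR _) (expR _) => e1 e2 e3 p1 p2 p3.
move: (n`!%:R) f0 => f f0.
transitivity ((f^-1 * f) * (A * B / C * (e1 / (e3 * e2)) / f)).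
  by rewrite !invfM !invrK; ring.
by rewrite mulVf// mul1r !invfM; ring.
Qed.

End residue_limit.

Section key.
Variable R : realType.
Variables (a al : R).
Hypotheses (hal : 1 < al < 2) (ha : 0 < a < 1) (hb : 0 < al - a < 1).

(** The residue at 0, which absorbs the decay n^(-al), is factored out by [res_coefE]; the remaining
    sums converge by Tannery's theorem on each component, dominated by exp 2 * M * |binw al j|. *)
Lemma ccvg_residue_sum (x : nat -> R[i]) (b M : R) : 0 < b < 1 ->
  (forall j, normc (x j) <= M) ->
  exists2 L : R[i], ccvg (fun n => \sum_(j < n) (binw al j)%:C * x j) L &
    ccvg (fun n => (power_decay al n)%:C *
      \sum_(j < n.+1) (res_coef b al n.+1 j)%:C * x j) ((residue_limit b al)%:C * L).
Proof.
move=> hb' xM.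
have E2 : 1 <= expR 2 :> R by rewrite -expR0 ler_expR.
have Re_R (t : R) (y : R[i]) : Re (t%:C * y) = t * Re y.
  by rewrite ReM /= mul0r subr0.
have Im_R (t : R) (y : R[i]) : Im (t%:C * y) = t * Im y.
  by rewrite ImM /= mul0r addr0.
have Re_sum n (y : nat -> R[i]) : Re (\sum_(j < n) y j) = \sum_(j < n) Re (y j).
  by apply: (big_morph _ (@ReD R)).
have Im_sum n (y : nat -> R[i]) : Im (\sum_(j < n) y j) = \sum_(j < n) Im (y j).
  by apply: (big_morph _ (@ImD R)).
have tan (y : nat -> R) : (forall j, `|y j| <= M) ->
  cvgn (series (fun j => binw al j * y j)) /\
  \sum_(j < n.+1) (binw al j * res_factor b al n.+1 j * y j) @[n --> \oo] -->
    limn (series (fun j => binw al j * y j)).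
  move=> yM.
  have [||j|c1 c2] := @tannery R (fun n j => binw al j * res_factor b al n j * y j)
    (fun j => binw al j * y j) (fun j => expR 2 * M * `|binw al j|).
  - move=> n j jn; rewrite !normrM -mulrA [leRHS]mulrC ler_wpM2l// ler_pM//.
    by rewrite ger0_norm ?res_factor_ge0 ?res_factor_le.
  - rewrite (_ : series _ = fun n => expR 2 * M * series (fun j => `|binw al j|) n).
      by apply: is_cvgM; [exact: is_cvg_cst|exact: cvg_series_norm_binw].
    by apply/funext => n; rewrite /series/= mulr_sumr.
  - rewrite -cvg_shiftS /=.
    have := cvg_res_factor b al j => h.
    have : binw al j * res_factor b al n.+1 j * y j @[n --> \oo] --> binw al j * 1 * y j.
      by apply: cvgM; [apply: cvgM => //|]; exact: cvg_cst.
    by rewrite mulr1.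
  - split=> //; move: c2.
    by rewrite -(cvg_shiftS (fun n => \sum_(j < n) (binw al j * res_factor b al n j * y j))).
have [r1 r2] := tan (fun j => Re (x j)) (fun j => le_trans (normr_Re_le _) (xM j)).
have [i1 i2] := tan (fun j => Im (x j)) (fun j => le_trans (normr_Im_le _) (xM j)).
set Lr := limn _ in r2; set Li := limn _ in i2.
exists (Lr +i* Li).
  split => /=.
    apply: cvg_trans r1; apply: near_eq_cvg; apply: nearW => n.
    rewrite (Re_sum n (fun j => (binw al j)%:C * x j)) /series/= big_mkord; apply: eq_bigr => j _; exact/esym/Re_R.
  apply: cvg_trans i1; apply: near_eq_cvg; apply: nearW => n.
  rewrite (Im_sum n (fun j => (binw al j)%:C * x j)) /series/= big_mkord; apply: eq_bigr => j _; exact/esym/Im_R.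
have cr := cvg_residue hal hb'.
have E n (y : nat -> R) : power_decay al n * res_coef b al n.+1 0 *
    \sum_(j < n.+1) (binw al j * res_factor b al n.+1 j * y j) =
    power_decay al n * \sum_(j < n.+1) (res_coef b al n.+1 j * y j).
  rewrite -mulrA mulr_sumr; congr (_ * _); apply: eq_bigr => j _.
  by rewrite (@res_coefE _ b al n.+1 j)// !mulrA.
split; rewrite ?Re_R ?Im_R /=.
  have h : power_decay al n * res_coef b al n.+1 0 *
      \sum_(j < n.+1) (binw al j * res_factor b al n.+1 j * Re (x j)) @[n --> \oo] -->
      residue_limit b al * Lr by exact: cvgM.
  apply: cvg_trans h; apply: near_eq_cvg; apply: nearW => n.
  rewrite Re_R (Re_sum n.+1 (fun j => (res_coef b al n.+1 j)%:C * x j)) (E n (fun j => Re (x j))); congr (_ * _); apply: eq_bigr => j _; exact/esym/Re_R.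
have h : power_decay al n * res_coef b al n.+1 0 *
      \sum_(j < n.+1) (binw al j * res_factor b al n.+1 j * Im (x j)) @[n --> \oo] -->
      residue_limit b al * Li by exact: cvgM.
  apply: cvg_trans h; apply: near_eq_cvg; apply: nearW => n.
rewrite Im_R (Im_sum n.+1 (fun j => (res_coef b al n.+1 j)%:C * x j)) (E n (fun j => Im (x j))); congr (_ * _); apply: eq_bigr => j _; exact/esym/Im_R.
Qed.

(* [1 / Psi] is the limit of its partial fraction expansion: its poles are
   at [-j] and [1 - al + j], with residues [residue_limit * binw al j]. *)
Lemma gamma_quotient_series (s : R[i]) (M : R) :
  (forall k : nat, s + (k%:R : R)%:C != 0) ->
  (forall k : nat, (1 - al)%:C - s + (k%:R : R)%:C != 0) ->
  (forall k, normc (shift_inv s k) <= M) ->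
  (forall k, normc (shift_inv ((1 - al)%:C - s) k) <= M) ->
  exists L1 L2 : R[i],
  [/\ ccvg (fun n => \sum_(j < n) (binw al j)%:C * shift_inv s j) L1,
      ccvg (fun n => \sum_(j < n) (binw al j)%:C * shift_inv ((1 - al)%:C - s) j) L2 &
      rgamma (a%:C + s) * rgamma ((1 - a)%:C - s) /
        (rgamma s * rgamma ((1 - al)%:C - s)) =
      (residue_limit a al)%:C * L1 + (residue_limit (al - a) al)%:C * L2].
Proof.
move=> s0 s1 M0 M1.
have [L1 h1 g1] := ccvg_residue_sum ha M0.
have [L2 h2 g2] := ccvg_residue_sum hb M1.
exists L1, L2; split => //.
have q : ccvg (fun n => gauss_seq (a%:C + s) n * gauss_seq ((1 - a)%:C - s) n /
  (gauss_seq s n * gauss_seq ((1 - al)%:C - s) n))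
  (rgamma (a%:C + s) * rgamma ((1 - a)%:C - s) / (rgamma s * rgamma ((1 - al)%:C - s))).
  apply: ccvgM; first by apply: ccvgM; exact: cvg_gauss_seq.
  apply: ccvgV; first by rewrite mulf_neq0// rgamma_neq0.
  by apply: ccvgM; exact: cvg_gauss_seq.
apply: (ccvg_unique q).
rewrite -[X in ccvg _ X]add0r.
under [X in ccvg X _]funext => n do rewrite gauss_seq_quotient gamma_quotient_pf// mulrDr mulrDr mulr1 -addrA.
apply: ccvgD; last exact: ccvgD.
exact/ccvg_real/cvg_power_decay.
Qed.

End key.

Local Close Scope complex_scope.

(** * Exponential and Fourier integrals *)

Section exponential_integrals.
Variable R : realType.
Local Notation mu := (@lebesgue_measure R).
Variables (la z : R).
Hypothesis la0 : 0 < la.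

Let d0 : 0 < la ^+ 2 + z ^+ 2.
Proof. by rewrite ltr_pwDl ?sqr_ge0// exprn_gt0. Qed.

Lemma cvg_expR_oo : expR (- (la * x)) @[x --> +oo] --> (0 : R).
Proof.
apply: (@cvg_comp _ _ _ ( *%R la) (fun x => expR (- x)) _ +oo).
  by apply: gt0_cvgMry => //; exact: cvg_id.
exact: cvgr_expR.
Qed.

Lemma is_derive_cos_lin (k x : R) :
  is_derive x (1 : R) (fun x => cos (k * x)) (- sin (k * x) * k).
Proof. exact: (@dcomp _ cos ( *%R k) x _ _ (is_derive_cos _) (dlin _ _)). Qed.

Lemma is_derive_sin_lin (k x : R) :
  is_derive x (1 : R) (fun x => sin (k * x)) (cos (k * x) * k).
Proof. exact: (@dcomp _ sin ( *%R k) x _ _ (is_derive_sin _) (dlin _ _)). Qed.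

Lemma is_derive_expR_lin (k x : R) :
  is_derive x (1 : R) (fun x => expR (k * x)) (expR (k * x) * k).
Proof. exact: (@dcomp _ expR ( *%R k) x _ _ (is_derive_expR _) (dlin _ _)). Qed.

(** The constant 1 keeps the integrand nonnegative, so that the fundamental theorem on a half-line
    applies without prior integrability; [integral_expR_1D_sub] later subtracts it again. *)
Lemma ge0_integral_expR_trig (p q : R) : (forall x, 0 <= 1 + p * cos x + q * sin x) ->
  (\int[mu]_(x in `[0%R, +oo[)
    (expR (- la * x) * (1 + p * cos (z * x) + q * sin (z * x)))%:E =
  (la^-1 + (p * la + q * z) / (la ^+ 2 + z ^+ 2))%:E)%E.
Proof.
move=> pq.
pose D := la ^+ 2 + z ^+ 2.
pose G x := p * (- la * cos (z * x) + z * sin (z * x))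
  - q * (la * sin (z * x) + z * cos (z * x)).
pose F x := expR (- la * x) * (- la^-1 + D^-1 * G x).
pose f x := expR (- la * x) * (1 + p * cos (z * x) + q * sin (z * x)).
have dF (x : R) : is_derive x (1 : R) F (f x).
  have dC := is_derive_cos_lin z x; have dS := is_derive_sin_lin z x.
  have dG := dB (dZ p (dD (dZ (- la) dC) (dZ z dS))) (dZ q (dD (dZ la dS) (dZ z dC))).
  apply: (is_derive_eq (dM (is_derive_expR_lin (- la) x) (dD (dcst (- la^-1) x) (dZ D^-1 dG)))).
  rewrite /f /G /D; field.
  by rewrite !gt_eqF.
have cF := derive_continuous dF.
have cf : continuous f.
  exact: (derive_continuous (fun x => dM (is_derive_expR_lin (- la) x)
    (dD (dD (dcst 1 x) (dZ p (is_derive_cos_lin z x))) (dZ q (is_derive_sin_lin z x))))).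
rewrite (@ge0_continuous_FTC2y _ f F 0 0).
- rewrite -EFinB sub0r; congr EFin.
  rewrite /F /G !mulr0 expR0 cos0 sin0 /D; field.
  by rewrite !gt_eqF.
- by move=> x _; rewrite mulr_ge0 ?expR_ge0.
- exact: continuous_subspaceT.
- pose K := la^-1 + D^-1 * (`|p| * (la + `|z|) + `|q| * (la + `|z|)).
  have h : K * expR (- (la * x)) @[x --> +oo] --> (K * 0 : R).
    by apply: cvgM; [exact: cvg_cst|exact: cvg_expR_oo].
  rewrite mulr0 in h.
  apply: norm_cvg0; apply: (squeeze_cvgr _ (cvg_cst 0) h); near=> x.
  rewrite normr_ge0/= /F normrM mulNr ger0_norm ?expR_ge0// mulrC ler_wpM2r ?expR_ge0//.
  have tri (s t : R) : `|s| <= 1 -> `|t| <= 1 -> `|la * s + z * t| <= la + `|z|.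
    move=> s1 t1; rewrite (le_trans (ler_normD _ _))// !normrM (gtr0_norm la0).
    by rewrite lerD// ler_piMr// ltW.
  rewrite (le_trans (ler_normD _ _))// normrN ger0_norm ?invr_ge0 ?(ltW la0)//.
  rewrite lerD2l normrM ger0_norm ?invr_ge0 ?(ltW d0)// ler_wpM2l ?invr_ge0 ?(ltW d0)//.
  rewrite (le_trans (ler_normB _ _))// !normrM lerD// ler_wpM2l//.
    by rewrite mulNr -mulrN tri ?normrN ?cos_max ?sin_max.
  by rewrite tri ?cos_max ?sin_max.
- by move=> x _; have [] := dF x.
- by apply: cvg_at_right_filter; exact: cF.
- by move=> x _; rewrite derive1E; have [_] := dF x.
Unshelve. all: by end_near. Qed.

End exponential_integrals.

Lemma integral_expR (R : realType) (la : R) : 0 < la ->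
  (\int[@lebesgue_measure R]_(x in `[0%R, +oo[) (expR (- la * x))%:E = (la^-1)%:E)%E.
Proof.
move=> la0; have := @ge0_integral_expR_trig _ _ 0 la0 0 0; rewrite !mul0r addr0 mul0r addr0 => <-.
  by apply: eq_integral => x _; rewrite !mul0r !addr0 mulr1.
by move=> x; rewrite !mul0r !addr0.
Qed.

Lemma integral_expR_1Dcos (R : realType) (la z : R) : 0 < la ->
  (\int[@lebesgue_measure R]_(x in `[0%R, +oo[) (expR (- la * x) * (1 + cos (z * x)))%:E =
   (la^-1 + la / (la ^+ 2 + z ^+ 2))%:E)%E.
Proof.
move=> la0; have := @ge0_integral_expR_trig _ _ z la0 1 0; rewrite mul1r mul0r addr0 => <-.
  by apply: eq_integral => x _; rewrite mul1r mul0r addr0.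
by move=> x; rewrite mul1r mul0r addr0 -lerBlDl sub0r cos_geN1.
Qed.

Lemma integral_expR_1Dsin (R : realType) (la z : R) : 0 < la ->
  (\int[@lebesgue_measure R]_(x in `[0%R, +oo[) (expR (- la * x) * (1 + sin (z * x)))%:E =
   (la^-1 + z / (la ^+ 2 + z ^+ 2))%:E)%E.
Proof.
move=> la0; have := @ge0_integral_expR_trig _ _ z la0 0 1; rewrite mul1r mul0r add0r => <-.
  by apply: eq_integral => x _; rewrite mul1r mul0r addr0.
by move=> x; rewrite mul1r mul0r addr0 -lerBlDl sub0r sin_geN1.
Qed.

Section exponential_Rintegrals.
Variable R : realType.
Local Notation mu := (@lebesgue_measure R).
Implicit Types la z w : R.

Lemma measurable_lin w : measurable_fun [set: R] (fun x : R => w * x).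
Proof. exact: measurable_funM. Qed.

Lemma measurable_cos_lin w : measurable_fun [set: R] (fun x : R => cos (w * x)).
Proof.
apply: measurableT_comp (measurable_lin w).
exact: continuous_measurable_fun (@continuous_cos R).
Qed.

Lemma measurable_sin_lin w : measurable_fun [set: R] (fun x : R => sin (w * x)).
Proof.
apply: measurableT_comp (measurable_lin w).
exact: continuous_measurable_fun (@continuous_sin R).
Qed.

Lemma measurable_expR_lin w : measurable_fun [set: R] (fun x : R => expR (w * x)).
Proof. exact: measurableT_comp (measurable_lin w). Qed.

Lemma integrable_expR_lin la : 0 < la ->
  mu.-integrable `[0, +oo[ (EFin \o (fun x => expR (- la * x))).
Proof.
move=> la0; apply/integrableP; split.
  by apply/measurable_EFinP/measurable_funTS; exact: measurable_expR_lin.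
under eq_integral do rewrite /= ger0_norm ?expR_ge0//.
by rewrite integral_expR// ltry.
Qed.

Lemma integrable_expR_bounded la (f : R -> R) : 0 < la ->
  measurable_fun [set: R] f -> (forall x, `|f x| <= 1) ->
  mu.-integrable `[0, +oo[ (EFin \o (fun x => expR (- la * x) * f x)).
Proof.
move=> la0 mf f1.
apply: (le_integrable _ _ _ (integrable_expR_lin la0)) => //.
  apply/measurable_EFinP/measurable_funTS/measurable_funM => //.
  exact: measurable_expR_lin.
by move=> x _ /=; rewrite lee_fin normrM ler_piMr.
Qed.

Lemma integral_expR_1D_sub la (f : R -> R) (v : R) : 0 < la ->
  measurable_fun [set: R] f -> (forall x, `|f x| <= 1) ->
  (\int[mu]_(x in `[0%R, +oo[) (expR (- la * x) * (1 + f x))%:E = (la^-1 + v)%:E ->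
  \int[mu]_(x in `[0%R, +oo[) (expR (- la * x) * f x)%:E = v%:E)%E.
Proof.
move=> la0 mf f1.
under eq_integral do rewrite mulrDr mulr1 EFinD.
rewrite integralD//=; last 2 first.
- exact: integrable_expR_lin.
- exact: integrable_expR_bounded.
rewrite integral_expR// EFinD => /(congr1 (fun y => y - la^-1%:E)%E).
by rewrite ![(la^-1%:E + _)%E]addeC !addeK.
Qed.

Lemma integral_expR_cos la z : 0 < la ->
  (\int[mu]_(x in `[0%R, +oo[) (expR (- la * x) * cos (z * x))%:E =
   (la / (la ^+ 2 + z ^+ 2))%:E)%E.
Proof.
move=> la0; apply: integral_expR_1D_sub => //.
- exact: measurable_cos_lin.
- by move=> x; exact: cos_max.
- exact: integral_expR_1Dcos.
Qed.

Lemma integral_expR_sin la z : 0 < la ->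
  (\int[mu]_(x in `[0%R, +oo[) (expR (- la * x) * sin (z * x))%:E =
   (z / (la ^+ 2 + z ^+ 2))%:E)%E.
Proof.
move=> la0; apply: integral_expR_1D_sub => //.
- exact: measurable_sin_lin.
- by move=> x; exact: sin_max.
- exact: integral_expR_1Dsin.
Qed.

End exponential_Rintegrals.

Lemma integrable_prodM d1 d2 (T1 : measurableType d1) (T2 : measurableType d2)
    (R : realType) (m1 : {sigma_finite_measure set T1 -> \bar R})
    (m2 : {sigma_finite_measure set T2 -> \bar R}) (a : T1 -> R) (b : T2 -> R) :
  m1.-integrable [set: T1] (EFin \o a) -> m2.-integrable [set: T2] (EFin \o b) ->
  (m1 \x m2)%E.-integrable [set: T1 * T2] (fun p => (a p.1 * b p.2)%:E).
Proof.
move=> ia ib.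
have ma : measurable_fun [set: T1] a.
  by apply/measurable_EFinP; exact: measurable_int ia.
have mb : measurable_fun [set: T2] b.
  by apply/measurable_EFinP; exact: measurable_int ib.
apply/integrable12ltyP.
  apply/measurable_EFinP/measurable_funM; exact: measurableT_comp.
have /integrableP[_ lta] := ia; have /integrableP[_ ltb] := ib.
under eq_integral => x _.
  under eq_integral do rewrite /= normrM EFinM.
  rewrite ge0_integralZl//; last first.
    by apply/measurable_EFinP; exact: measurableT_comp.
  over.
rewrite ge0_integralZr//; last 2 first.
- by apply/measurable_EFinP; exact: measurableT_comp.
- exact: integral_ge0.
rewrite lte_mul_pinfty//.
  exact: integral_ge0.
by rewrite ge0_fin_numE ?integral_ge0.
Qed.

(** * Averaging test functions by Fubini *)

Section mixing.
Variable R : realType.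
Local Notation mu := (@lebesgue_measure R).
Context d (U : measurableType d) (m : {sigma_finite_measure set U -> \bar R}).
Variables (k : nat) (g Y : 'I_k -> U -> R).
Hypothesis mY : forall i, measurable_fun [set: U] (Y i).
Hypothesis ig : forall i, m.-integrable [set: U] (EFin \o g i).

(** Integrated against [m], this is the integral of [phi] against the signed measure that sums the
    images under [Y i] of [g i] times [m]. Staying on [U] avoids constructing that measure. *)
Definition weighted_sum (phi : R -> R) (w : U) : R :=
  \sum_(i < k) phi (Y i w) * g i w.

Let mg i : measurable_fun [set: U] (g i).
Proof. by apply/measurable_EFinP; exact: measurable_int (ig i). Qed.

Lemma integrable_weighted (phi : R -> R) (M : R) i :
  measurable_fun [set: R] phi -> (forall y, `|phi y| <= M) ->
  m.-integrable [set: U] (EFin \o (fun w => phi (Y i w) * g i w)).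
Proof.
move=> mphi phiM.
have M0 : 0 <= M by rewrite (le_trans _ (phiM 0)).
apply: (le_integrable measurableT _ _ (integrableZl measurableT M (ig i))).
  apply/measurable_EFinP/measurable_funM => //.
  exact: measurableT_comp mphi (mY i).
move=> w _ /=; rewrite lee_fin !normrM ler_wpM2r//.
by rewrite (le_trans (phiM _))// ler_norm.
Qed.

Lemma integrable_weighted_sum (phi : R -> R) (M : R) :
  measurable_fun [set: R] phi -> (forall y, `|phi y| <= M) ->
  m.-integrable [set: U] (EFin \o weighted_sum phi).
Proof.
move=> mphi phiM.
have -> : EFin \o weighted_sum phi =
    (fun w => \sum_(i < k) (phi (Y i w) * g i w)%:E)%E.
  by apply/funext => w; rewrite /weighted_sum /= -sumEFin.
apply: integrable_sum => // i _.
exact: integrable_weighted mphi phiM.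
Qed.

(* Fubini: a mixture of test functions that are annihilated by the signed
   measure [\sum_i (Y i)_* (g i . m)] is annihilated as well. *)
Lemma mix_weighted_sum (kap : R -> R) (psi : R -> R -> R) (Psi : R -> R) (M : R) :
  mu.-integrable [set: R] (EFin \o kap) ->
  measurable_fun [set: R * R] (fun p => psi p.1 p.2) ->
  (forall t y, `|psi t y| <= M) ->
  (forall y, (\int[mu]_t (kap t * psi t y)%:E = (Psi y)%:E)%E) ->
  (forall t, kap t != 0 -> (\int[m]_w (weighted_sum (psi t) w)%:E = 0)%E) ->
  (\int[m]_w (weighted_sum Psi w)%:E = 0)%E.
Proof.
move=> ik mpsi psiM psiE psi0.
have M0 : 0 <= M by rewrite (le_trans _ (psiM 0 0)).
have mk : measurable_fun [set: R] kap.
  by apply/measurable_EFinP; exact: measurable_int ik.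
pose G w := \sum_(i < k) `|g i w|.
have iG : m.-integrable [set: U] (EFin \o G).
  have -> : EFin \o G = (fun w => \sum_(i < k) `|g i w|%:E)%E.
    by apply/funext => w; rewrite /G /= -sumEFin.
  by apply: integrable_sum => // i _; exact: (integrable_norm (ig i)).
pose f (p : measurableTypeR R * U) := (kap p.1 * weighted_sum (psi p.1) p.2)%:E.
have mf : measurable_fun [set: measurableTypeR R * U] f.
  apply/measurable_EFinP/measurable_funM; first exact: measurableT_comp.
  rewrite /weighted_sum; apply: measurable_sum => i.
  apply: measurable_funM; last exact: measurableT_comp.
  apply: (measurableT_comp (f := fun p => psi p.1 p.2)
    (g := fun x : R * U => (x.1, Y i x.2)) mpsi).
  by apply: measurable_fun_pair => //; exact: measurableT_comp.
(* The integrable bound |kap| M sum |g i| on the product space justifies exchanging the two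
   integrals. *)
have fG p : (`|f p| <= `|(kap p.1 * (M * G p.2))%:E|)%E.
  have G0 : 0 <= G p.2 by exact: sumr_ge0.
  rewrite lee_fin !normrM ler_wpM2l// (ger0_norm M0) (ger0_norm G0).
  rewrite (le_trans (ler_norm_sum _ _ _))// mulr_sumr.
  apply: ler_sum => i _.
  by rewrite normrM ler_wpM2r.
have iMG : m.-integrable [set: U] (EFin \o (fun w => M * G w)).
  exact: (integrableZl measurableT M iG).
have intf : (mu \x m)%E.-integrable [set: measurableTypeR R * U] f.
  have h := integrable_prodM ik iMG.
  have h2 := le_integrable (measurableT) mf (fun p _ => fG p).
  exact: h2 h.
have mpsit t : measurable_fun [set: R] (psi t).
  exact: (measurable_fun_pair2 (f := fun p => psi p.1 p.2) t mpsi).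
have F := Fubini intf.
have L0 : (\int[mu]_t \int[m]_w f (t, w) = 0)%E.
  apply: integral0_eq => t _; rewrite /f /=.
  under eq_integral do rewrite EFinM.
  rewrite integralZl//; last first.
    exact: integrable_weighted_sum (mpsit t) (psiM t).
  have [->|/psi0 ->] := eqVneq (kap t) 0; first by rewrite mul0e.
  by rewrite mule0.
rewrite L0 in F; rewrite [RHS]F; apply: eq_integral => w _.
have ikpsi y : mu.-integrable [set: R] (EFin \o (fun t => kap t * psi t y)).
  apply: (le_integrable measurableT _ _ (integrableZl measurableT M ik)).
    apply/measurable_EFinP/measurable_funM => //.
    exact: (measurable_fun_pair1 (f := fun p => psi p.1 p.2) y mpsi).
  move=> t _ /=; rewrite lee_fin !normrM mulrC ler_wpM2r//.
  by rewrite (le_trans (psiM _ _))// ler_norm.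
rewrite /f /= /weighted_sum.
transitivity (\int[mu]_t \sum_(i < k) ((g i w)%:E * (kap t * psi t (Y i w))%:E))%E; last first.
  apply: eq_integral => t _; rewrite mulr_sumr -sumEFin; apply: eq_bigr => i _.
  by rewrite -EFinM; congr EFin; ring.
rewrite (@integral_sum _ _ _ mu setT measurableT _
  (fun i t => (g i w)%:E * (kap t * psi t (Y i w))%:E)%E); last first.
  by move=> i; exact: (integrableZl measurableT _ (ikpsi (Y i w))).
rewrite -sumEFin; apply: eq_bigr => i _.
by rewrite integralZl//= ?psiE -?EFinM 1?mulrC//; exact: ikpsi.
Qed.

End mixing.

(** * Fourier uniqueness for signed image measures *)

Section atan_limits.
Variable R : realType.

Lemma cvg_natS_oo : (n.+1%:R : R) @[n --> \oo] --> +oo.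
Proof.
apply: ger_cvgy (@cvgr_idn R); apply: nearW => n.
by rewrite ler_nat.
Qed.

(** The shift 1/(n+1) is much larger than the width (n+1)^(-2), so r = 0 is sent to plus infinity
    together with r > 0. This decides which endpoint of ]b, c] is included. *)
Definition sharpen (r : R) (n : nat) : R := (r + n.+1%:R^-1) * n.+1%:R ^+ 2.

Lemma sharpenE r n : sharpen r n = n.+1%:R * (r * n.+1%:R + 1).
Proof.
rewrite /sharpen; have : n.+1%:R != 0 :> R by rewrite pnatr_eq0.
by move: n.+1%:R => N N0; field.
Qed.

Lemma cvg_atan_sharpen (r : R) :
  atan (sharpen r n) @[n --> \oo] --> (if 0 <= r then pi / 2 else - (pi / 2)).
Proof.
case: ifPn => [r0|].
  apply: (@cvg_comp _ _ _ (sharpen r) _ _ +oo); last exact: cvgy_atan.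
  apply: ger_cvgy cvg_natS_oo; apply: nearW => n.
  by rewrite sharpenE ler_peMr// lerDr mulr_ge0.
rewrite -ltNge => r0.
have h : atan (- sharpen r n) @[n --> \oo] --> pi / 2.
  apply: (@cvg_comp _ _ _ (fun n => - sharpen r n) _ _ +oo); last exact: cvgy_atan.
  apply: ger_cvgy cvg_natS_oo.
  have /cvgryPge /(_ (2 / - r)) := cvg_natS_oo; apply: filterS => n.
  rewrite ler_pdivrMr ?oppr_gt0// => h.
  by rewrite sharpenE -mulrN ler_peMr//; lra.
rewrite (_ : (fun n => _) = fun n => - atan (- sharpen r n)); first exact: cvgN.
by apply/funext => n; rewrite atanN opprK.
Qed.

End atan_limits.

Section fourier_uniqueness.
Variable R : realType.
Local Notation mu := (@lebesgue_measure R).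
Context d (U : measurableType d) (m : {sigma_finite_measure set U -> \bar R}).
Variables (k : nat) (g Y : 'I_k -> U -> R).
Hypothesis mY : forall i, measurable_fun [set: U] (Y i).
Hypothesis ig : forall i, m.-integrable [set: U] (EFin \o g i).
Hypothesis cos0 : forall z, 0 < z ->
  (\int[m]_w (weighted_sum g Y (fun y => cos (z * y)) w)%:E = 0)%E.
Hypothesis sin0 : forall z, 0 < z ->
  (\int[m]_w (weighted_sum g Y (fun y => sin (z * y)) w)%:E = 0)%E.

Let poisson (e a y : R) : R := e / (e ^+ 2 + (y - a) ^+ 2).

(** The Poisson kernel is the average of cos(z(y - a)) over z > 0 with weight exp(-ez). Only z > 0
    enters, so the singularity of 1/Psi at z = 0 is never met. *)
Let poisson_annihilated e a : 0 < e ->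
  (\int[m]_w (weighted_sum g Y (poisson e a) w)%:E = 0)%E.
Proof.
move=> e0.
pose kap z := if 0 < z then expR (- e * z) else 0.
have kapE : EFin \o kap = (EFin \o (fun z => expR (- e * z))) \_ `]0, +oo[.
  apply/funext => z; rewrite patchE /kap /=.
  by rewrite mem_setE in_itv /= andbT; case: ifP.
have ie : mu.-integrable `]0, +oo[ (EFin \o (fun z => expR (- e * z))).
  apply: integrableS (integrable_expR_lin e0) => //.
  by move=> x /=; rewrite !in_itv /= !andbT => /ltW.
apply: (@mix_weighted_sum _ _ _ _ _ _ _ mY ig kap (fun z y => cos (z * (y - a))) _ 1).
- rewrite kapE; have h := integrable_mkcond (mu := mu) (D := `]0, +oo[%classic)
    (EFin \o (fun z => expR (- e * z))) (measurable_itv _).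
  exact: (h.1 ie).
- apply: measurableT_comp; first exact: continuous_measurable_fun (@continuous_cos R).
  apply: measurable_funM => //; exact: measurable_funB.
- by move=> z y; exact: cos_max.
- move=> y; rewrite /poisson -(integral_expR_cos (y - a) e0).
  rewrite -integral_itv_obnd_cbnd; last first.
    apply/measurable_EFinP/measurable_funTS/measurable_funM.
      exact: measurable_expR_lin.
    exact: measurable_cos_lin.
  rewrite [RHS]integral_mkcond; apply: eq_integral => z _.
  rewrite patchE mem_setE in_itv /= andbT /kap; case: ifP => _.
    by rewrite [(y - a) * z]mulrC.
  by rewrite mul0r.
- move=> z; rewrite /kap; case: ifPn => [z0 _|]; last by rewrite eqxx.
  have -> : weighted_sum g Y (fun y => cos (z * (y - a))) =
      (fun w => cos (z * a) * weighted_sum g Y (fun y => cos (z * y)) w +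
                sin (z * a) * weighted_sum g Y (fun y => sin (z * y)) w).
    apply/funext => w; rewrite /weighted_sum !mulr_sumr -big_split /=.
    by apply: eq_bigr => i _; rewrite mulrBr cosB; ring.
  have ic : m.-integrable [set: U] (EFin \o weighted_sum g Y (fun y => cos (z * y))).
    apply: (integrable_weighted_sum mY ig (measurable_cos_lin _) (M := 1)).
    by move=> y; exact: cos_max.
  have iS : m.-integrable [set: U] (EFin \o weighted_sum g Y (fun y => sin (z * y))).
    apply: (integrable_weighted_sum mY ig (measurable_sin_lin _) (M := 1)).
    by move=> y; exact: sin_max.
  under eq_integral do rewrite EFinD !EFinM.
  rewrite integralD//; last 2 first.
  - exact: (integrableZl _ _ ic).
  - exact: (integrableZl _ _ iS).
  rewrite integralZl// integralZl// cos0// sin0// !mule0 addr0//.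
Qed.

(** These differences are Poisson kernels integrated over their centre in [b, c]. *)
Let atan_annihilated e b c : 0 < e -> b < c ->
  (\int[m]_w (weighted_sum g Y
    (fun y => atan ((c - y) / e) - atan ((b - y) / e)) w)%:E = 0)%E.
Proof.
move=> e0 bc.
have D0 (x : R) : 0 < e ^+ 2 + x ^+ 2 by rewrite ltr_pwDl ?sqr_ge0// exprn_gt0.
have cq : continuous (fun x : R => e / (e ^+ 2 + x ^+ 2) : R).
  move=> x; apply: cvgM; first exact: cvg_cst.
  apply: cvgV; first by rewrite gt_eqF.
  by apply: cvgD; [exact: cvg_cst|exact: exprn_continuous].
have cp y : continuous (fun a : R => poisson e a y : R).
  move=> a; apply: (@continuous_comp _ _ _ (fun a => y - a) (fun x : R => e / (e ^+ 2 + x ^+ 2) : R)); last exact: cq.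
  by apply: cvgB; [exact: cvg_cst|exact: cvg_id].
pose kap a := \1_(`[b, c]%classic) a : R.
apply: (@mix_weighted_sum _ _ _ _ _ _ _ mY ig kap (fun a y => poisson e a y) _ e^-1).
- exact: integrable_indic_itv.
- have mB : measurable_fun [set: R * R] (fun p : R * R => p.2 - p.1).
    exact: measurable_funB.
  exact: (measurableT_comp (continuous_measurable_fun cq) mB).
- move=> a y; rewrite /poisson ger0_norm; last by rewrite divr_ge0 ?ltW.
  rewrite ler_pdivrMr// mulrDr expr2 mulrA mulVf ?gt_eqF// mul1r lerDl.
  by rewrite mulr_ge0 ?sqr_ge0// invr_ge0 ltW.
- move=> y.
  have dF (a : R) : is_derive a (1 : R) (fun a => atan ((a - y) / e)) (poisson e a y).
    have dl := @dM _ _ _ _ _ _ (dB (did a) (dcst y a)) (dcst (e^-1) a).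
    apply: (is_derive_eq (@dcomp _ atan (fun a => (a - y) / e) a _ _ (is_derive1_atan _) dl)).
    rewrite /poisson; field.
    have := D0 (a - y); have := D0 (y - a).
    by move=> h1 h2; rewrite (gt_eqF e0) /= !gt_eqF.
  rewrite -(segment_FTC2 bc (@cp y) dF) [RHS]integral_mkcond; apply: eq_integral => a _.
  rewrite /kap patchE indicE; case: (_ \in _); by rewrite ?mul1r ?mul0r.
- by move=> a _; exact: poisson_annihilated.
Qed.

(* The functions [atan (sharpen (c - y) n) - atan (sharpen (b - y) n)]
   converge boundedly to [pi] times the indicator function of ]b, c]. *)
Lemma fourier_uniqueness b c : b < c ->
  (\int[m]_w (weighted_sum g Y \1_(`]b, c]%classic) w)%:E = 0)%E.
Proof.
move=> bc.
pose phi n y := atan (sharpen (c - y) n) - atan (sharpen (b - y) n).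
have phi0 n : (\int[m]_w (weighted_sum g Y (phi n) w)%:E = 0)%E.
  have e0 : 0 < n.+1%:R ^- 2 :> R by rewrite invr_gt0 exprn_gt0.
  have bc' : b + n.+1%:R^-1 < c + n.+1%:R^-1 :> R by rewrite ltrD2r.
  rewrite -[RHS](atan_annihilated e0 bc'); apply: eq_integral => w _; congr EFin.
  by apply: eq_bigr => i _; rewrite /phi /sharpen invrK ![_ + n.+1%:R^-1 - _]addrAC.
have phicvg y : phi n y @[n --> \oo] --> pi * \1_(`]b, c]%classic) y.
  have -> : pi * \1_(`]b, c]%classic) y =
      (if 0 <= c - y then pi / 2 else - (pi / 2)) -
      (if 0 <= b - y then pi / 2 else - (pi / 2)) :> R.
    rewrite indicE mem_setE in_itv /= !subr_ge0 [b < y]ltNge.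
    have [yb|yb] := leP y b; last by case: ifP => _ /=; field.
    by rewrite (le_trans yb (ltW bc)) subrr mulr0.
  by apply: cvgB; exact: cvg_atan_sharpen.
have phi_le n y : `|phi n y| <= pi.
  rewrite ler_norml; have := atan_gtNpi2 (sharpen (c - y) n).
  have := atan_ltpi2 (sharpen (c - y) n); have := atan_gtNpi2 (sharpen (b - y) n).
  have := atan_ltpi2 (sharpen (b - y) n); rewrite /phi.
  by move=> h1 h2 h3 h4; apply/andP; split; lra.
have mphi n : measurable_fun [set: R] (phi n).
  have ma (x : R) : measurable_fun [set: R] (fun y => atan (sharpen (x - y) n)).
    have m1 := continuous_measurable_fun (derive_continuous (@is_derive1_atan R)).
    have m2 : measurable_fun [set: R] (fun y => sharpen (x - y) n).
      apply: measurable_funM => //; apply: measurable_funD => //.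
      exact: measurable_funB.
    exact: (measurableT_comp m1 m2).
  exact: measurable_funB.
pose f_ n w := (weighted_sum g Y (phi n) w)%:E.
pose f w := (pi * weighted_sum g Y \1_(`]b, c]%classic) w)%:E.
pose G w := (\sum_(i < k) `|pi * g i w|%:E)%E.
have iG : m.-integrable [set: U] G.
  apply: integrable_sum => // i _; apply: integrable_norm.
  exact: (integrableZl measurableT pi (ig i)).
have iI : m.-integrable [set: U] (EFin \o weighted_sum g Y \1_(`]b, c]%classic)).
  apply: (integrable_weighted_sum mY ig (M := 1)) => // y.
  by rewrite indicE; case: (_ \in _); rewrite ?normr1 ?normr0.
have f_f w : f_ n w @[n --> \oo] --> f w.
  apply: cvg_EFin; first exact: nearW.
  rewrite /f /weighted_sum mulr_sumr /=.
  apply: cvg_sum_seq => i; rewrite mulrA; apply: cvgM; last exact: cvg_cst.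
  exact: phicvg.
have f_G n w : (`|f_ n w| <= G w)%E.
  rewrite /f_ /G sumEFin lee_fin (le_trans (ler_norm_sum _ _ _))//.
  by apply: ler_sum => i _; rewrite !normrM ler_wpM2r// (le_trans (phi_le n _))// ler_norm.
have [//|||//|//|_ _] := @dominated_convergence _ _ _ m setT measurableT f_ f G.
- move=> n; exact: measurable_int (integrable_weighted_sum mY ig (mphi n) (phi_le n)).
- exact: measurable_int (integrableZl measurableT pi iI).
- exact: aeW.
- exact: aeW.
rewrite (_ : (fun n => _) = (fun=> 0%E)); last first.
  by apply/funext => n; exact: phi0.
move=> /cvg_lim -/(_ (@ereal_hausdorff R)); rewrite lim_cst; last exact: ereal_hausdorff.
rewrite (_ : (\int[m]_w f w)%E =
  (pi%:E * \int[m]_w (weighted_sum g Y \1_(`]b, c]%classic) w)%:E)%E).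
  move=> /esym/eqP; rewrite mule_eq0 eqe gt_eqF ?pi_gt0//= => /eqP.
  exact.
by rewrite -integralZl.
Qed.

End fourier_uniqueness.

(** * The residual density *)

Section binomial_series.
Variables (R : realType) (al : R).
Hypothesis hal : 1 < al < 2.

Definition binomial_partial (n : nat) (t : R) : R :=
  \sum_(j < n.+1) binw al j * t ^+ j.

Let dpartial (n : nat) (t : R) : R := \sum_(j < n) j.+1%:R * binw al j.+1 * t ^+ j.

Let is_derive_partial n (t : R) :
  is_derive t (1 : R) (binomial_partial n) (dpartial n t).
Proof.
elim: n => [|n IH].
  rewrite /dpartial big_ord0 (_ : binomial_partial 0 = fun=> 1); first exact: dcst.
  by apply/funext => x; rewrite /binomial_partial big_ord_recl big_ord0 addr0 mulr1 binw0.
rewrite (_ : binomial_partial n.+1 = fun x => binomial_partial n x + binw al n.+1 * x ^+ n.+1).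
  apply: (is_derive_eq (dD IH (dZ (binw al n.+1) (dX n (did t))))).
  by rewrite /dpartial big_ord_recr /=; congr (_ + _); ring.
by apply/funext => x; rewrite /binomial_partial big_ord_recr.
Qed.

(** The function (1 - t)^(al - 1) solves the same equation with right-hand side 0; truncating its
    series leaves a single boundary term. *)
Let partial_ode n t : (1 - t) * dpartial n t + (al - 1) * binomial_partial n t =
  - (n.+1%:R * binw al n.+1 * t ^+ n).
Proof.
elim: n => [|n IH].
  rewrite /dpartial /binomial_partial big_ord0 big_ord_recl big_ord0 binwS binw0.
  by field.
have -> : dpartial n.+1 t = dpartial n t + n.+1%:R * binw al n.+1 * t ^+ n.
  by rewrite /dpartial big_ord_recr.
have -> : binomial_partial n.+1 t = binomial_partial n t + binw al n.+1 * t ^+ n.+1.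
  by rewrite /binomial_partial big_ord_recr.
have h : n.+2%:R * binw al n.+2 = binw al n.+1 * (1 - al + n.+1%:R).
  by rewrite [in LHS]binwS; have : n.+2%:R != 0 :> R by []; move: n.+2%:R => N N0; field.
rewrite h exprS -[n.+1%:R]natr1.
transitivity ((1 - t) * dpartial n t + (al - 1) * binomial_partial n t +
   (n.+1%:R * binw al n.+1 * t ^+ n) - t ^+ n.+1 * binw al n.+1 * (n.+1%:R - (al - 1))).
  by rewrite exprS -[n.+1%:R]natr1; ring.
by rewrite IH exprS -[n.+1%:R]natr1; ring.
Qed.

Let coef_le1 n : `|n.+1%:R * binw al n.+1| <= 1.
Proof.
have [al1 al2] := andP hal.
elim: n => [|n IH].
  by rewrite binwS binw0 addr0 !mul1r divr1 ler_norml; lra.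
have -> : n.+2%:R * binw al n.+2 =
    (n.+1%:R * binw al n.+1) * ((1 - al + n.+1%:R) / n.+1%:R).
  rewrite [in LHS]binwS; have : n.+2%:R != 0 :> R by [].
  have : n.+1%:R != 0 :> R by [].
  by move: (n.+2%:R) (n.+1%:R) => N M M0 N0; field; rewrite ?M0 ?N0.
rewrite normrM (le_trans (ler_piMr _ _) IH)// ger0_norm.
  by rewrite ler_pdivrMr// mul1r; lra.
by rewrite divr_ge0// -natr1; have : 0 <= n%:R :> R by []; lra.
Qed.

(** The quotient [F] of the partial sum by (1 - t)^(al - 1) equals 1 at 0, and by [partial_ode] its
    derivative on [0, t] is at most E t^n; the mean value theorem then gives |F t - 1| <= E t^n. *)
Lemma binomial_series t : 0 <= t < 1 ->
  binomial_partial n t @[n --> \oo] --> (1 - t) `^ (al - 1).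
Proof.
have [al1 al2] := andP hal.
move=> /andP[]; rewrite le_eqVlt => /predU1P[<- _|t0 t1].
  rewrite subr0 powR1; rewrite (_ : (fun n => _) = fun=> 1); first exact: cvg_cst.
  apply/funext => n; rewrite /binomial_partial big_ord_recl binw0 expr0 mulr1 big1 ?addr0//.
  by move=> i _; rewrite expr0n /= mulr0.
pose L (x : R) := expR (- (al - 1) * ln (1 - x)).
pose F n x := binomial_partial n x * L x.
pose dF n x := - (n.+1%:R * binw al n.+1 * x ^+ n) * (L x / (1 - x)).
have dFE n (x : R) : x < 1 -> is_derive x (1 : R) (F n) (dF n x).
  move=> x1; have x1' : 0 < 1 - x by rewrite subr_gt0.
  have d1 := dB (dcst 1 x) (did x).
  have d2 := @dcomp _ (@ln R) (fun x => 1 - x) x _ _ (is_derive1_ln x1') d1.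
  have d3 := dZ (- (al - 1)) d2.
  have d4 := @dcomp _ (@expR R) (fun x => - (al - 1) * ln (1 - x)) x _ _ (is_derive_expR _) d3.
  apply: (is_derive_eq (dM (is_derive_partial n x) d4)).
  rewrite /dF -(partial_ode n x) /L; field.
  by rewrite gt_eqF.
pose E := L t / (1 - t).
have bound n : `|F n t - 1| <= E * t ^+ n.
  have F0 : F n 0 = 1.
    rewrite /F /L subr0 ln1 mulr0 expR0 mulr1 /binomial_partial big_ord_recl binw0.
    rewrite expr0 mulr1 big1 ?addr0// => i _.
    by rewrite expr0n /= mulr0.
  have cF : {within `[0, t], continuous (F n)}.
    apply: derivable_within_continuous => x; rewrite in_itv/= => /andP[_ xt].
    by have [] := dFE n x (le_lt_trans xt t1).
  have [|c] := @MVT R (F n) (dF n) 0 t t0 _ cF.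
    by move=> x; rewrite in_itv/= => /andP[_ xt]; apply: dFE; exact: lt_trans t1.
  rewrite in_itv/= => /andP[c0 ct]; rewrite F0 subr0 => ->.
  have c1 : 0 < 1 - c by rewrite subr_gt0 (lt_trans ct).
  have t1' : 0 < 1 - t by rewrite subr_gt0.
  rewrite normrM /dF normrM normrN [`|_ * c ^+ n|]normrM normrX (gtr0_norm c0) (gtr0_norm t0).
  apply: (@le_trans _ _ (1 * t ^+ n * E * 1)); last by rewrite mulr1 mul1r mulrC.
  rewrite ler_pM ?mulr_ge0 ?exprn_ge0 ?(ltW c0) ?(ltW t0)// ?(ltW t1)//.
  rewrite ler_pM ?mulr_ge0 ?exprn_ge0 ?(ltW c0)//.
    by rewrite ler_pM ?exprn_ge0 ?(ltW c0) ?coef_le1// lerXn2r ?nnegrE ?ltW.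
  rewrite ger0_norm ?divr_ge0 ?expR_ge0 ?(ltW c1)// /E.
  apply: ler_pM; rewrite ?expR_ge0 ?invr_ge0 ?(ltW c1)//.
    rewrite ler_expR ler_wnM2l ?oppr_le0 ?subr_ge0 ?(ltW al1)//.
    by rewrite ler_ln ?posrE// lerD2l lerN2 ltW.
  by rewrite lef_pV2 ?posrE// lerD2l lerN2 ltW.
have cF : F n t @[n --> \oo] --> (1 : R).
  apply/subr_cvg0; apply: norm_cvg0.
  have h : E * t ^+ n @[n --> \oo] --> (E * 0 : R).
    apply: cvgM; first exact: cvg_cst.
    by apply: cvg_expr; rewrite gtr0_norm.
  rewrite mulr0 in h.
  by apply: (squeeze_cvgr _ (cvg_cst 0) h); apply: nearW => n; rewrite normr_ge0 bound.
have L0 : L t != 0 by rewrite gt_eqF ?expR_gt0.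
have -> : (1 - t) `^ (al - 1) = 1 / L t.
  by rewrite /powR gt_eqF ?subr_gt0// /L mulNr expRN invrK mul1r.
rewrite (_ : (fun n => _) = fun n => F n t / L t); last first.
  by apply/funext => n; rewrite /F mulfK.
by apply: cvgM => //; exact: cvg_cst.
Qed.

End binomial_series.

Section exponential_mixture.
Variable R : realType.
Local Notation mu := (@lebesgue_measure R).
Variables (c la : nat -> R) (G : R -> R).
Hypothesis c0 : forall j, 0 <= c j.
Hypothesis la0 : forall j, 0 < la j.
Hypothesis cG : forall x, 0 < x ->
  series (fun j => c j * expR (- la j * x)) n @[n --> \oo] --> G x.
Hypothesis mG : measurable_fun [set: R] G.
Hypothesis cA : cvgn (series (fun j => c j / la j)).

Lemma nneseries_EFin (f : nat -> R) (l : R) : (forall j, 0 <= f j) ->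
  series f n @[n --> \oo] --> l -> (\sum_(0 <= j <oo) (f j)%:E = l%:E)%E.
Proof.
move=> f0 fl; apply: cvg_lim => //.
rewrite (_ : (fun n => _) = fun n => (series f n)%:E); last first.
  by apply/funext => n; rewrite /series/= sumEFin.
by apply: cvg_EFin; [exact: nearW|exact: fl].
Qed.

(** Against 1 + psi >= 0 every term is nonnegative, so the sum and the integral commute. The
    contribution [I j] of [psi] is at most 1/(la j) in absolute value because 0 <= 1 + psi <= 2,
    which makes the two resulting series converge separately. *)
Lemma integral_exponential_mixture (psi : R -> R) (I : nat -> R) :
  measurable_fun [set: R] psi -> (forall x, `|psi x| <= 1) ->
  (forall j, (\int[mu]_(x in `[0%R, +oo[) (expR (- la j * x) * (1 + psi x))%:E =
    ((la j)^-1 + I j)%:E)%E) ->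
  cvgn (series (fun j => c j * I j)) /\
  (\int[mu]_(x in `[0%R, +oo[) (G x * (1 + psi x))%:E =
    (limn (series (fun j => c j / la j)) + limn (series (fun j => c j * I j)))%:E)%E.
Proof.
move=> mpsi psi1 HI.
have psi0 x : 0 <= 1 + psi x by have := psi1 x; rewrite ler_norml => /andP[]; lra.
have psi2 x : 1 + psi x <= 2 by have := psi1 x; rewrite ler_norml => /andP[]; lra.
have mf j : measurable_fun [set: R] (fun x => c j * (expR (- la j * x) * (1 + psi x))).
  apply: measurable_funM => //; apply: measurable_funM.
    exact: measurable_expR_lin.
  exact: measurable_funD.
have Ile j : `|I j| <= (la j)^-1.
  have h1 : (0 <= ((la j)^-1 + I j)%:E)%E.
    by rewrite -HI integral_ge0// => x _; rewrite lee_fin mulr_ge0 ?expR_ge0.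
  have h2 : (((la j)^-1 + I j)%:E <= (2 * (la j)^-1)%:E)%E.
    rewrite -HI EFinM -(integral_expR (la0 j)) -ge0_integralZl//; last first.
      by apply/measurable_EFinP/measurable_funTS; exact: measurable_expR_lin.
    apply: ge0_le_integral => //.
    - by move=> x _; rewrite lee_fin mulr_ge0 ?expR_ge0.
    - apply/measurable_EFinP/measurable_funTS/measurable_funM.
        exact: measurable_expR_lin.
      exact: measurable_funD.
    - apply/measurable_EFinP/measurable_funTS/measurable_funM => //.
      exact: measurable_expR_lin.
    - by move=> x _; rewrite -EFinM lee_fin mulrC ler_wpM2r ?expR_ge0.
  rewrite !lee_fin in h1 h2; rewrite ler_norml; apply/andP; split; lra.
have cI : cvgn (series (fun j => c j * I j)).
  apply: normed_cvg; apply: (series_le_cvg _ _ _ cA) => j /=.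
  - exact: normr_ge0.
  - by rewrite divr_ge0// ltW.
  - by rewrite normrM ger0_norm// ler_wpM2l.
split=> //.
rewrite -integral_itv_obnd_cbnd; last first.
  apply/measurable_EFinP/measurable_funTS/measurable_funM => //.
  exact: measurable_funD.
transitivity (\int[mu]_(x in `]0%R, +oo[)
  (\sum_(0 <= j <oo) (c j * (expR (- la j * x) * (1 + psi x)))%:E))%E.
  apply: eq_integral => x; rewrite mem_setE in_itv/= andbT => x0.
  apply/esym/nneseries_EFin => [j|]; first by rewrite mulr_ge0// mulr_ge0 ?expR_ge0.
  rewrite (_ : series _ = fun n => series (fun j => c j * expR (- la j * x)) n * (1 + psi x)).
    by apply: cvgM; [exact: cG|exact: cvg_cst].
  by apply/funext => n; rewrite /series/= mulr_suml; apply: eq_bigr => j _; rewrite mulrA.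
rewrite integral_nneseries//=; last 2 first.
- by move=> j; apply/measurable_EFinP/measurable_funTS; exact: mf.
- by move=> j x _; rewrite lee_fin mulr_ge0// mulr_ge0 ?expR_ge0.
transitivity (\sum_(0 <= j <oo) (c j / la j + c j * I j)%:E)%E.
  apply: eq_eseriesr => j _.
  rewrite integral_itv_obnd_cbnd; last by apply/measurable_EFinP/measurable_funTS; exact: mf.
  under eq_integral do rewrite EFinM.
  rewrite ge0_integralZl//; first by rewrite HI -EFinM mulrDr.
  - apply/measurable_EFinP/measurable_funTS/measurable_funM.
      exact: measurable_expR_lin.
    exact: measurable_funD.
  - by move=> x _; rewrite lee_fin mulr_ge0 ?expR_ge0.
  - by rewrite lee_fin.
apply: (@nneseries_EFin (fun j => c j / la j + c j * I j)) => [j|].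
  rewrite -mulrDr mulr_ge0//; have := Ile j; rewrite ler_norml => /andP[h _]; lra.
have h : series (fun j => c j / la j) n + series (fun j => c j * I j) n @[n --> \oo] -->
    limn (series (fun j => c j / la j)) + limn (series (fun j => c j * I j)).
  by apply: cvgD; [exact: cA|exact: cI].
apply: cvg_trans h; apply: near_eq_cvg; apply: nearW => n.
by rewrite /series/= big_split.
Qed.

End exponential_mixture.

Lemma ge0_integral_halves (R : realType) (f : R -> \bar R) :
  measurable_fun [set: R] f -> (forall x, (0 <= f x)%E) ->
  (\int[@lebesgue_measure R]_x f x =
   \int[@lebesgue_measure R]_(x in `[0%R, +oo[) f x +
   \int[@lebesgue_measure R]_(x in `]0%R, +oo[) f (- x)%R)%E.
Proof.
move=> mf f0.
have mN : measurable_fun [set: R] (fun x => f (- x)).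
  exact: measurableT_comp.
rewrite -(setUv (`[0, +oo[%classic : set (measurableTypeR R))) setCitvr.
rewrite ge0_integral_setU//=; last 2 first.
- exact: measurable_funTS.
- rewrite -setCitvr; exact/disj_setPCl.
congr (_ + _)%E.
rewrite integral_itv_bndo_bndc; last exact: measurable_funTS.
rewrite integral_itv_obnd_cbnd; last exact: measurable_funTS.
rewrite ge0_integration_by_substitution0//.
by apply: eq_integral => x _; rewrite opprK.
Qed.

Section residual_density.
Variables (R : realType) (al p q : R).
Hypotheses (hal : 1 < al < 2) (p0 : 0 <= p) (q0 : 0 <= q).
Local Notation mu := (@lebesgue_measure R).
Local Notation be := (al - 1).

Definition density_pos (x : R) : R :=
  p * (1 - (1 - expR (- x)) `^ be) + q * expR (- be * x).

(** Written in the reflected variable: the argument x stands for the point -x. *)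
Definition density_neg (x : R) : R :=
  q * (1 - (1 - expR (- x)) `^ be) * expR (be * x).

(** The claimed potential density minus the constant [p] on the negative half-line; this subtraction
    makes it integrable. *)
Definition residual_density (x : R) : R :=
  if 0 <= x then density_pos x else density_neg (- x).

Let al1 : 1 < al. Proof. by case/andP: hal. Qed.
Let al2 : al < 2. Proof. by case/andP: hal. Qed.

(** For y in [0, 1] and be in (0, 1) one has y <= y^be <= 1; take y = 1 - exp(-x). *)
Lemma powR_defect x : 0 <= x -> 0 <= 1 - (1 - expR (- x)) `^ be <= expR (- x).
Proof.
move=> x0; have e1 : expR (- x) <= 1 by rewrite -expR0 ler_expR oppr_le0.
have y0 : 0 <= 1 - expR (- x) by rewrite subr_ge0.
have y1 : 1 - expR (- x) <= 1 by rewrite gerBl expR_ge0.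
have be0 : be != 0 by rewrite gt_eqF// subr_gt0.
rewrite subr_ge0 lerBlDr -lerBlDl.
move: y0; rewrite le_eqVlt => /predU1P[<-|y0]; first by rewrite powR0// lexx ler01.
apply/andP; split.
  apply: (@le_trans _ _ (1 `^ be)); last by rewrite powR1.
  have b0 : 0 <= be by rewrite subr_ge0 ltW.
  by apply: ge0_ler_powR => //; rewrite nnegrE ltW.
rewrite -[leLHS](powRr1 (ltW y0)); apply: ger_powR; first by rewrite y0.
by have := al2; lra.
Qed.

Lemma residual_density_ge0 x : 0 <= residual_density x.
Proof.
rewrite /residual_density; case: ifPn => [x0|].
  have /andP[h _] := powR_defect x0.
  by rewrite addr_ge0 ?mulr_ge0 ?expR_ge0.
rewrite -ltNge -oppr_gt0 => /ltW x0; have /andP[h _] := powR_defect x0.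
by rewrite mulr_ge0 ?expR_ge0// mulr_ge0.
Qed.

Lemma residual_density_le x : residual_density x <= p + q.
Proof.
rewrite /residual_density; case: ifPn => [x0|].
  have /andP[_ h] := powR_defect x0.
  have e1 : expR (- x) <= 1 by rewrite -expR0 ler_expR oppr_le0.
  have e2 : expR (- be * x) <= 1.
    by rewrite -[leRHS]expR0 ler_expR mulNr oppr_le0 mulr_ge0// subr_ge0 ltW.
  rewrite lerD//; first by rewrite ler_piMr// (le_trans h).
  by rewrite ler_piMr.
rewrite -ltNge -oppr_gt0; move: (- x) => y /ltW y0.
have /andP[_ h] := powR_defect y0.
rewrite /density_neg (@le_trans _ _ q) ?lerDr// -mulrA ler_piMr//.
rewrite (@le_trans _ _ (expR (- y) * expR (be * y)))//.
  by rewrite ler_wpM2r// expR_ge0.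
rewrite -expRD -[leRHS]expR0 ler_expR.
suff : be * y <= y by lra.
by rewrite ler_piMl//; have := al2; lra.
Qed.

Lemma residual_density_tail x : 0 <= x ->
  residual_density x <= (p + q) * expR (- be * x).
Proof.
move=> x0; rewrite /residual_density x0 mulrDl lerD2r ler_wpM2l//.
have /andP[_ h] := powR_defect x0; rewrite (le_trans h)// ler_expR mulNr lerN2.
by rewrite ler_piMl//; have := al2; lra.
Qed.

Let mdef : measurable_fun [set: R] (fun x => 1 - (1 - expR (- x)) `^ be).
Proof.
apply: measurable_funB => //.
apply: (measurableT_comp (f := fun y => y `^ be)); first exact: measurable_powR.
by apply: measurable_funB => //; exact: measurableT_comp.
Qed.

Lemma measurable_density_pos : measurable_fun [set: R] density_pos.
Proof.
apply: measurable_funD; apply: measurable_funM => //.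
exact: measurable_expR_lin.
Qed.

Lemma measurable_density_neg : measurable_fun [set: R] density_neg.
Proof.
apply: measurable_funM; last exact: measurable_expR_lin.
exact: measurable_funM.
Qed.

Lemma measurable_residual_density : measurable_fun [set: R] residual_density.
Proof.
apply: measurable_fun_ifT => //.
- exact: measurable_fun_ler.
- exact: measurable_density_pos.
- apply: measurableT_comp; first exact: measurable_density_neg.
  exact: oppr_measurable.
Qed.

End residual_density.

Local Open Scope complex_scope.

(** * Fourier transform of the residual density *)

Section residual_transform.
Variables (R : realType) (al p q : R).
Hypotheses (hal : 1 < al < 2) (p0 : 0 <= p) (q0 : 0 <= q).
Local Notation mu := (@lebesgue_measure R).
Local Notation be := (al - 1).
Local Notation h := (residual_density al p q).

Let al1 : 1 < al. Proof. by case/andP: hal. Qed.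
Let al2 : al < 2. Proof. by case/andP: hal. Qed.
Let be0 : 0 < be. Proof. by rewrite subr_gt0. Qed.

(** In the variable s = -iz, poles with negative real part give exponentials on the positive
    half-line: 1 - al (index 0, rate be) and -1, -2, ... (the later indices). The poles 2 - al, 3 -
    al, ... give those on the negative half-line ([cneg], [laneg]). The pole 0 is left out; it
    corresponds to the subtracted constant. *)
Definition cpos (j : nat) : R := if j is j'.+1 then - p * binw al j else q.
Definition lapos (j : nat) : R := if j is j'.+1 then j%:R else be.
Definition cneg (j : nat) : R := - q * binw al j.+1.
Definition laneg (j : nat) : R := j.+1%:R - be.

Lemma cpos_ge0 j : 0 <= cpos j.
Proof. by case: j => [//|j]; rewrite /cpos mulNr oppr_ge0 mulr_ge0_le0// binwS_le0. Qed.

Lemma cneg_ge0 j : 0 <= cneg j.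
Proof. by rewrite /cneg mulNr oppr_ge0 mulr_ge0_le0// binwS_le0. Qed.

Lemma lapos_gt0 j : 0 < lapos j.
Proof. by case: j. Qed.

Lemma laneg_gt0 j : 0 < laneg j.
Proof. by rewrite /laneg -natr1; have : 0 <= j%:R :> R by []; have := al2; lra. Qed.

Let binomial_defect x : 0 < x ->
  1 - binomial_partial al n (expR (- x)) @[n --> \oo] --> 1 - (1 - expR (- x)) `^ be.
Proof.
move=> x0; apply: cvgB; first exact: cvg_cst.
by apply: binomial_series => //; rewrite expR_ge0/= -[ltRHS]expR0 ltr_expR oppr_lt0.
Qed.

Let sum_binwS n t : \sum_(j < n) binw al j.+1 * t ^+ j.+1 = binomial_partial al n t - 1.
Proof. by rewrite /binomial_partial big_ord_recl binw0 mul1r addrC addKr. Qed.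

Let expRX (x : R) n : expR (- n%:R * x) = expR (- x) ^+ n.
Proof. by rewrite -expRM_natl mulrN mulNr. Qed.

Lemma cvg_density_pos x : 0 < x ->
  series (fun j => cpos j * expR (- lapos j * x)) n @[n --> \oo] --> density_pos al p q x.
Proof.
move=> x0; rewrite -cvg_shiftS /=.
rewrite (_ : (fun n => _) = fun n => p * (1 - binomial_partial al n (expR (- x))) +
    q * expR (- be * x)); last first.
  apply/funext => n; rewrite /series/= big_mkord big_ord_recl /= addrC; congr (_ + _).
  rewrite -opprB -sum_binwS mulrN -mulNr mulr_sumr; apply: eq_bigr => j _.
  by rewrite expRX mulrA.
apply: cvgD; last exact: cvg_cst.
by apply: cvgM; [exact: cvg_cst|exact: binomial_defect].
Qed.

Lemma cvg_density_neg x : 0 < x ->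
  series (fun j => cneg j * expR (- laneg j * x)) n @[n --> \oo] --> density_neg al q x.
Proof.
move=> x0.
rewrite (_ : (fun n => _) = fun n => q * (1 - binomial_partial al n (expR (- x))) *
    expR (be * x)); last first.
  apply/funext => n; rewrite /series/= big_mkord.
  rewrite -opprB -sum_binwS mulrN -mulNr mulr_sumr mulr_suml; apply: eq_bigr => j _.
  by rewrite /laneg opprB addrC mulrDl expRD expRX /cneg !mulrA.
apply: cvgM; last exact: cvg_cst.
by apply: cvgM; [exact: cvg_cst|exact: binomial_defect].
Qed.

Let cvg_series_scaled (K : R) : cvgn (series (fun j => K * `|binw al j|)).
Proof.
rewrite (_ : series _ = fun n => K * series (fun j => `|binw al j|) n).
  by apply: is_cvgM; [exact: is_cvg_cst|exact: cvg_series_norm_binw].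
by apply/funext => n; rewrite /series/= mulr_sumr.
Qed.

Lemma cvg_series_cpos : cvgn (series (fun j => cpos j / lapos j)).
Proof.
apply: (series_le_cvg _ _ _ (@cvg_series_scaled (p + q / be))) => j.
- by rewrite divr_ge0 ?cpos_ge0// ltW ?lapos_gt0.
- by rewrite mulr_ge0// addr_ge0// divr_ge0// ltW.
- case: j => [|j]; first by rewrite binw0 normr1 mulr1 lerDr.
  rewrite /cpos /lapos ler0_norm ?binwS_le0// mulNr -mulrN -mulrA.
  have b0 : 0 <= - binw al j.+1 by rewrite oppr_ge0 binwS_le0.
  rewrite mulrDl (@le_trans _ _ (p * - binw al j.+1))//.
    by rewrite ler_wpM2l// ler_pdivrMr// ler_peMr// ler1n.
  by rewrite lerDl mulr_ge0// divr_ge0// ltW.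
Qed.

Lemma cvg_series_cneg : cvgn (series (fun j => cneg j / laneg j)).
Proof.
have cs : cvgn (series (fun j => q / (1 - be) * `|binw al j.+1|)).
  have /cvg_ex[l hl] := @cvg_series_scaled (q / (1 - be)).
  apply/cvg_ex; exists (l - q / (1 - be) * `|binw al 0|).
  have : series (fun j => q / (1 - be) * `|binw al j|) n.+1 - q / (1 - be) * `|binw al 0|
      @[n --> \oo] --> l - q / (1 - be) * `|binw al 0|.
    by apply: cvgB; [rewrite cvg_shiftS|exact: cvg_cst].
  apply: cvg_trans; apply: near_eq_cvg; apply: nearW => n.
  by rewrite /series/= !big_mkord big_ord_recl addrC addKr.
have b1 : 0 < 1 - be by have := al2; lra.
apply: (series_le_cvg _ _ _ cs) => j.
- by rewrite divr_ge0 ?cneg_ge0// ltW ?laneg_gt0.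
- by rewrite mulr_ge0// divr_ge0// ltW.
- rewrite /cneg ler0_norm ?binwS_le0// mulNr -mulrN -!mulrA ler_wpM2l// mulrC.
  rewrite ler_wpM2r ?oppr_ge0 ?binwS_le0// lef_pV2 ?posrE ?laneg_gt0//.
  by rewrite /laneg lerD2r ler1n.
Qed.

Section one_test_function.
Variables (psi : R -> R) (Ip In : nat -> R).
Hypotheses (mpsi : measurable_fun [set: R] psi) (psi1 : forall x, `|psi x| <= 1).
Hypothesis HIp : forall j,
  (\int[mu]_(x in `[0%R, +oo[) (expR (- lapos j * x) * (1 + psi x))%:E =
   ((lapos j)^-1 + Ip j)%:E)%E.
Hypothesis HIn : forall j,
  (\int[mu]_(x in `[0%R, +oo[) (expR (- laneg j * x) * (1 + psi (- x)))%:E =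
   ((laneg j)^-1 + In j)%:E)%E.

Lemma integral_residual_1D :
  [/\ cvgn (series (fun j => cpos j * Ip j)), cvgn (series (fun j => cneg j * In j)) &
  (\int[mu]_x (h x * (1 + psi x))%:E =
   (limn (series (fun j => cpos j / lapos j)) + limn (series (fun j => cpos j * Ip j)) +
   (limn (series (fun j => cneg j / laneg j)) + limn (series (fun j => cneg j * In j))))%:E)%E].
Proof.
have [cp Ep] := integral_exponential_mixture cpos_ge0 lapos_gt0 cvg_density_pos
  (measurable_density_pos _ _ _) cvg_series_cpos mpsi psi1 HIp.
have mpsiN : measurable_fun [set: R] (fun x => psi (- x)).
  by apply: measurableT_comp => //; exact: oppr_measurable.
have [cn En] := integral_exponential_mixture cneg_ge0 laneg_gt0 cvg_density_neg
  (measurable_density_neg _ _) cvg_series_cneg mpsiN (fun x => psi1 (- x)) HIn.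
split=> //; rewrite EFinD -Ep -En ge0_integral_halves; last 2 first.
- apply/measurable_EFinP/measurable_funM; first exact: measurable_residual_density.
  exact: measurable_funD.
- move=> x; rewrite lee_fin mulr_ge0 ?residual_density_ge0//.
  by have := psi1 x; rewrite ler_norml => /andP[]; lra.
congr (_ + _)%E.
  apply: eq_integral => x; rewrite mem_setE in_itv/= andbT => x0.
  by rewrite /residual_density x0.
rewrite -integral_itv_obnd_cbnd; last first.
  apply/measurable_EFinP/measurable_funTS/measurable_funM.
    exact: measurable_density_neg.
  exact: measurable_funD.
apply: eq_integral => x; rewrite mem_setE in_itv/= andbT => x0.
by rewrite /residual_density oppr_ge0 leNgt x0/= opprK.
Qed.

End one_test_function.

Lemma integral_residual :
  (\int[mu]_x (h x)%:E = (limn (series (fun j => cpos j / lapos j)) +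
    limn (series (fun j => cneg j / laneg j)))%:E)%E.
Proof.
have Z (c : nat -> R) : limn (series (fun j => c j * 0)) = 0.
  rewrite (_ : series _ = fun=> 0) ?lim_cst//.
  by apply/funext => n; rewrite /series/= big1// => j _; rewrite mulr0.
have E (la : R) : 0 < la ->
  (\int[mu]_(x in `[0%R, +oo[) (expR (- la * x) * (1 + 0))%:E = (la^-1 + 0)%:E)%E.
  by move=> la0; under eq_integral do rewrite addr0 mulr1; rewrite integral_expR// addr0.
have n1 (x : R) : `|(0 : R)| <= 1 by rewrite normr0.
have [_ _] := @integral_residual_1D (fun=> 0) (fun=> 0) (fun=> 0)
  (measurable_cst _) n1 (fun j => E _ (lapos_gt0 j)) (fun j => E _ (laneg_gt0 j)).
by rewrite !Z !addr0 => <-; apply: eq_integral => x _; rewrite ?addr0 mulr1.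
Qed.

Lemma integrable_residual : mu.-integrable [set: R] (EFin \o h).
Proof.
apply/integrableP; split.
  by apply/measurable_EFinP; exact: measurable_residual_density.
under eq_integral do rewrite /= ger0_norm ?residual_density_ge0//.
by rewrite integral_residual ltry.
Qed.

(** The total mass, obtained from the case psi = 0, is subtracted from the integral against 1 +
    psi. *)
Lemma integral_residual_test (psi : R -> R) (Ip In : nat -> R) :
  measurable_fun [set: R] psi -> (forall x, `|psi x| <= 1) ->
  (forall j, (\int[mu]_(x in `[0%R, +oo[) (expR (- lapos j * x) * (1 + psi x))%:E =
   ((lapos j)^-1 + Ip j)%:E)%E) ->
  (forall j, (\int[mu]_(x in `[0%R, +oo[) (expR (- laneg j * x) * (1 + psi (- x)))%:E =
   ((laneg j)^-1 + In j)%:E)%E) ->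
  exists l1 l2 : R,
  [/\ series (fun j => cpos j * Ip j) n @[n --> \oo] --> l1,
      series (fun j => cneg j * In j) n @[n --> \oo] --> l2 &
      (\int[mu]_x (h x * psi x)%:E = (l1 + l2)%:E)%E].
Proof.
move=> mpsi psi1 HIp HIn.
have [cp cn E] := integral_residual_1D mpsi psi1 HIp HIn.
exists (limn (series (fun j => cpos j * Ip j))), (limn (series (fun j => cneg j * In j))).
split => //.
have ih := integrable_residual.
have ihpsi : mu.-integrable [set: R] (EFin \o (fun x => h x * psi x)).
  apply: (le_integrable measurableT _ _ ih).
    apply/measurable_EFinP/measurable_funM => //; exact: measurable_residual_density.
  by move=> x _ /=; rewrite lee_fin normrM ler_piMr.
move: E; under eq_integral do rewrite mulrDr mulr1 EFinD.
rewrite integralD//= integral_residual.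
set A := limn _; set B := limn _; set C := limn _; set D := limn _.
rewrite (_ : A + C + (B + D) = A + B + (C + D)); last by ring.
rewrite [in RHS]EFinD => /(congr1 (fun y => y - (A + B)%:E)%E).
by rewrite ![((A + B)%:E + _)%E]addeC !addeK.
Qed.

End residual_transform.

(** * The reciprocal of the exponent *)

Section residue_sign.
Variables (R : realType) (a al : R).
Hypotheses (hal : 1 < al < 2) (ha : 0 < a < 1).

Lemma residue_limit_neq0 : residue_limit a al != 0.
Proof.
have [a0 a1] := andP ha; have pi0 := pi_gt0 R.
rewrite /residue_limit mulf_neq0//.
  rewrite mulf_neq0 ?invr_neq0 ?gt_eqF// sin_gt0_pi// mulr_gt0//=.
  by rewrite gtr_pMr.
rewrite /Gamma [rgamma _]rgamma_real -fmorphV /= invr_eq0.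
have := rgamma_neq0 (onemal_nonpole hal); rewrite rgamma_real.
by rewrite (inj_eq (@complexI _) _ 0).
Qed.

(** The approximating residues are nonpositive, since 1 - al is their only negative factor;
    strictness comes from [residue_limit_neq0]. *)
Lemma residue_limit_lt0 : residue_limit a al < 0.
Proof.
have [a0 a1] := andP ha; have [al1 al2] := andP hal.
rewrite lt_neqAle residue_limit_neq0/=.
rewrite -(cvg_lim _ (cvg_residue hal ha))//; apply: limr_le.
  by apply/cvg_ex; exists (residue_limit a al); exact: cvg_residue.
apply: nearW => n; rewrite mulr_ge0_le0 ?expR_ge0// /res_coef subr0 !addr0.
rewrite mulr_ge0_le0//.
  by rewrite mulr_ge0//; apply: prodr_ge0 => k _; rewrite addr_ge0//; lra.
rewrite invr_le0 -[n.+1]/(1 + n)%N lagrange_denE expr0 fact0 !mul1r.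
rewrite mulr_ge0_le0// /rising big_ord_recl addr0 mulr_le0_ge0//; first by lra.
by apply: prodr_ge0 => k _; rewrite /= /bump/= natrD; have : 0 <= k%:R :> R by []; lra.
Qed.

End residue_sign.

Section residual_fourier.
Variables (R : realType) (al p q z : R).
Hypotheses (hal : 1 < al < 2) (p0 : 0 <= p) (q0 : 0 <= q) (z0 : z != 0).
Local Notation mu := (@lebesgue_measure R).
Local Notation h := (residual_density al p q).
Local Notation s := (0 -i* z).
Variables L1 L2 : R[i].
Hypothesis cL1 : ccvg (fun n => \sum_(j < n) (binw al j)%:C * shift_inv s j) L1.
Hypothesis cL2 :
  ccvg (fun n => \sum_(j < n) (binw al j)%:C * shift_inv ((1 - al)%:C - s) j) L2.

Let shift_inv1 (j : nat) : shift_inv s j =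
  (j%:R / (j%:R ^+ 2 + z ^+ 2)) +i* (z / (j%:R ^+ 2 + z ^+ 2)).
Proof. by apply: eqc; rewrite /shift_inv ?ReV ?ImV /= add0r addr0 sqrrN ?opprK. Qed.

Let shift_inv2 (j : nat) : shift_inv ((1 - al)%:C - s) j =
  ((1 - al + j%:R) / ((1 - al + j%:R) ^+ 2 + z ^+ 2)) +i*
  (- z / ((1 - al + j%:R) ^+ 2 + z ^+ 2)).
Proof. by apply: eqc; rewrite /shift_inv ?ReV ?ImV /= subr0 opprK add0r addr0. Qed.

Let Re_R (t : R) (y : R[i]) : Re (t%:C * y) = t * Re y.
Proof. by rewrite ReM /= mul0r subr0. Qed.
Let Im_R (t : R) (y : R[i]) : Im (t%:C * y) = t * Im y.
Proof. by rewrite ImM /= mul0r addr0. Qed.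

(** Here [f] is the real or the imaginary part, so that cosine and sine are treated together. The
    term p * r0 compensates for the pole 0, present in [L1] but absent from h. *)
Let residual_real (Ip In : nat -> R) (f : R[i] -> R) (psi : R -> R) (r0 : R) :
  (forall x y, f (x + y) = f x + f y) -> (forall t y, f (t%:C * y) = t * f y) ->
  (forall u l, ccvg u l -> f (u n) @[n --> \oo] --> f l) ->
  measurable_fun [set: R] psi -> (forall x, `|psi x| <= 1) ->
  (forall j, (\int[mu]_(x in `[0%R, +oo[) (expR (- lapos al j * x) * (1 + psi x))%:E =
   ((lapos al j)^-1 + Ip j)%:E)%E) ->
  (forall j, (\int[mu]_(x in `[0%R, +oo[) (expR (- laneg al j * x) * (1 + psi (- x)))%:E =
   ((laneg al j)^-1 + In j)%:E)%E) ->
  f (shift_inv s 0) = r0 ->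
  (forall j, f (shift_inv s j.+1) = Ip j.+1) ->
  - f (shift_inv ((1 - al)%:C - s) 0) = Ip 0%N ->
  (forall j, f (shift_inv ((1 - al)%:C - s) j.+1) = In j) ->
  (\int[mu]_x (h x * psi x)%:E = (f (- p%:C * L1 - q%:C * L2) + p * r0)%:E)%E.
Proof.
move=> fD fR fc mpsi psi1 HIp HIn f0 f1 g0 g1.
have [l1 [l2 [c1 c2 ->]]] := integral_residual_test hal p0 q0 mpsi psi1 HIp HIn.
congr EFin.
have fN y : f (- y) = - f y.
  by rewrite -mulN1r -(rmorphN1 (real_complex R)) fR mulN1r.
have fsum n (u : nat -> R[i]) : f (\sum_(j < n) u j) = \sum_(j < n) f (u j).
  apply: (big_morph f fD).
  by have := fR 0 0; rewrite mulr0 mul0r.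
(* One more term on the positive side: its index 0 is the pole 1 - al of the second family, so n + 1
   terms here and n terms there use the same poles as the two truncated sums below, up to the pole
   0. *)
have c3 : series (fun j => cpos al p q j * Ip j) n.+1 +
    series (fun j => cneg al q j * In j) n @[n --> \oo] --> l1 + l2.
  by apply: cvgD => //; rewrite cvg_shiftS.
have c4 : f (- p%:C * (\sum_(j < n.+1) (binw al j)%:C * shift_inv s j) -
    q%:C * (\sum_(j < n.+1) (binw al j)%:C * shift_inv ((1 - al)%:C - s) j)) + p * r0
    @[n --> \oo] --> f (- p%:C * L1 - q%:C * L2) + p * r0.
  apply: cvgD; last exact: cvg_cst.
  have k1 : ccvg (fun n => - p%:C * (\sum_(j < n.+1) (binw al j)%:C * shift_inv s j)) (- p%:C * L1).
    by apply: ccvgM; [exact: ccvg_cst|apply/(ccvg_shiftS (fun n => \sum_(j < n) _))].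
  have k2 : ccvg (fun n => - q%:C * (\sum_(j < n.+1) (binw al j)%:C * shift_inv ((1 - al)%:C - s) j)) (- q%:C * L2).
    by apply: ccvgM; [exact: ccvg_cst|apply/(ccvg_shiftS (fun n => \sum_(j < n) _))].
  apply: fc; rewrite -mulNr; under eq_fun do rewrite -mulNr.
  exact: ccvgD.
apply: (cvg_unique _ c3); rewrite //.
apply: cvg_trans c4; apply: near_eq_cvg; apply: nearW => n.
rewrite fD fN mulNr fN !fR.
rewrite (fsum n.+1 (fun j => (binw al j)%:C * shift_inv s j)).
rewrite (fsum n.+1 (fun j => (binw al j)%:C * shift_inv ((1 - al)%:C - s) j)).
rewrite /series/= !big_mkord !big_ord_recl /= !fR f0 binw0 !mul1r.
rewrite -g0 /cpos /cneg /=.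
under [X in - (p * (_ + X))]eq_bigr do rewrite fR f1.
under [X in - (q * (_ + X))]eq_bigr do rewrite fR g1.
rewrite [X in _ = _ + X + _](eq_bigr (fun i : 'I_n => - p * (binw al i.+1 * Ip i.+1)));
    last first.
  by move=> i _; rewrite mulrA.
rewrite [X in _ = _ + X](eq_bigr (fun i : 'I_n => - q * (binw al i.+1 * In i))); last first.
  by move=> i _; rewrite mulrA.
rewrite -!mulr_sumr; ring.
Qed.

Lemma integral_residual_cos :
  (\int[mu]_x (h x * cos (z * x))%:E = (Re (- p%:C * L1 - q%:C * L2))%:E)%E.
Proof.
rewrite (@residual_real (fun j => lapos al j / (lapos al j ^+ 2 + z ^+ 2))
  (fun j => laneg al j / (laneg al j ^+ 2 + z ^+ 2)) (@complex.Re R) _ 0).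
- by rewrite mulr0 addr0.
- exact: ReD.
- exact: Re_R.
- by move=> u l [].
- exact: measurable_cos_lin.
- by move=> x; exact: cos_max.
- by move=> j; rewrite integral_expR_1Dcos// lapos_gt0.
- move=> j; rewrite -(integral_expR_1Dcos z (laneg_gt0 hal j)).
  by apply: eq_integral => x _; rewrite mulrN cosN.
- by rewrite shift_inv1 /= mul0r.
- by move=> j; rewrite shift_inv1.
- by rewrite shift_inv2 /= addr0 -mulNr opprB -sqrrN opprB.
- move=> j; rewrite shift_inv2 /= /laneg.
  by rewrite (_ : 1 - al + _ = j.+1%:R - (al - 1)); last ring.
Qed.

Lemma integral_residual_sin :
  (\int[mu]_x (h x * sin (z * x))%:E =
   (Im (- p%:C * L1 - q%:C * L2) + p / z)%:E)%E.
Proof.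
rewrite (@residual_real (fun j => z / (lapos al j ^+ 2 + z ^+ 2))
  (fun j => - z / (laneg al j ^+ 2 + z ^+ 2)) (@complex.Im R) _ z^-1).
- by [].
- exact: ImD.
- exact: Im_R.
- by move=> u l [].
- exact: measurable_sin_lin.
- by move=> x; exact: sin_max.
- by move=> j; rewrite integral_expR_1Dsin// lapos_gt0.
- move=> j; rewrite -(sqrrN z) -(integral_expR_1Dsin (- z) (laneg_gt0 hal j)).
  by apply: eq_integral => x _; rewrite mulrN [- z * x]mulNr.
- by rewrite shift_inv1 /= expr0n /= add0r expr2 invfM mulrA divff// mul1r.
- by move=> j; rewrite shift_inv1.
- by rewrite shift_inv2 /= addr0 -mulNr opprK -(sqrrN (1 - al)) opprB.
- move=> j; rewrite shift_inv2 /= /laneg.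
  by rewrite (_ : 1 - al + _ = j.+1%:R - (al - 1)); last ring.
Qed.

End residual_fourier.

Section inverse_exponent.
Variables (R : realType) (alpha rho : R).
Hypotheses (hal : 1 < alpha < 2) (ha : 0 < alpha * rho < 1)
  (hb : 0 < alpha * (1 - rho) < 1).
Local Notation mu := (@lebesgue_measure R).

Definition weight_pos : R := - residue_limit (alpha * rho) alpha.
Definition weight_neg : R := - residue_limit (alpha * (1 - rho)) alpha.

Lemma weight_pos_gt0 : 0 < weight_pos.
Proof. by rewrite oppr_gt0 residue_limit_lt0. Qed.

Lemma weight_neg_gt0 : 0 < weight_neg.
Proof. by rewrite oppr_gt0 residue_limit_lt0. Qed.

Lemma shift_inv_le (w : R[i]) k : Im w != 0 -> normc (shift_inv w k) <= `|Im w|^-1.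
Proof.
move=> w0; rewrite /shift_inv normcV.
have h : `|Im w| <= normc (w + k%:R%:C).
  by apply: le_trans (normr_Im_le _); rewrite ImD /= addr0.
by rewrite lef_pV2 ?posrE ?(lt_le_trans _ h) ?normr_gt0.
Qed.

(** The partial fraction series is compared term by term with the transform of h. The term -i C / z
    is the pole at s = 0, formally the transform of C 1_{x<0}. *)
Lemma inverse_exponent (z : R) : z != 0 -> exists hc hs : R,
  [/\ (\int[mu]_x (residual_density alpha weight_pos weight_neg x * cos (z * x))%:E = hc%:E)%E,
      (\int[mu]_x (residual_density alpha weight_pos weight_neg x * sin (z * x))%:E = hs%:E)%E,
      Psi_tilde alpha rho z != 0 &
      (Psi_tilde alpha rho z)^-1 = hc +i* (hs - weight_pos / z)].
Proof.
move=> z0.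
pose s : R[i] := 0 -i* z.
have Imne (w : R[i]) k : Im w != 0 -> w + (k%:R : R)%:C != 0.
  by move=> w0; rewrite eq_complex /= ImD /= addr0 (negbTE w0) andbF.
have s_im : Im s != 0 by rewrite /= oppr_eq0.
have s_im' (x : R) : Im (x%:C - s) != 0 by rewrite ImD ImN /= opprK add0r.
have a_im (x : R) : Im (x%:C + s) != 0 by rewrite ImD /= add0r oppr_eq0.
have hb' : 0 < alpha - alpha * rho < 1.
  by move: hb; rewrite mulrBr mulr1.
have M1 k : normc (shift_inv s k) <= `|z|^-1.
  by apply: le_trans (shift_inv_le k s_im) _; rewrite /= normrN.
have M2 k : normc (shift_inv ((1 - alpha)%:C - s) k) <= `|z|^-1.
  by apply: le_trans (shift_inv_le k (s_im' _)) _; rewrite ImD ImN /= opprK add0r.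
have [L1 [L2 [c1 c2 E]]] := @gamma_quotient_series R (alpha * rho) alpha hal ha hb' s `|z|^-1
  (fun k => Imne _ k s_im) (fun k => Imne _ k (s_im' _)) M1 M2.
have PsiE : Psi_tilde alpha rho z = (rgamma ((alpha * rho)%:C + s) *
    rgamma ((1 - alpha * rho)%:C - s) / (rgamma s * rgamma ((1 - alpha)%:C - s)))^-1.
  have e1 : alpha * rho -i* z = (alpha * rho)%:C + s by apply: eqc; rewrite ?ReD ?ImD /= ?addr0 ?add0r.
  have e2 : (1 - alpha * rho) +i* z = (1 - alpha * rho)%:C - s.
    by apply: eqc; rewrite ?ReD ?ImD ?ReN ?ImN /= ?oppr0 ?addr0 ?opprK ?add0r.
  have e3 : (1 - alpha) +i* z = (1 - alpha)%:C - s.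
    by apply: eqc; rewrite ?ReD ?ImD ?ReN ?ImN /= ?oppr0 ?addr0 ?opprK ?add0r.
  rewrite /Psi_tilde e1 e2 e3 /Gamma !invfM !invrK -/s.
  move: (rgamma _) (rgamma _) (rgamma _) (rgamma _) => A B C D; ring.
have inv_neq0 : (Psi_tilde alpha rho z)^-1 != 0.
  rewrite PsiE invrK mulf_neq0// ?invr_neq0// mulf_neq0//; apply: rgamma_neq0 => k;
    by rewrite Imne.
exists (Re (- weight_pos%:C * L1 - weight_neg%:C * L2)),
  (Im (- weight_pos%:C * L1 - weight_neg%:C * L2) + weight_pos / z).
split.
- exact: (integral_residual_cos hal (ltW weight_pos_gt0) (ltW weight_neg_gt0) c1 c2).
- exact: (integral_residual_sin hal (ltW weight_pos_gt0) (ltW weight_neg_gt0) z0 c1 c2).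
- by rewrite -invr_eq0.
- rewrite PsiE invrK E addrK.
  set K := _ + _; set K' := _ - _.
  have -> : K' = K.
    rewrite /K /K' /weight_pos /weight_neg mulrBr mulr1 !rmorphN opprK.
    by rewrite mulNr opprK.
  by case: (K).
Qed.

End inverse_exponent.

Local Close Scope complex_scope.

(** * Measurability of the path and drift *)

Section joint_measurability.
Variables (R : realType) (d : measure_display) (T : measurableType d).
Variable X : R -> T -> R.
Hypothesis mX : forall t, 0 <= t -> measurable_fun [set: T] (X t).
Hypothesis rcX : forall w t, 0 <= t -> (fun s => X s w) @ t^'+ --> X t w.

(** Frozen at [X 0] for negative times, so that it is defined on the whole product. *)
Definition joint_path (p : measurableTypeR R * T) : R := X (Num.max p.1 0) p.2.

(** The first multiple of 1/(n+1) strictly above max(x, 0); strictness is what the right limit in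
    [rcX] requires. *)
Definition grid_above (n : nat) (x : R) : R :=
  (Num.trunc (Num.max x 0 * n.+1%:R)).+1%:R / n.+1%:R.

Let max0 (x : R) : 0 <= Num.max x 0. Proof. by rewrite le_max lexx orbT. Qed.

Lemma grid_above_itv n x :
  Num.max x 0 < grid_above n x <= Num.max x 0 + n.+1%:R^-1.
Proof.
have y0 : 0 <= Num.max x 0 * n.+1%:R by rewrite mulr_ge0.
have /andP[h1 h2] := truncn_itv y0.
rewrite /grid_above ltr_pdivlMr// h2/= ler_pdivrMr// mulrDl mulVf ?pnatr_eq0//.
by rewrite -natr1 lerD2r.
Qed.

(** By right continuity the path is the limit of its samples on the grid, and each sampled path is a
    single random variable on each of countably many strips of time. *)
Lemma measurable_joint_path :
  measurable_fun [set: measurableTypeR R * T] joint_path.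
Proof.
pose f (n : nat) (p : measurableTypeR R * T) := X (grid_above n p.1) p.2.
apply: (@measurable_fun_cvg _ _ _ _ f) => [n|[x w] _]; last first.
  have /cvg_at_rightP := @rcX w _ (max0 x).
  apply; split => [n|]; first by have /andP[] := grid_above_itv n x.
  have h : Num.max x 0 + n.+1%:R^-1 @[n --> \oo] --> (Num.max x 0 + 0 : R).
    by apply: cvgD; [exact: cvg_cst|exact: cvg_harmonic].
  rewrite addr0 in h.
  apply: (squeeze_cvgr _ (cvg_cst (Num.max x 0)) h); apply: nearW => n.
  by have /andP[/ltW -> ->] := grid_above_itv n x.
pose y (p : measurableTypeR R * T) := Num.max p.1 0 * n.+1%:R.
have my : measurable_fun [set: measurableTypeR R * T] y.
  apply: measurable_funM => //; apply: measurable_maxr => //.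
pose E k := y @^-1` `[k%:R, k.+1%:R[%classic.
have mE k : measurable (E k).
  by rewrite -[E k]setTI; exact: my.
have -> : [set: measurableTypeR R * T] = \bigcup_k E k.
  apply/esym/seteqP; split => // p _; exists (Num.trunc (y p)) => //.
  by rewrite /E /= in_itv /= truncn_itv// mulr_ge0.
apply/measurable_fun_bigcup => // k.
have : measurable_fun (E k) (X (k.+1%:R / n.+1%:R) \o snd).
  apply: measurable_funTS; apply: measurableT_comp => //.
  by apply: mX; rewrite divr_ge0.
apply: eq_measurable_fun => p; rewrite inE /E /= in_itv /= => h.
rewrite /f /grid_above.
have -> : Num.trunc (Num.max p.1 0 * n.+1%:R) = k; last by [].
by apply/eqP; rewrite truncn_eq// mulr_ge0.
Qed.

End joint_measurability.

(** * Second moment of the centred path *)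

Lemma fatou_bound d (T : measurableType d) (R : realType) (m : {measure set T -> \bar R})
    (f : nat -> T -> R) (g : T -> R) (B : \bar R) :
  (forall n, measurable_fun [set: T] (f n)) -> (forall n x, 0 <= f n x) ->
  (forall x, f n x @[n --> \oo] --> g x) ->
  (forall n, (\int[m]_x (f n x)%:E <= B)%E) ->
  (\int[m]_x (g x)%:E <= B)%E.
Proof.
move=> mf f0 fg fB.
have cf x : (f n x)%:E @[n --> \oo] --> (g x)%:E.
  by apply: cvg_EFin; [exact: nearW|exact: fg].
have := @fatou _ _ _ m setT measurableT (fun n x => (f n x)%:E)
  (fun n => (measurable_EFinP _ _).2 (mf n)) (fun n x _ => f0 n x).
rewrite (_ : (fun x => limn_einf _) = EFin \o g); last first.
  by apply/funext => x; rewrite is_cvg_limn_einfE ?(cvg_lim _ (cf x))//; apply/cvg_ex; exists (g x)%:E.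
move=> h; apply: le_trans h _.
rewrite limn_einf_lim; apply: lime_le; first exact: is_cvg_einfs.
apply: nearW => n; apply: le_trans (fB n).
by apply: ereal_inf_lbound; exists n => /=.
Qed.

Section second_moment.
Variables (R : realType) (d : measure_display) (T : measurableType d).
Variables (P : probability T R) (Psi : R -> R[i]) (t : R) (Y : T -> R) (m K e : R).
Hypothesis t0 : 0 <= t.
Hypothesis e0 : 0 < e.
Hypothesis mY : measurable_fun [set: T] Y.
Hypothesis EC : forall z,
  ('E_P[fun w => cos (z * Y w)] = (Re (cexp (- (t%:C)%C * Psi z)))%:E)%E.
Hypothesis ES : forall z,
  ('E_P[fun w => sin (z * Y w)] = (Im (cexp (- (t%:C)%C * Psi z)))%:E)%E.
Hypothesis Psi_drift : forall z, 0 < z < e ->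
  normc (Psi z - Complex 0 (m * z)) <= K * z ^+ 2.

Let K0 : 0 <= K.
Proof.
have e2 : 0 < e / 2 < e by rewrite divr_gt0//= ltr_pdivrMr// ltr_pMr// ltr1n.
have := le_trans (normc_ge0 _) (Psi_drift e2).
by rewrite pmulr_lge0// exprn_gt0// divr_gt0.
Qed.

Lemma measurable_cos_comp (z : R) (f : T -> R) : measurable_fun [set: T] f ->
  measurable_fun [set: T] (fun w => cos (z * f w)).
Proof. by move=> mf; exact: measurableT_comp (measurable_cos_lin z) mf. Qed.

Lemma measurable_sin_comp (z : R) (f : T -> R) : measurable_fun [set: T] f ->
  measurable_fun [set: T] (fun w => sin (z * f w)).
Proof. by move=> mf; exact: measurableT_comp (measurable_sin_lin z) mf. Qed.

Lemma integrable_bounded (f : T -> R) (M : R) : measurable_fun [set: T] f ->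
  (forall w, `|f w| <= M) -> P.-integrable [set: T] (EFin \o f).
Proof.
move=> mf fM; apply: measurable_bounded_integrable => //.
  by rewrite ltey_eq fin_num_measure.
exists M; split; first exact: num_real.
by move=> x Mx w _; exact: le_trans (fM w) (ltW Mx).
Qed.

Let expectation_cos_centered (z : R) :
  (\int[P]_w (cos (z * (Y w + m * t)))%:E =
   (Re (cexp (- t%:C * (Psi z - Complex 0 (m * z)))%C))%:E)%E.
Proof.
have ic := integrable_bounded (measurable_cos_comp z mY) (fun w => cos_max _).
have iS := integrable_bounded (measurable_sin_comp z mY) (fun w => sin_max _).
have ec := EC z; have es := ES z; rewrite unlock in ec es.
under eq_integral do rewrite mulrDr cosD EFinB mulrC [sin _ * sin _]mulrC 2!EFinM.
rewrite integralB//; last 2 first.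
- exact: integrableZl ic.
- exact: integrableZl iS.
rewrite integralZl// integralZl// ec es -!EFinM -EFinB; congr EFin.
rewrite mulrBr cexpD ReM.
have -> : (- (- t%:C * Complex 0 (m * z)))%C = Complex 0 (z * (m * t)).
  by apply: eqc; rewrite /=; ring.
by rewrite /cexp /= expR0 !mul1r mulrC [X in _ - X = _]mulrC.
Qed.

(** For |v| <= 1, [cexp_taylor] with M = 1 gives |exp v - 1| <= 5 e |v|^2 + |v| <= A |v|. *)
Let A : R := 5 * expR 1 + 1.

Let expectation_onem_cos (z : R) : 0 < z < e -> t * (K * z ^+ 2) <= 1 ->
  (\int[P]_w ((1 - cos (z * (Y w + m * t))) / z ^+ 2)%:E <= (A * K * t)%:E)%E.
Proof.
move=> ze tz; have /andP[z0 _] := ze.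
have mYt : measurable_fun [set: T] (fun w => Y w + m * t) by exact: measurable_funD.
have ic := integrable_bounded (measurable_cos_comp z mYt) (fun w => cos_max _).
set v := (- t%:C * (Psi z - Complex 0 (m * z)))%C.
have nv : normc v <= t * (K * z ^+ 2).
  by rewrite normcM normcN normcR ger0_norm// ler_wpM2l// Psi_drift.
have v1 : normc v <= 1 := le_trans nv tz.
have h : 1 - Re (cexp v) <= A * normc v.
  apply: (@le_trans _ _ (normc (cexp v - 1))).
    by rewrite (le_trans _ (normr_Re_le _))// ReD ReN -normrN opprB ler_norm.
  rewrite -[cexp v - 1](subrK v) (le_trans (normcD _ _))// /A mulrDl mul1r lerD2r.
  rewrite (le_trans (cexp_taylor v1))// (_ : 4 + 1 = 5); last by ring.
  rewrite ler_wpM2l ?mulr_ge0 ?expR_ge0// expr2 ler_piMr// normc_ge0//.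
under eq_integral do rewrite mulrC EFinM.
rewrite integralZl//; last first.
  exact: (integrableB measurableT (finite_measure_integrable_cst P 1 measurableT) ic).
under eq_integral do rewrite EFinB.
rewrite integralB//; last exact: finite_measure_integrable_cst.
rewrite (_ : (\int[P]_w 1%:E = 1)%E); last first.
  by rewrite integral_cst// mul1e; exact: probability_setT.
rewrite expectation_cos_centered -EFinB -EFinM lee_fin.
rewrite mulrC ler_pdivrMr ?exprn_gt0// (le_trans h)// -!mulrA ler_wpM2l//.
  by rewrite addr_ge0// mulr_ge0// expR_ge0.
by rewrite mulrCA.
Qed.

Let cvg_second_difference (u : nat -> R) (y : R) : (forall n, 0 < u n) ->
  u @ \oo --> 0 ->
  (1 - cos (u n * y)) / u n ^+ 2 @[n --> \oo] --> y ^+ 2 / 2.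
Proof.
move=> u0 cu.
have h : sin (u n * y / 2) / u n @[n --> \oo] --> y / 2.
  apply/subr_cvg0; apply: norm_cvg0.
  have c : u n * (y / 2) ^+ 2 @[n --> \oo] --> (0 * (y / 2) ^+ 2 : R).
    by apply: cvgM => //; exact: cvg_cst.
  rewrite mul0r in c.
  apply: (squeeze_cvgr _ (cvg_cst 0) c); apply: nearW => n; rewrite normr_ge0/=.
  have un := u0 n.
  have -> : sin (u n * y / 2) / u n - y / 2 = (sin (u n * y / 2) - u n * y / 2) / u n.
    by field; rewrite gt_eqF.
  rewrite normrM [`|_^-1|]ger0_norm ?invr_ge0 ?(ltW un)// ler_pdivrMr//.
  by rewrite (le_trans (norm_sinB_le _))// le_eqVlt; apply/orP/or_introl/eqP; field.
have -> : y ^+ 2 / 2 = 2 * (y / 2 * (y / 2)) by field.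
rewrite (_ : (fun n => _) = fun n => 2 * (sin (u n * y / 2) / u n * (sin (u n * y / 2) / u n))).
  by apply: cvgM; [exact: cvg_cst|exact: cvgM].
by apply/funext => n; rewrite onem_cosE; field; rewrite gt_eqF.
Qed.

(** No moment is assumed: (1 - cos(zy))/z^2 tends to y^2/2 as z -> 0, its expectation is bounded
    through the exponent by [expectation_onem_cos], and Fatou's lemma passes the bound to the
    limit. *)
Lemma second_moment_le :
  (\int[P]_w ((Y w + m * t) ^+ 2)%:E <= (2 * A * K * t)%:E)%E.
Proof.
(* Beyond this index, z = u n is below [e] and t K z^2 <= 1, as [expectation_onem_cos] demands. *)
pose N := Num.trunc (e^-1 + t * K).
have tK0 : 0 <= t * K by rewrite mulr_ge0.
have e10 : 0 < e^-1 by rewrite invr_gt0.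
have /andP[_ NK] : N%:R <= e^-1 + t * K < N.+1%:R.
  by apply: truncn_itv; rewrite addr_ge0// ltW.
pose u (n : nat) : R := (n + N).+1%:R^-1.
have u0 n : 0 < u n by rewrite invr_gt0.
have cu : u @ \oo --> 0.
  by have := @cvg_harmonic R; rewrite -(cvg_shiftn N).
have Nn n : e^-1 + t * K < (n + N).+1%:R.
  by rewrite (lt_le_trans NK)// ler_nat ltnS leq_addl.
have ue n : 0 < u n < e.
  rewrite u0/= -[ltRHS]invrK ltf_pV2 ?posrE//.
  by apply: le_lt_trans (Nn n); rewrite lerDl.
have ut n : t * (K * u n ^+ 2) <= 1.
  have u1 : u n <= 1 by rewrite invf_le1// ler1n.
  rewrite mulrA expr2 mulrA (@le_trans _ _ (t * K * u n))//.
    by rewrite ler_piMr// mulr_ge0// ltW.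
  by rewrite ler_pdivrMr// mul1r ltW// (le_lt_trans _ (Nn n))// lerDr ltW.
have mYt : measurable_fun [set: T] (fun w => Y w + m * t) by exact: measurable_funD.
have /= h := @fatou_bound _ _ _ P
  (fun n w => (1 - cos (u n * (Y w + m * t))) / u n ^+ 2)
  (fun w => (Y w + m * t) ^+ 2 / 2) (A * K * t)%:E.
have : (\int[P]_w ((Y w + m * t) ^+ 2 / 2)%:E <= (A * K * t)%:E)%E.
  apply: h => [n|n w|w|n].
  - by apply: measurable_funM => //; apply: measurable_funB => //; exact: measurable_cos_comp.
  - by rewrite divr_ge0 ?onem_cos_ge0// exprn_ge0// ltW.
  - exact: cvg_second_difference.
  - exact: expectation_onem_cos.
under eq_integral do rewrite mulrC EFinM.
rewrite ge0_integralZl//.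
- by rewrite -!mulrA [(2 * _)%:E]EFinM lee_pdivrMl// !mulrA.
- by apply/measurable_EFinP; exact: measurable_funX.
- by move=> w _; rewrite lee_fin sqr_ge0.
Qed.

End second_moment.

(** * The translated half-line and the exponent near zero *)

Section step_difference.
Variable R : realType.
Local Notation mu := (@lebesgue_measure R).

(** The indicator of the negative half-line minus its translate by y: neither is integrable, but the
    difference has norm |y| in L^1. *)
Definition step_difference (y x : R) : R := (x < 0)%R%:R - (x < y)%R%:R.

Let step_difference_itv (y : R) (f : R -> R) :
  (fun x => (step_difference y x * f x)%:E) =
  (if (0 <= y)%R then (fun x => - (f x)%:E) \_ `[0%R, y[ else (fun x => (f x)%:E) \_ `[y, 0%R[)%E.
Proof.
apply/funext => x; rewrite /step_difference; case: ifPn => [y0|]; last rewrite -ltNge => y0.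
  rewrite patchE mem_setE in_itv /=.
  have [xn|xn] := ltP x 0; last by case: ltP => _; rewrite ?(subrr, sub0r, mulN1r, mul0r).
  by rewrite (lt_le_trans xn y0) subrr mul0r.
rewrite patchE mem_setE in_itv /= andbC.
have [xn|xn] := ltP x 0; last by rewrite [x < y]ltNge (le_trans (ltW y0) xn)/= subrr mul0r.
by rewrite leNgt; case: (x < y); rewrite /= ?subrr ?subr0 ?mul0r ?mul1r.
Qed.

Lemma integral_step_difference (f F : R -> R) (y : R) : continuous f ->
  (forall x : R, is_derive x (1 : R) F (f x)) ->
  (\int[mu]_x (step_difference y x * f x)%:E = (F 0 - F y)%:E)%E.
Proof.
move=> cf dF.
have mf : measurable_fun [set: R] f by exact: continuous_measurable_fun.
have half a b : a <= b -> (\int[mu]_(x in `[a, b[) (f x)%:E = (F b - F a)%:E)%E.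
  rewrite le_eqVlt => /predU1P[->|ab].
    by rewrite set_itvco0 integral_set0 subrr.
  rewrite integral_itv_bndo_bndc; first exact: segment_FTC2.
  by apply/measurable_EFinP/measurable_funTS.
rewrite step_difference_itv; case: ifPn => [y0|]; last rewrite -ltNge => y0.
  have i : mu.-integrable `[0, y[ (EFin \o f).
    apply: (integrableS _ _ _ (continuous_segment_integrable 0 y cf)) => //.
    by apply: subset_itvl; rewrite bnd_simp.
  rewrite -integral_mkcond integralN; last exact: integrable_add_def.
  by rewrite half// -EFinN opprB.
by rewrite -integral_mkcond half// ltW.
Qed.

Lemma integral_norm_step_difference (y : R) :
  (\int[mu]_x `|(step_difference y x)%:E| = `|y|%:E)%E.
Proof.
have -> : (fun x => `|(step_difference y x)%:E|)%E =
    (fun x => (step_difference y x * (if 0 <= y then -1 else 1))%:E).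
  apply/funext => x; rewrite /= /step_difference.
  case: ifPn => [y0|]; last rewrite -ltNge => y0.
    have [xn|xn] := ltP x 0; first by rewrite (lt_le_trans xn y0) subrr normr0 mul0r.
    by case: ltP => _; rewrite /= ?subrr ?normr0 ?mul0r// sub0r normrN1 mulrN1 opprK.
  have [xn|xn] := ltP x 0; last by rewrite ltNge (le_trans (ltW y0) xn)/= subr0 normr0 mul0r.
  by case: ltP => _; rewrite ?subrr ?subr0 ?normr0 ?normr1 ?mul0r ?mul1r.
set c : R := if 0 <= y then -1 else 1.
have dF (x : R) : is_derive x (1 : R) (fun x => x * c) c.
  by apply: (is_derive_eq (dM (did x) (dcst c x))); rewrite mulr0 addr0 mul1r.
rewrite (@integral_step_difference (fun=> c) _ _ _ dF); last exact: cst_continuous.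
rewrite mul0r sub0r; congr EFin; rewrite /c; case: ifPn => [y0|]; last rewrite -ltNge => y0.
  by rewrite mulrN1 opprK ger0_norm.
by rewrite mulr1 ltr0_norm.
Qed.

End step_difference.

Section exponent_drift.
Variables (R : realType) (h : R -> R) (C : R) (Psi : R -> R[i]).
Local Notation mu := (@lebesgue_measure R).
Hypothesis C0 : 0 < C.
Hypothesis h0 : forall x, 0 <= h x.
Hypothesis ih : mu.-integrable [set: R] (EFin \o h).
Hypothesis inv : forall z, z != 0 -> exists hc hs : R,
  [/\ (\int[mu]_x (h x * cos (z * x))%:E = hc%:E)%E,
      (\int[mu]_x (h x * sin (z * x))%:E = hs%:E)%E,
      Psi z != 0 & (Psi z)^-1 = Complex hc (hs - C / z)].

Let H : R := fine (\int[mu]_x (h x)%:E).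

Let bounded_by_mass (f : R -> R) v : measurable_fun [set: R] f ->
  (forall x, `|f x| <= 1) -> (\int[mu]_x (h x * f x)%:E = v%:E)%E -> `|v| <= H.
Proof.
move=> mf f1 E.
have mh : measurable_fun [set: R] h by apply/measurable_EFinP; exact: measurable_int ih.
have mhf : measurable_fun [set: R] (fun x => h x * f x) by exact: measurable_funM.
rewrite -lee_fin /H fineK; last exact: integrable_fin_num.
rewrite -abse_EFin -E (le_trans (le_abse_integral _ _ _))//.
  exact/measurable_EFinP.
apply: ge0_le_integral => //.
- by apply/measurable_EFinP; exact: measurableT_comp.
- exact/measurable_EFinP.
- by move=> x _; rewrite /= lee_fin normrM (ger0_norm (h0 x)) ler_piMr.
Qed.

(* [1 = Psi z * (hc + i hs - i C / z)] forces [Psi z ~ i z / C] near [0]. *)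
Lemma exponent_drift : exists K e : R, 0 < e /\ forall z, 0 < z < e ->
  normc (Psi z - Complex 0 (C^-1 * z)) <= K * z ^+ 2.
Proof.
have H0 : 0 <= H by rewrite fine_ge0// integral_ge0// => x _; rewrite lee_fin.
have d0 : 0 < 4 * H + 1 by rewrite ltr_wpDl// mulr_ge0.
(* For z < C/(4H + 1) the transform of h, of modulus at most 2H, satisfies (z/C)(2H) <= 1/2. This
   first yields |Psi z| <= 2z/C, and substituting that back gives the error 4H z^2/C^2. *)
exists (4 * H / C ^+ 2), (C / (4 * H + 1)); split; first by rewrite divr_gt0.
move=> z /andP[z0 ze]; have [hc [hs [Ec Es Pn Pi]]] := inv (lt0r_neq0 z0).
have bc := bounded_by_mass (measurable_cos_lin z) (fun x => cos_max _) Ec.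
have bs := bounded_by_mass (measurable_sin_lin z) (fun x => sin_max _) Es.
set W := Complex hc hs.
have nW : normc W <= 2 * H.
  by rewrite (le_trans (normc_le_ReIm _))// /= mulr2n mulrDl mul1r lerD.
have E : Psi z - Complex 0 (C^-1 * z) = - (Complex 0 (C^-1 * z) * W * Psi z).
  apply: (mulIf (invr_neq0 Pn)).
  rewrite mulrBl divff// mulNr mulfK// Pi.
  have zn := lt0r_neq0 z0; have Cn := lt0r_neq0 C0.
  by apply: eqc; rewrite /=; field; rewrite zn Cn.
have nC : normc (Complex 0 (C^-1 * z)) = z / C.
  by rewrite /= expr0n /= add0r sqrtr_sqr ger0_norm ?mulr_ge0 ?invr_ge0 ?ltW// mulrC.
have zC0 : 0 <= z / C by rewrite divr_ge0 ?ltW.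
have n0 : 0 <= normc (Psi z) by exact: normc_ge0.
have half : z / C * (2 * H) <= 2^-1.
  move: ze; rewrite ltr_pdivlMr// => ze.
  rewrite mulrAC ler_pdivrMr//; nra.
have nE : normc (Psi z - Complex 0 (C^-1 * z)) <= z / C * (2 * H) * normc (Psi z).
  by rewrite E normcN !normcM nC ler_wpM2r// ler_wpM2l.
have nPsi : normc (Psi z) <= 2 * (z / C).
  have := normcD (Psi z - Complex 0 (C^-1 * z)) (Complex 0 (C^-1 * z)).
  rewrite subrK nC => hn; nra.
rewrite (le_trans nE)// (_ : 4 * H / C ^+ 2 * z ^+ 2 = z / C * (2 * H) * (2 * (z / C))).
  by apply: ler_wpM2l => //; apply: mulr_ge0 => //; apply: mulr_ge0.
by field; rewrite lt0r_neq0.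
Qed.

End exponent_drift.

(** * The resolvent identity *)

Section semigroup_integral.
Variables (R : realType) (Psi : R[i]).
Local Notation mu := (@lebesgue_measure R).
Hypothesis Psi0 : Psi != 0.

Let semigroupE (s : R) : cexp (- (s%:C)%C * Psi) =
  Complex (expR (- Re Psi * s) * cos (- Im Psi * s)) (expR (- Re Psi * s) * sin (- Im Psi * s)).
Proof.
have -> : - (s%:C)%C * Psi = Complex (- Re Psi * s) (- Im Psi * s).
  by case: Psi => u v; apply: eqc; rewrite /=; ring.
by [].
Qed.

Lemma integral_semigroup (a b t : R) : 0 < t ->
  (\int[mu]_(s in `[0%R, t])
     (a * Re (cexp (- (s%:C)%C * Psi)) + b * Im (cexp (- (s%:C)%C * Psi)))%:E =
   (a * Re (Psi^-1 * (1 - cexp (- (t%:C)%C * Psi))) +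
    b * Im (Psi^-1 * (1 - cexp (- (t%:C)%C * Psi))))%:E)%E.
Proof.
move=> t0.
have := mulVf Psi0; case: (Psi^-1) => p q PV.
have PVr : p * Re Psi - q * Im Psi = 1.
  by move: (congr1 (@complex.Re R) PV); rewrite ReM.
have PVi : p * Im Psi + q * Re Psi = 0.
  by move: (congr1 (@complex.Im R) PV); rewrite ImM.
pose e s := expR (- Re Psi * s); pose cs s := cos (- Im Psi * s); pose sn s := sin (- Im Psi * s).
have de (s : R) : is_derive s (1 : R) e (e s * - Re Psi) by exact: is_derive_expR_lin.
have dc (s : R) : is_derive s (1 : R) cs (- sn s * - Im Psi) by exact: is_derive_cos_lin.
have ds (s : R) : is_derive s (1 : R) sn (cs s * - Im Psi) by exact: is_derive_sin_lin.
(* This is a Re + b Im of the primitive -exp(-s Psi)/Psi, with p + iq = 1/Psi. *)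
pose G s := (b * - q - a * p) * (e s * cs s) + (a * q - b * p) * (e s * sn s).
pose g s := a * (e s * cs s) + b * (e s * sn s).
have dG (s : R) : is_derive s (1 : R) G (g s).
  apply: (is_derive_eq (dD (dZ _ (dM (de s) (dc s))) (dZ _ (dM (de s) (ds s))))).
  rewrite /g; move: (e s) (cs s) (sn s) => x y w.
  transitivity (a * (x * y) * (p * Re Psi - q * Im Psi) + b * (x * y) * (p * Im Psi + q * Re Psi)
    + b * (x * w) * (p * Re Psi - q * Im Psi) - a * (x * w) * (p * Im Psi + q * Re Psi)).
    ring.
  rewrite PVr PVi; ring.
have cg : continuous g.
  have dg (s : R) := dD (dZ a (dM (de s) (dc s))) (dZ b (dM (de s) (ds s))).
  exact: derive_continuous dg.
under eq_integral do rewrite semigroupE /= -/(e _) -/(cs _) -/(sn _) -/(g _).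
rewrite (segment_FTC2 t0 cg dG) semigroupE; congr EFin.
rewrite /G /= -/(e t) -/(cs t) -/(sn t).
have -> : e 0 = 1 by rewrite /e mulr0 expR0.
have -> : cs 0 = 1 by rewrite /cs mulr0 cos0.
have -> : sn 0 = 0 by rewrite /sn mulr0 sin0.
by move: (e t) (cs t) (sn t) => x y w; ring.
Qed.

End semigroup_integral.

Section sigma_finite_product.
Context d1 d2 (T1 : measurableType d1) (T2 : measurableType d2) (R : realType).
Variables (m1 : {sigma_finite_measure set T1 -> \bar R})
  (m2 : {sigma_finite_measure set T2 -> \bar R}).

Definition sigma_product : set (T1 * T2) -> \bar R := (m1 \x m2)%E.

HB.instance Definition _ := Measure.on sigma_product.

Let sigma_finite_product : sigma_finite [set: T1 * T2] sigma_product.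
Proof.
have /sigma_finiteP[F [TF ndF Foo]] := sigma_finiteT m1.
have /sigma_finiteP[G [TG ndG Goo]] := sigma_finiteT m2.
exists (fun n => F n `*` G n).
  apply/esym/seteqP; split => // -[x y] _.
  have [i _ Fx] : (\bigcup_n F n) x by rewrite -TF.
  have [j _ Gy] : (\bigcup_n G n) y by rewrite -TG.
  exists (maxn i j) => //; split => /=.
    by apply: (subsetPset _ _ (ndF _ _ (leq_maxl i j))).
  by apply: (subsetPset _ _ (ndG _ _ (leq_maxr i j))).
move=> k; have [mF Fy] := Foo k; have [mG Gy] := Goo k.
split; first exact: measurableX.
by rewrite /sigma_product product_measure1E// lte_mul_pinfty// ge0_fin_numE.
Qed.

HB.instance Definition _ := Measure_isSigmaFinite.Build _ _ _ sigma_product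
  sigma_finite_product.

End sigma_finite_product.

(** * The resolvent identity on the Fourier side *)

Section fourier_identity.
Variables (R : realType) (d : measure_display) (T : measurableType d)
  (P : probability T R) (X : R -> T -> R) (h : R -> R) (C : R) (Psi : R -> R[i]).
Local Notation mu := (@lebesgue_measure R).
Local Notation U := (measurableTypeR R * T)%type.
Local Notation m := (sigma_product mu P).
Hypothesis ih : mu.-integrable [set: R] (EFin \o h).
Hypothesis inv : forall z, z != 0 -> exists hc hs : R,
  [/\ (\int[mu]_x (h x * cos (z * x))%:E = hc%:E)%E,
      (\int[mu]_x (h x * sin (z * x))%:E = hs%:E)%E,
      Psi z != 0 & (Psi z)^-1 = Complex hc (hs - C / z)].
Hypothesis mX : forall t, 0 <= t -> measurable_fun [set: T] (X t).
Hypothesis rcX : forall w t, 0 <= t -> (fun s => X s w) @ t^'+ --> X t w.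
Hypothesis charX : has_char_exponent P X Psi.
Variable t : R.
Hypothesis t0 : 0 < t.
Hypothesis iX : P.-integrable [set: T] (EFin \o X t).

(* Each piece is the image under [path_position i] of the signed measure with
   density [path_weight i]. *)
Definition path_weight (i : 'I_4) (p : U) : R :=
  nth 0 [:: h p.1; - h p.1; C * step_difference (X t p.2) p.1; - \1_`[0, t] p.1] i.

(** The four signed measures are h dx, minus its convolution with P_t, C E[1_{x<0} - 1_{x<X_t}] dx,
    and minus the occupation measure up to time t. The first coordinate of [p] is a point of space
    in the first three and a time in the last. *)
Definition path_position (i : 'I_4) (p : U) : R :=
  nth 0 [:: p.1; p.1 + X t p.2; p.1; joint_path X p] i.

Let mXt : measurable_fun [set: T] (X t). Proof. exact/mX/ltW. Qed.

Lemma measurable_path_position i : measurable_fun [set: U] (path_position i).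
Proof.
case: i => [[|[|[|[|//]]]] i4]; rewrite /path_position/=.
- exact: measurable_fst.
- by apply: measurable_funD => //; exact: measurableT_comp mXt measurable_snd.
- exact: measurable_fst.
- exact: measurable_joint_path.
Qed.

Let integrable_fst (f : R -> R) : mu.-integrable [set: R] (EFin \o f) ->
  m.-integrable [set: U] (fun p => (f p.1)%:E).
Proof.
move=> fi; have := integrable_prodM fi (finite_measure_integrable_cst P 1 measurableT).
by under eq_fun do rewrite /= mulr1.
Qed.

Let measurable_step : measurable_fun [set: U] (fun p => step_difference (X t p.2) p.1).
Proof.
have mind (f g : U -> R) : measurable_fun [set: U] f -> measurable_fun [set: U] g ->
    measurable_fun [set: U] (fun p => (f p < g p)%R%:R : R).
  move=> mf mg; have -> : (fun p => (f p < g p)%R%:R : R) = (fun p => if f p < g p then 1 else 0).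
    by apply/funext => p; case: ltP.
  by apply: measurable_fun_ifT => //; exact: measurable_fun_ltr.
apply: measurable_funB; first exact: mind.
by apply: mind => //; exact: measurableT_comp mXt measurable_snd.
Qed.

Let integrable_step : m.-integrable [set: U] (fun p => (step_difference (X t p.2) p.1)%:E).
Proof.
apply/integrable21ltyP; first exact/measurable_EFinP.
under eq_integral do rewrite /= integral_norm_step_difference.
by have /integrableP[] := iX.
Qed.

Lemma integrable_path_weight i : m.-integrable [set: U] (EFin \o path_weight i).
Proof.
case: i => [[|[|[|[|//]]]] i4]; rewrite /path_weight/=.
- exact: integrable_fst.
- exact: (integrableN (integrable_fst ih)).
- exact: (integrableZl measurableT C integrable_step).
- have i := integrable_indic_itv (0 : R) t true false.
  exact: (integrableN (integrable_fst i)).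
Qed.

Section trigonometric_test.
Variables a b z : R.
Hypothesis z0 : 0 < z.

Let trig (y : R) : R := a * cos (z * y) + b * sin (z * y).

Let measurable_trig : measurable_fun [set: R] trig.
Proof.
apply: measurable_funD; apply: measurable_funM => //.
  exact: measurable_cos_lin.
exact: measurable_sin_lin.
Qed.

Let trig_le y : `|trig y| <= `|a| + `|b|.
Proof.
rewrite (le_trans (ler_normD _ _))// !normrM lerD// ler_piMr//.
  exact: cos_max.
exact: sin_max.
Qed.

Let expectation_trig (s k A B : R) : 0 <= s ->
  (\int[P]_w (k + A * cos (z * X s w) + B * sin (z * X s w))%:E =
   (k + A * Re (cexp (- (s%:C)%C * Psi z)) + B * Im (cexp (- (s%:C)%C * Psi z)))%:E)%E.
Proof.
move=> s0; have [] := charX z s0; rewrite unlock => Ec Es.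
have ic := integrable_bounded P (measurable_cos_comp z (mX s0)) (fun w => cos_max _).
have iS := integrable_bounded P (measurable_sin_comp z (mX s0)) (fun w => sin_max _).
have ik := finite_measure_integrable_cst P k measurableT.
under eq_integral do rewrite 2!EFinD 2!EFinM.
rewrite integralD//; last 2 first.
- by apply: integrableD => //; exact: integrableZl ic.
- exact: integrableZl iS.
rewrite integralD//; last exact: integrableZl ic.
rewrite !integralZl// Ec Es (_ : (\int[P]_w k%:E = k%:E)%E)//.
by rewrite integral_cst// [X in (_ * X)%E](@probability_setT _ _ _ P) mule1.
Qed.

(** With phi = exp(-t Psi) and H the transform of h, the four pieces contribute H, -phi H, -(1 -
    phi) iC/z and -(1 - phi)/Psi; they cancel because 1/Psi = H - iC/z. *)
Lemma weighted_sum_trig :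
  (\int[m]_p (weighted_sum path_weight path_position trig p)%:E = 0)%E.
Proof.
have [hc [hs [Ec Es Pn Pi]]] := inv (lt0r_neq0 z0).
have iw i := integrable_weighted measurable_path_position integrable_path_weight
  i measurable_trig trig_le.
have zn := lt0r_neq0 z0.
have hf A B : (\int[mu]_x (h x * (A * cos (z * x) + B * sin (z * x)))%:E =
    (A * hc + B * hs)%:E)%E.
  have mh : measurable_fun [set: R] h by apply/measurable_EFinP; exact: measurable_int ih.
  have ib (f : R -> R) : measurable_fun [set: R] f -> (forall x, `|f x| <= 1) ->
      mu.-integrable [set: R] (fun x => (h x * f x)%:E).
    move=> mf f1; apply: (le_integrable measurableT _ _ ih).
      by apply/measurable_EFinP; exact: measurable_funM.
    by move=> x _ /=; rewrite lee_fin normrM ler_piMr.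
  have ic := ib _ (measurable_cos_lin z) (fun x => cos_max _).
  have iS := ib _ (measurable_sin_lin z) (fun x => sin_max _).
  under eq_integral do rewrite mulrDr EFinD (mulrCA _ A) (mulrCA _ B) (EFinM A) (EFinM B).
  rewrite integralD//; last 2 first.
  - exact: integrableZl ic.
  - exact: integrableZl iS.
  by rewrite !integralZl// Ec Es.
have Et k A B := expectation_trig k A B (ltW t0).
have St := integral_semigroup Pn (- a) (- b) t0.
move: (cexp (- (t%:C)%C * Psi z)) => phi in Et St.
have I0 : (\int[m]_p (trig p.1 * h p.1)%:E = (a * hc + b * hs)%:E)%E.
  rewrite -(integral12_prod_meas1 (iw ord0)) -hf; apply: eq_integral => x _.
  rewrite /fubini_F /path_position /path_weight /= integral_cst//.
  by rewrite [X in (_ * X)%E](@probability_setT _ _ _ P) mule1 mulrC.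
have I1 : (\int[m]_p (trig (p.1 + X t p.2) * - h p.1)%:E =
    (- (a * Re phi + b * Im phi) * hc + - (b * Re phi - a * Im phi) * hs)%:E)%E.
  rewrite -(integral12_prod_meas1 (iw (Ordinal (isT : 1 < 4)%N))) -hf.
  apply: eq_integral => x _; rewrite /fubini_F /path_position /path_weight /=.
  transitivity (\int[P]_w (0 + - h x * (a * cos (z * x) + b * sin (z * x)) * cos (z * X t w) +
      - h x * (b * cos (z * x) - a * sin (z * x)) * sin (z * X t w))%:E)%E.
    apply: eq_integral => w _; congr EFin; rewrite /trig [z * (_ + _)]mulrDr cosD sinD; ring.
  by rewrite Et; congr EFin; ring.
have I2 : (\int[m]_p (trig p.1 * (C * step_difference (X t p.2) p.1))%:E =
    (- C * b / z + C * b / z * Re phi - C * a / z * Im phi)%:E)%E.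
  rewrite -(integral21_prod_meas1 (iw (Ordinal (isT : 2 < 4)%N))).
  rewrite -mulNr -Et.
  apply: eq_integral => w _; rewrite /fubini_G /path_position /path_weight /=.
  pose F y : R := C * a / z * sin (z * y) + - (C * b / z) * cos (z * y).
  have dF (y : R) : is_derive y (1 : R) F (C * trig y).
    apply: (is_derive_eq (dD (dZ _ (is_derive_sin_lin z y)) (dZ _ (is_derive_cos_lin z y)))).
    by rewrite /trig; field.
  under eq_integral do rewrite mulrCA mulrA mulrC.
  have ctrig : continuous (fun y => C * trig y).
    have dtrig (y : R) : is_derive y (1 : R) (fun y => C * trig y) _ :=
      dZ C (dD (dZ a (is_derive_cos_lin z y)) (dZ b (is_derive_sin_lin z y))).
    exact: derive_continuous dtrig.
  rewrite (integral_step_difference _ ctrig dF).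
  by congr EFin; rewrite /F mulr0 sin0 cos0; ring.
have I3 : (\int[m]_p (trig (joint_path X p) * - \1_`[0, t] p.1)%:E =
    (- a * Re ((Psi z)^-1 * (1 - phi)) + - b * Im ((Psi z)^-1 * (1 - phi)))%:E)%E.
  rewrite -(integral12_prod_meas1 (iw (Ordinal (isT : 3 < 4)%N))).
  rewrite -St [RHS]integral_mkcond.
  apply: eq_integral => x _; rewrite /fubini_F /path_position /path_weight /= patchE.
  rewrite mem_setE; case: ifPn => /= xt; last first.
    by under eq_integral do rewrite indicE mem_setE (negbTE xt) oppr0 mulr0; rewrite integral0.
  have x0 : 0 <= x by move: xt; rewrite in_itv /= => /andP[].
  transitivity (\int[P]_w (0 + - a * cos (z * X x w) + - b * sin (z * X x w))%:E)%E.
    apply: eq_integral => w _; rewrite /joint_path /= (max_idPl x0) indicE mem_setE xt /trig /=.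
    by congr EFin; ring.
  by rewrite (expectation_trig _ _ _ x0) add0r.
rewrite /weighted_sum; under eq_integral do rewrite -sumEFin.
rewrite integral_sum//.
rewrite !big_ord_recl big_ord0 /path_position /path_weight /= /bump /=.
rewrite [X in (X + _)%E]I0 [X in (_ + (X + _))%E]I1 [X in (_ + (_ + (X + _)))%E]I2.
rewrite [X in (_ + (_ + (_ + (X + _))))%E]I3 adde0 -!EFinD; congr EFin.
rewrite Pi; case: phi {Et St I1 I2 I3} => u v /=; ring.
Qed.
End trigonometric_test.

Lemma path_identity_weighted (b c : R) : b < c ->
  (\int[m]_p (weighted_sum path_weight path_position \1_(`]b, c]%classic) p)%:E = 0)%E.
Proof.
apply: (fourier_uniqueness measurable_path_position integrable_path_weight) => z z0.
  rewrite -[RHS](weighted_sum_trig 1 0 z0); apply: eq_integral => p _.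
  by congr EFin; apply: eq_bigr => i _; rewrite mul1r mul0r addr0.
rewrite -[RHS](weighted_sum_trig 0 1 z0); apply: eq_integral => p _.
by congr EFin; apply: eq_bigr => i _; rewrite mul1r mul0r add0r.
Qed.

End fourier_identity.

Section section_probability.
Variables (R : realType) (d : measure_display) (T : measurableType d)
  (P : probability T R).
Local Notation mu := (@lebesgue_measure R).
Local Notation U := (measurableTypeR R * T)%type.
Variables (Z : U -> R) (A : set R).
Hypothesis mZ : measurable_fun [set: U] Z.
Hypothesis mA : measurable A.

Let mZA : measurable (Z @^-1` A).
Proof. by rewrite -[Z @^-1` A]setTI; exact: mZ. Qed.

Let sectionE x : [set w | A (Z (x, w))] = xsection (Z @^-1` A) x.
Proof. by apply/seteqP; split => w /=; rewrite /xsection /= inE. Qed.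

Lemma measurable_section (x : R) : measurable [set w | A (Z (x, w))].
Proof. by rewrite sectionE; exact: measurable_xsection. Qed.

Lemma measurable_section_probability :
  measurable_fun [set: R] (fun x => P [set w | A (Z (x, w))]).
Proof.
have := measurable_fun_xsection P mZA.
by congr (measurable_fun _ _); apply/funext => x /=; rewrite sectionE.
Qed.

Lemma integral_section_probability (k : R -> R) :
  measurable_fun [set: R] k -> (forall x, 0 <= k x) ->
  (\int[sigma_product mu P]_p (k p.1 * \1_A (Z p))%:E =
   \int[mu]_x ((k x)%:E * P [set w | A (Z (x, w))]))%E.
Proof.
move=> mk k0.
rewrite /sigma_product fubini_tonelli1; last 2 first.
- apply/measurable_EFinP/measurable_funM; first exact: measurableT_comp mk measurable_fst.
  by apply: measurableT_comp mZ; exact: measurable_indic.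
- by move=> p; rewrite lee_fin mulr_ge0.
apply: eq_integral => x _; rewrite /fubini_F /=.
under eq_integral do rewrite EFinM.
have mS := measurable_section x.
rewrite ge0_integralZl//.
- by congr (_ * _)%E; rewrite -[X in P X]setIT -integral_indic.
- by apply/measurable_EFinP; exact: (measurable_indic mS).
- by rewrite lee_fin.
Qed.

End section_probability.

Section resolvent.
Variables (R : realType) (d : measure_display) (T : measurableType d)
  (P : probability T R) (X : R -> T -> R) (h : R -> R) (C : R) (Psi : R -> R[i]).
Local Notation mu := (@lebesgue_measure R).
Local Notation U := (measurableTypeR R * T)%type.
Local Notation m := (sigma_product mu P).
Hypothesis C0 : 0 < C.
Hypothesis h0 : forall x, 0 <= h x.
Hypothesis ih : mu.-integrable [set: R] (EFin \o h).
Hypothesis inv : forall z, z != 0 -> exists hc hs : R,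
  [/\ (\int[mu]_x (h x * cos (z * x))%:E = hc%:E)%E,
      (\int[mu]_x (h x * sin (z * x))%:E = hs%:E)%E,
      Psi z != 0 & (Psi z)^-1 = Complex hc (hs - C / z)].
Hypothesis mX : forall t, 0 <= t -> measurable_fun [set: T] (X t).
Hypothesis rcX : forall w t, 0 <= t -> (fun s => X s w) @ t^'+ --> X t w.
Hypothesis charX : has_char_exponent P X Psi.

Let mh : measurable_fun [set: R] h.
Proof. by apply/measurable_EFinP; exact: measurable_int ih. Qed.

(** The candidate for the potential density: the inverse transform of 1/Psi in which -iC/z is
    interpreted as a step on the negative half-line. *)
Definition green_density (x : R) : R := h x + C * (x < 0)%R%:R.

Lemma green_density_ge0 x : 0 <= green_density x.
Proof. by rewrite addr_ge0// mulr_ge0// ltW. Qed.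

Lemma measurable_green_density : measurable_fun [set: R] green_density.
Proof.
apply: measurable_funD => //; apply: measurable_funM => //.
have -> : (fun x : R => (x < 0)%R%:R : R) = \1_`]-oo, 0[.
  by apply/funext => x; rewrite indicE mem_setE in_itv.
exact: measurable_indic.
Qed.

(** This is u = u * P_t plus the occupation measure up to t, evaluated on ]b, c]. It is rearranged
    from the vanishing signed measure so that every term is nonnegative. *)
Lemma resolvent_identity (t b c : R) : 0 < t -> P.-integrable [set: T] (EFin \o X t) ->
  b < c ->
  (\int[mu]_(x in `]b, c]) (green_density x)%:E =
   \int[mu]_x ((h x)%:E * P [set w | `]b, c]%classic (x + X t w)%R]) +
   (\int[mu]_x ((C * \1_(`]b, c]%classic) x)%:E * P [set w | (0 < X t w - x)%R]) +
    \int[mu]_(s in `[0%R, t]) P [set w | `]b, c]%classic (X s w)]))%E.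
Proof.
move=> t0 iX bc; set I := `]b, c]%classic.
have mI : measurable I by exact: measurable_itv.
have mpos : measurable [set y : R | 0 < y].
  have -> : [set y : R | 0 < y] = `]0, +oo[%classic.
    by apply/seteqP; split => y /=; rewrite in_itv /= andbT.
  exact: measurable_itv.
have mXt := mX (ltW t0).
have mXt2 : measurable_fun [set: U] (fun p => X t p.2).
  by exact: measurableT_comp mXt measurable_snd.
have mD : measurable_fun [set: U] (fun p => p.1 + X t p.2) by exact: measurable_funD.
have mB : measurable_fun [set: U] (fun p => X t p.2 - p.1) by exact: measurable_funB.
have mJ := measurable_joint_path mX rcX.
pose W := weighted_sum (path_weight X h C t) (path_position X t) \1_I.
pose A (p : U) : R := \1_I p.1 * green_density p.1.
pose B0 (p : U) : R := h p.1 * \1_I (p.1 + X t p.2).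
pose B1 (p : U) : R := C * \1_I p.1 * \1_[set y : R | 0 < y] (X t p.2 - p.1).
pose B2 (p : U) : R := \1_(`[0, t]%classic) p.1 * \1_I (joint_path X p).
have W0 : (\int[m]_p (W p)%:E = 0)%E := path_identity_weighted ih inv mX rcX charX t0 iX bc.
have iW : m.-integrable [set: U] (EFin \o W).
  apply: (integrable_weighted_sum (M := 1) (measurable_path_position mX rcX t0)
    (integrable_path_weight C ih mX t0 iX)) => //.
  by move=> y; rewrite ger0_norm// indicE; case: (_ \in _).
(* A pointwise identity on the product space: subtracting the step difference from 1_{x<0} leaves
   1_{x<X_t}. The correction [W] has integral 0. *)
have AB p : A p = B0 p + (B1 p + B2 p) + W p.
  rewrite /W /weighted_sum !big_ord_recl big_ord0 /path_weight /path_position /= /bump /=.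
  rewrite /A /B0 /B1 /B2 /green_density /step_difference.
  rewrite [X in C * _ * X](_ : _ = (p.1 < X t p.2)%R%:R); last first.
    by rewrite indicE; congr ((nat_of_bool _)%:R); apply/idP/idP; rewrite inE /= subr_gt0.
  ring.
have iI : mu.-integrable [set: R] (EFin \o (\1_I : R -> R)) := integrable_indic_itv b c false false.
have iA : m.-integrable [set: U] (EFin \o A).
  have i1 : mu.-integrable [set: R] (fun x => (h x + C * \1_I x)%:E).
    exact: (integrableD measurableT ih (integrableZl measurableT C iI)).
  have i2 : mu.-integrable [set: R] (EFin \o (fun x => \1_I x * green_density x)).
    apply: (le_integrable measurableT _ _ i1).
      apply/measurable_EFinP/measurable_funM; last exact: measurable_green_density.
      exact: measurable_indic.
    move=> x _; rewrite /= lee_fin ger0_norm ?mulr_ge0 ?green_density_ge0//.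
    rewrite ger0_norm ?addr_ge0 ?mulr_ge0 ?(ltW C0)//.
    rewrite /green_density mulrDr lerD//.
      by rewrite ler_piMl// indicE; case: (_ \in _).
    by rewrite mulrCA ler_wpM2l ?(ltW C0)// ler_piMr// lern1; case: (_ < _).
  have := integrable_prodM i2 (finite_measure_integrable_cst P 1 measurableT).
  by under eq_fun do rewrite /= mulr1.
have AE : (\int[m]_p (A p)%:E = \int[mu]_(x in I) (green_density x)%:E)%E.
  rewrite -(integral12_prod_meas1 iA) [RHS]integral_mkcond.
  apply: eq_integral => x _; rewrite /fubini_F /A /= integral_cst//.
  rewrite [X in (_ * X)%E](@probability_setT _ _ _ P) mule1 patchE indicE.
  by case: ifP => _; rewrite ?mul1r ?mul0r.
have mB0 : measurable_fun [set: U] B0.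
  apply: measurable_funM; first exact: measurableT_comp mh measurable_fst.
  by apply: measurableT_comp mD; exact: measurable_indic.
have mB1 : measurable_fun [set: U] B1.
  apply: measurable_funM.
    apply: measurable_funM => //.
    by apply: measurableT_comp measurable_fst; exact: measurable_indic.
  by apply: measurableT_comp mB; exact: measurable_indic.
have mB2 : measurable_fun [set: U] B2.
  apply: measurable_funM.
    by apply: measurableT_comp measurable_fst; exact: measurable_indic.
  by apply: measurableT_comp mJ; exact: measurable_indic.
have BE : (\int[m]_p (A p)%:E = \int[m]_p (B0 p + (B1 p + B2 p))%:E)%E.
  transitivity (\int[m]_p (A p - W p)%:E)%E.
    by under [RHS]eq_integral do rewrite EFinB; rewrite integralB// W0 sube0.
  by apply: eq_integral => p _; rewrite AB addrK.
rewrite -AE BE; under eq_integral do rewrite 2!EFinD.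
have B00 p : 0 <= B0 p by rewrite mulr_ge0.
have B10 p : 0 <= B1 p by rewrite !mulr_ge0// ltW.
have B20 p : 0 <= B2 p by rewrite mulr_ge0.
rewrite ge0_integralD//; last 4 first.
- by move=> p _; rewrite lee_fin.
- exact/measurable_EFinP.
- by move=> p _; rewrite -EFinD lee_fin addr_ge0.
- by under eq_fun do rewrite -EFinD; apply/measurable_EFinP; exact: measurable_funD.
rewrite ge0_integralD//; last 4 first.
- by move=> p _; rewrite lee_fin.
- exact/measurable_EFinP.
- by move=> p _; rewrite lee_fin.
- exact/measurable_EFinP.
congr (_ + (_ + _))%E.
- exact: (integral_section_probability P mD mI mh h0).
- apply: (integral_section_probability P mB mpos (k := fun x => C * \1_I x)).
    by apply: measurable_funM => //; exact: measurable_indic.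
  by move=> x; rewrite mulr_ge0// ltW.
- have mk : measurable_fun [set: R] (\1_(`[0, t]%classic) : R -> R).
    exact: measurable_indic.
  rewrite (integral_section_probability P mJ mI mk)//.
  rewrite [RHS]integral_mkcond; apply: eq_integral => x _; rewrite patchE indicE.
  case: ifPn; last by rewrite mul0e.
  rewrite mem_setE in_itv /= => /andP[x0 _].
  by rewrite mul1e /joint_path /= (max_idPl x0).
Qed.

End resolvent.

(** * Potential of intervals and of Borel sets *)

Lemma cvg_integral_vanishing (R : realType) (k : R -> R) (q : nat -> R -> \bar R) :
  (@lebesgue_measure R).-integrable [set: R] (EFin \o k) -> (forall x, 0 <= k x) ->
  (forall n, measurable_fun [set: R] (q n)) -> (forall n x, (0 <= q n x <= 1)%E) ->
  (forall x, q n x @[n --> \oo] --> 0%E) ->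
  (\int[@lebesgue_measure R]_x ((k x)%:E * q n x) @[n --> \oo] --> 0)%E.
Proof.
move=> ik k0 mq q01 cq.
have mk := measurable_int _ ik.
have := @dominated_cvg _ _ _ (@lebesgue_measure R) setT measurableT
  (fun n x => (k x)%:E * q n x)%E (cst 0%E) (EFin \o k).
rewrite integral_cst// mul0e; apply => //.
- by move=> n; exact: (emeasurable_funM mk (mq n)).
- move=> x _; rewrite /cst -[X in _ --> X](mule0 (k x)%:E).
  exact: cvgeZl.
- move=> n x _; have /andP[q0 q1] := q01 n x.
  by rewrite gee0_abs ?mule_ge0 ?lee_fin//= -[leRHS]mule1 lee_wpmul2l ?lee_fin.
Qed.

Section potential_interval.
Variables (R : realType) (d : measure_display) (T : measurableType d)
  (P : probability T R) (X : R -> T -> R) (h : R -> R) (C : R) (Psi : R -> R[i]).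
Local Notation mu := (@lebesgue_measure R).
Local Notation U := (measurableTypeR R * T)%type.
Hypothesis C0 : 0 < C.
Hypothesis h0 : forall x, 0 <= h x.
Hypothesis ih : mu.-integrable [set: R] (EFin \o h).
Hypothesis inv : forall z, z != 0 -> exists hc hs : R,
  [/\ (\int[mu]_x (h x * cos (z * x))%:E = hc%:E)%E,
      (\int[mu]_x (h x * sin (z * x))%:E = hs%:E)%E,
      Psi z != 0 & (Psi z)^-1 = Complex hc (hs - C / z)].
Hypothesis mX : forall t, 0 <= t -> measurable_fun [set: T] (X t).
Hypothesis rcX : forall w t, 0 <= t -> (fun s => X s w) @ t^'+ --> X t w.
Hypothesis charX : has_char_exponent P X Psi.

Lemma drift_second_moment : exists K : R, forall t, 0 <= t ->
  (\int[P]_w ((X t w + C^-1 * t) ^+ 2)%:E <= (K * t)%:E)%E.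
Proof.
have [K [e [e0 Psi_drift]]] := exponent_drift C0 h0 ih inv.
exists (2 * (5 * expR 1 + 1) * K) => t t0.
by apply: (second_moment_le t0 e0 (mX t0) _ _ Psi_drift) => z;
  have [] := charX z t0.
Qed.

Let mXD t : 0 <= t -> measurable_fun [set: T] (fun w => (X t w + C^-1 * t) ^+ 2).
Proof. by move=> t0; apply: measurable_funX; apply: measurable_funD => //; exact: mX. Qed.

(** Domination by the second moment: |x| <= (x + y)^2 + 1 + y for y >= 0, with y = t/C. *)
Lemma integrable_path t : 0 <= t -> P.-integrable [set: T] (EFin \o X t).
Proof.
move=> t0; have [K Kt] := drift_second_moment.
have i2 : P.-integrable [set: T] (fun w => ((X t w + C^-1 * t) ^+ 2)%:E).
  apply/integrableP; split; first by apply/measurable_EFinP; exact: mXD.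
  under eq_integral do rewrite gee0_abs ?lee_fin ?sqr_ge0//.
  by rewrite (le_lt_trans (Kt _ t0))// ltry.
have i3 := finite_measure_integrable_cst P (1 + C^-1 * t) measurableT.
apply: (le_integrable measurableT _ _ (integrableD measurableT i2 i3)).
  by apply/measurable_EFinP; exact: mX.
move=> w _; rewrite /= lee_fin.
have c0 : 0 <= C^-1 * t by rewrite mulr_ge0// invr_ge0 ltW.
rewrite [leRHS]ger0_norm ?addr_ge0 ?sqr_ge0// ler_norml.
move: (X t w) (C^-1 * t) c0 => x y y0.
have q1 := sqr_ge0 (x + y + 2^-1); have q2 := sqr_ge0 (x + y - 2^-1).
by apply/andP; split; nra.
Qed.

(** Chebyshev's inequality around -t/C at t = n + 1: once 2|y| <= t/C, exceeding y is a deviation of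
    at least r = t/(2C), of probability at most K t/r^2, which is of order 1/t. *)
Lemma cvg_drift_negligible (y : R) :
  P [set w | 0 < X n.+1%:R w - y] @[n --> \oo] --> 0%E.
Proof.
have [K Kt] := drift_second_moment.
pose mm := C^-1; have m0 : 0 < mm by rewrite invr_gt0.
have mS n : measurable [set w | 0 < X n.+1%:R w - y].
  have -> : [set w | 0 < X n.+1%:R w - y] = X n.+1%:R @^-1` `]y, +oo[.
    by apply/seteqP; split => w /=; rewrite in_itv /= andbT subr_gt0.
  by rewrite -[X in measurable X]setTI; exact: mX.
have K0 : 0 <= K.
  rewrite -lee_fin -[K in leRHS]mulr1; apply: le_trans (Kt 1 ler01).
  by apply: integral_ge0 => w _; rewrite lee_fin sqr_ge0.
have bound n : 2 * `|y| <= mm * n.+1%:R ->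
    (P [set w | 0%R < X n.+1%:R w - y]%R <= (4 * K / mm ^+ 2 * n.+1%:R^-1)%:E)%E.
  move=> yn; set S := [set w | _]; set r : R := mm * n.+1%:R / 2.
  have r0 : 0 < r by rewrite divr_gt0// mulr_gt0.
  have rE : 4 * K / mm ^+ 2 * n.+1%:R^-1 = (r ^+ 2)^-1 * (K * n.+1%:R).
    rewrite /r; move: (n.+1%:R : R) (ltr0Sn R n) => v v0.
    by field; rewrite !lt0r_neq0.
  rewrite rE EFinM -lee_pdivrMl ?invr_gt0 ?exprn_gt0// invrK.
  apply: le_trans (Kt n.+1%:R _) => //.
  have mSn : measurable S := mS n.
  have mi : measurable_fun [set: T] (fun w => (\1_S w : R)%:E).
    by apply/measurable_EFinP; exact: measurable_indic.
  have r2 : (0 <= (r ^+ 2)%:E :> \bar R)%E by rewrite lee_fin sqr_ge0.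
  have mXn : measurable_fun [set: T] (fun w => ((X n.+1%:R w + C^-1 * n.+1%:R) ^+ 2)%:E).
    by apply/measurable_EFinP; exact: mXD.
  have -> : P S = (\int[P]_w (\1_S w : R)%:E)%E by rewrite integral_indic// setIT.
  rewrite -ge0_integralZl//.
  apply: ge0_le_integral => //.
  - by move=> w _; rewrite mule_ge0.
  - exact: measurable_funeM.
  move=> w _; rewrite -EFinM lee_fin indicE; case: (boolP (w \in S)) => wS /=; last first.
    by rewrite mulr0 sqr_ge0.
  move: wS; rewrite inE /S /= subr_gt0 mulr1 => yX.
  have ry : - r <= y.
    have : `|y| <= r by rewrite /r ler_pdivlMr// mulrC.
    by rewrite ler_norml => /andP[].
  have rr : C^-1 * n.+1%:R = r + r by rewrite /r /mm; field; rewrite lt0r_neq0.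
  rewrite rr ler_pXn2r ?nnegrE ?(ltW r0)//; lra.
have ch : (4 * K / mm ^+ 2 * n.+1%:R^-1)%:E @[n --> \oo] --> 0%E.
  apply: cvg_EFin; first exact: nearW.
  rewrite -[X in _ --> X](mulr0 (4 * K / mm ^+ 2)).
  by apply: cvgM; [exact: cvg_cst|exact: cvg_harmonic].
apply: (squeeze_cvge _ (cvg_cst 0%E) ch).
exists (Num.trunc (2 * `|y| / mm)) => // n /= Nn.
rewrite measure_ge0/=; apply: bound.
have v0 : 0 <= 2 * `|y| / mm by rewrite divr_ge0 ?mulr_ge0// ltW.
have /andP[_ lt] := truncn_itv v0.
rewrite -ler_pdivrMl// mulrC (le_trans (ltW lt))// ler_nat ltnS//.
Qed.

Let mJ := measurable_joint_path mX rcX.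

Lemma measurable_marginal_probability (A : set R) : measurable A ->
  measurable_fun [set t : R | 0 <= t] (fun s => P [set w | A (X s w)]).
Proof.
move=> mA.
have := measurable_funTS (D := [set t : R | 0 <= t]) (measurable_section_probability P mJ mA).
apply: eq_measurable_fun => s; rewrite inE /= => s0.
by rewrite /joint_path /= (max_idPl s0).
Qed.

(** The resolvent identity at t = n + 1, n -> oo. The two terms making up u * P_t vanish by
    dominated convergence and the drift to minus infinity, and the occupation measure increases to
    the potential. *)
Lemma potential_itv (b c : R) : b < c ->
  potential P X `]b, c]%classic = (\int[mu]_(x in `]b, c]) (green_density h C x)%:E)%E.
Proof.
move=> bc; set I := `]b, c]%classic.
have mI : measurable I by exact: measurable_itv.
have n0 n : 0 < n.+1%:R :> R by [].
have E n := resolvent_identity C0 h0 ih inv mX rcX charX (n0 n) (integrable_path (ltW (n0 n))) bc.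
have mX2 n : measurable_fun [set: U] (fun p => X n.+1%:R p.2).
  exact: measurableT_comp (mX (ltW (n0 n))) measurable_snd.
have mD n : measurable_fun [set: U] (fun p => p.1 + X n.+1%:R p.2) by exact: measurable_funD.
have mB n : measurable_fun [set: U] (fun p => X n.+1%:R p.2 - p.1) by exact: measurable_funB.
have mpos : measurable [set y : R | 0 < y].
  have -> : [set y : R | 0 < y] = `]0, +oo[%classic.
    by apply/seteqP; split => y /=; rewrite in_itv /= andbT.
  exact: measurable_itv.
have c1 : (\int[mu]_x ((h x)%:E * P [set w | I (x + X n.+1%:R w)%R]) @[n --> \oo] --> 0)%E.
  apply: cvg_integral_vanishing => //.
  - by move=> n; exact: measurable_section_probability (mD n) mI.
  - move=> n x; rewrite measure_ge0 probability_le1//.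
    exact: (measurable_section (mD n) mI).
  - move=> x; apply: (squeeze_cvge _ (cvg_cst 0%E) (cvg_drift_negligible (b - x))).
    apply: nearW => n; rewrite measure_ge0/=; apply: le_measure.
    + by rewrite inE; exact: (measurable_section (mD n) mI).
    + have := measurable_section (mB n) mpos (b - x).
      by rewrite inE.
    + by move=> w; rewrite /I /= in_itv /= => /andP[+ _]; lra.
have c2 : (\int[mu]_x ((C * \1_I x)%:E * P [set w | (0 < X n.+1%:R w - x)%R]) @[n --> \oo] --> 0)%E.
  apply: cvg_integral_vanishing => //.
  - have iI : mu.-integrable [set: R] (EFin \o (\1_I : R -> R)) := integrable_indic_itv b c false false.
    exact: (integrableZl measurableT C iI).
  - by move=> x; rewrite mulr_ge0// ltW.
  - by move=> n; exact: measurable_section_probability (mB n) mpos.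
  - move=> n x; rewrite measure_ge0 probability_le1//.
    exact: (measurable_section (mB n) mpos).
  - by move=> x; exact: cvg_drift_negligible.
have c3 : (\int[mu]_(s in `[0%R, n.+1%:R]) P [set w | I (X s w)] @[n --> \oo] --> potential P X I)%E.
  have -> : potential P X I = (\int[mu]_(s in \bigcup_n `[0%R, n.+1%:R]%classic) P [set w | I (X s w)])%E.
    rewrite /potential; congr (integral _ _ _); apply/seteqP; split => s /=.
      move=> s0; exists (Num.trunc s) => //=; rewrite in_itv /= s0.
      by have /andP[_ /ltW] := truncn_itv s0.
    by move=> [n _] /=; rewrite in_itv /= => /andP[].
  have H := @ge0_nondecreasing_set_cvg_integral _ (measurableTypeR R) R (fun n => `[0%R, n.+1%:R]%classic)
    (fun s => P [set w | I (X s w)]) mu.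
  apply: H => //.
  - apply/nondecreasing_seqP => n; apply/subsetPset => s /=; rewrite !in_itv /= => /andP[-> sn].
    by rewrite (le_trans sn)// ler_nat.
  - move=> n; apply: measurable_funS (measurable_marginal_probability mI) => //.
      rewrite (_ : [set t : R | 0 <= t] = `[0, +oo[%classic) //.
      by apply/seteqP; split => s /=; rewrite in_itv /= andbT.
    by move=> s /=; rewrite in_itv /= => /andP[].
have def0 (y : \bar R) : (0 +? y)%E by [].
have := cvgeD (def0 _) c1 (cvgeD (def0 _) c2 c3); rewrite !add0e => /(_ _ _) c123.
rewrite -(cvg_lim _ c123)//; apply: cvg_lim => //.
by rewrite -(eq_cvg \oo _ E); exact: cvg_cst.
Qed.

End potential_interval.

(** * From intervals to Borel sets *)

Lemma integral_nonneg_sigma_additive d (T : measurableType d) (R : realType)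
    (m : {measure set T -> \bar R}) (f : T -> \bar R) :
  measurable_fun [set: T] f -> (forall x, (0 <= f x)%E) ->
  semi_sigma_additive (fun A : set T => (\int[m]_(x in A) f x)%E).
Proof.
move=> mf f0 F mF tF mUF.
rewrite (ge0_integral_bigcup m mF (measurable_funTS mf))//.
by apply: is_cvg_nneseries => n _ _; exact: integral_ge0.
Qed.

Section potential_measure.
Variables (R : realType) (d : measure_display) (T : measurableType d)
  (P : probability T R) (X : R -> T -> R).
Local Notation mu := (@lebesgue_measure R).
Hypothesis mX : forall t, 0 <= t -> measurable_fun [set: T] (X t).
Hypothesis mprob : forall A : set R, measurable A ->
  measurable_fun [set t : R | 0 <= t] (fun s => P [set w | A (X s w)]).

Lemma potential_sigma_additive :
  semi_sigma_additive (potential P X : set (measurableTypeR R) -> \bar R).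
Proof.
move=> F mF tF mUF.
have mD : measurable [set t : R | 0 <= t].
  rewrite (_ : [set t : R | 0 <= t] = `[0, +oo[%classic)//.
  by apply/seteqP; split => s /=; rewrite in_itv /= andbT.
have -> : potential P X (\bigcup_n F n) =
    (\sum_(n <oo) potential P X (F n))%E; last first.
  by apply: is_cvg_nneseries => n _ _; exact: integral_ge0.
rewrite /potential -(integral_nneseries mu mD (fun n => mprob (mF n)))//.
apply: eq_integral => t; rewrite inE /= => t0.
have -> : [set w | (\bigcup_n F n) (X t w)] = \bigcup_n (X t @^-1` F n).
  by apply/seteqP; split => w; move=> -[n _ Fn]; exists n.
have mXF n : measurable (X t @^-1` F n) by rewrite -[X in measurable X]setTI; exact: (mX t0 measurableT (mF n)).
have tXF : trivIset [set: nat] (fun n => X t @^-1` F n).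
  apply/trivIsetP => i j _ _ ij; rewrite -preimage_setI.
  by have /trivIsetP/(_ i j I I ij) -> := tF; rewrite preimage_set0.
by apply/esym/cvg_lim => //; exact: (@measure_sigma_additive _ _ _ P _ mXF tXF).
Qed.

End potential_measure.

(** The half-open intervals are stable under intersection and generate the Borel sets, and the ]-n,
    n] exhaust the line with finite mass. *)
Lemma measure_unique_itv (R : realType) (f1 f2 : set (measurableTypeR R) -> \bar R) :
  f1 set0 = 0%E -> (forall A, (0 <= f1 A)%E) -> semi_sigma_additive f1 ->
  f2 set0 = 0%E -> (forall A, (0 <= f2 A)%E) -> semi_sigma_additive f2 ->
  (forall b c : R, b < c -> f1 `]b, c]%classic = f2 `]b, c]%classic) ->
  (forall b c : R, b < c -> (f2 `]b, c]%classic < +oo)%E) ->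
  forall A, measurable A -> f1 A = f2 A.
Proof.
move=> f10 f1ge f1sa f20 f2ge f2sa f12 f2oo A mA.
pose m1 : {measure set (measurableTypeR R) -> \bar R} :=
  HB.pack f1 (isMeasure.Build _ _ _ f1 f10 f1ge f1sa).
pose m2 : {measure set (measurableTypeR R) -> \bar R} :=
  HB.pack f2 (isMeasure.Build _ _ _ f2 f20 f2ge f2sa).
have nn (n : nat) : - n.+1%:R < n.+1%:R :> R by rewrite gtrN.
have mG : @measurable _ (measurableTypeR R) = <<s @ocitv R >> by [].
pose J n : set R := `]- n.+1%:R, n.+1%:R]%classic.
have oJ n : @ocitv R (J n) by exact: is_ocitv.
have JT : \bigcup_n J n = setT.
  apply/seteqP; split => // x _; exists (Num.trunc `|x|) => //=.
  have /andP[_ h] := truncn_itv (normr_ge0 x).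
  have := ler_norm x; have := ler_norm (- x); rewrite normrN /J /= in_itv /=.
  by move=> h1 h2; apply/andP; split; lra.
have m12 B : @ocitv R B -> m1 B = m2 B.
  by move=> /ocitvP[->|[[b c] /= bc ->]]; [rewrite /= f10 f20|exact: f12].
have m1oo n : (m1 (J n) < +oo)%E by rewrite /= f12//; exact: f2oo.
exact: (@measure_unique _ R (measurableTypeR R) _ J mG (@ocitvI R) oJ JT m1 m2 m12 m1oo A mA).
Qed.

(** * The explicit formula and the conclusion *)

Section green_density_formula.
Variables (R : realType) (alpha rho : R).
Hypothesis hal : 1 < alpha < 2.

(** The equality is pointwise, including x = 0: there 0 to the power alpha - 1 is 0, and both sides
    are the sum of the two weights. *)
Lemma u_tildeE x : u_tilde alpha rho x =
  green_density (residual_density alpha (weight_pos alpha rho) (weight_neg alpha rho))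
    (weight_pos alpha rho) x.
Proof.
have [al1 al2] := andP hal.
set c := - (1 / pi) * complex.Re (Gamma (Complex (1 - alpha) 0)).
have cE : c = - (complex.Re (Gamma (1 - alpha)%:C%C) / pi).
  by rewrite /c div1r mulNr mulrC.
have cp : weight_pos alpha rho = c * sin (pi * alpha * rho).
  by rewrite /weight_pos /residue_limit mulrA cE; ring.
have cn : weight_neg alpha rho = c * sin (pi * alpha * (1 - rho)).
  by rewrite /weight_neg /residue_limit mulrA cE; ring.
rewrite /u_tilde -/c -cp -cn /green_density /residual_density.
case: ltgtP => [x0|x0|<-].
- by rewrite /density_pos mulr0 addr0.
- by rewrite /density_neg opprK mulr1 [LHS]addrC [_ * - x]mulrN [- _ * x]mulNr.
- rewrite /density_pos. rewrite oppr0 expR0 subrr powR0 ?mulr0 ?expR0; last first.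
    by rewrite subr_eq0 gt_eqF.
  by rewrite subr0 !mulr1 addr0 mulrDr -cp -cn.
Qed.

End green_density_formula.

Unset Implicit Arguments.

Theorem theorem4p1 (R : realType) (alpha rho : R)
  (d : measure_display) (T : measurableType d) (P : probability T R)
  (X : R -> T -> R) :
  1 < alpha < 2 -> 0 < rho < 1 ->
  0 < alpha * rho < 1 -> 0 < alpha * (1 - rho) < 1 ->
  is_levy_process P X ->
  has_char_exponent P X (Psi_tilde alpha rho) ->
  forall A : set R, measurable A ->
    potential P X A =
    (\int[@lebesgue_measure R]_(x in A) (u_tilde alpha rho x)%:E)%E.
Proof.
move=> hal _ ha hb [mX _ _ _ rcX] charX A mA.
have rc w t : 0 <= t -> (fun s => X s w) @ t^'+ --> X t w.
  by move=> t0; have [] := rcX w t t0.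
pose p := weight_pos alpha rho; pose q := weight_neg alpha rho.
have p0 : 0 < p by exact: weight_pos_gt0.
have q0 : 0 < q by exact: weight_neg_gt0.
pose h := residual_density alpha p q.
have h0 x : 0 <= h x by exact: residual_density_ge0 (ltW p0) (ltW q0) x.
have ih : (@lebesgue_measure R).-integrable setT (EFin \o h).
  exact: integrable_residual (ltW p0) (ltW q0).
have mg : measurable_fun setT (EFin \o green_density h p).
  by apply/measurable_EFinP; exact: measurable_green_density ih.
have g0 x : (0 <= (green_density h p x)%:E)%E by rewrite lee_fin green_density_ge0.
under eq_integral do rewrite (u_tildeE _ hal).
apply: (@measure_unique_itv R (potential P X)
  (fun A => \int[@lebesgue_measure R]_(x in A) (green_density h p x)%:E)%E) => //.
- by rewrite /potential; apply: integral0_eq => t _; exact: measure0.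
- by move=> B; apply: integral_ge0 => t _; exact: measure_ge0.
- apply: potential_sigma_additive => //.
  by move=> B; exact: measurable_marginal_probability.
- by rewrite integral_set0.
- by move=> B; exact: integral_ge0.
- exact: integral_nonneg_sigma_additive.
- by move=> b c bc; apply: potential_itv charX b c bc => //; exact: inverse_exponent.
- move=> b c bc.
  (* A bounded density gives bounded intervals finite mass, as the uniqueness argument requires. *)
  have gM x : green_density h p x <= p + q + p.
    rewrite lerD ?residual_density_le ?(ltW p0) ?(ltW q0)//.
    by rewrite ler_piMr ?(ltW p0)// lern1; case: (_ < _).
  apply: (@le_lt_trans _ _ (\int[@lebesgue_measure R]_(x in `]b, c]%classic) (p + q + p)%:E)%E).
    by apply: ge0_le_integral => //; [exact: measurable_funTS mg|move=> x _; rewrite lee_fin].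
  by rewrite integral_cst//= lebesgue_measure_itv/= lte_fin bc -EFinB -EFinM ltry.
Qed.
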